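(* Let $A$ be a unital C*-algebra and let $\pi: A \to B(H)$ be a non-degenerate representation of $A$ on a Hilbert space $H$ such that the set $\mathrm{WE}(\pi)$ of weak expectations of $\pi$ is non-empty. Let $\phi \in \mathrm{WE}(\pi)$, let $\phi(\cdot) = V^*\rho(\cdot)V$ be the minimal Stinespring dilation of $\phi$ on the Hilbert space $K$, and let $\phi(\cdot) = \langle \sigma(\cdot)e, e\rangle$ be the Paschke dilation of $\phi$ on the Hilbert $\pi(A)''$-module $X$, with associated extension $\tilde\sigma : B(H) \to \mathcal{P}(X')$ and $\hat e \in X'$. Then the following statements are equivalent: (1) $\phi$ is an extreme point of $\mathrm{WE}(\pi)$. (2) For every $t$ with $0<t<1$ and every $\phi_0 \in [0,\phi] \cap t\,\mathrm{WE}(\pi)$, one has $\phi_0 = t\phi$; here $[0,\phi] = \{\theta \in CP(B(H), \pi(A)'') : \phi - \theta \text{ is completely positive}\}$. (3) The subspace $[\rho(\pi(A))VH]$ is a faithful subspace of $K$ for the set of operators $\mathcal{C}^S_\phi$. (4) If $T \in \mathcal{C}^P_\phi$ satisfies $\langle T\tilde\sigma(\pi(a))\hat e, \hat e\rangle = 0$ for all $a \in A$, then $T = 0$.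
   Context: Weak expectations. $\pi(A)''$ denotes the double commutant of $\pi(A)$ in $B(H)$. A weak expectation of $\pi$ is a unital completely positive map $\theta: B(H) \to \pi(A)''$ with $\theta(\pi(a)) = \pi(a)$ for all $a\in A$. $\mathrm{WE}(\pi)$ is the (convex) set of all weak expectations of $\pi$, and $t\,\mathrm{WE}(\pi) = \{t\theta : \theta\in \mathrm{WE}(\pi)\}$. $CP(B(H),\pi(A)'')$ is the set of completely positive maps from $B(H)$ to $\pi(A)''$. Minimal Stinespring dilation. For $\phi\in \mathrm{WE}(\pi)$ (viewed as a map into $B(H)$), this is a triple $(\rho,V,K)$, unique up to unitary equivalence, with $K$ a Hilbert space, $V:H\to K$ bounded linear, $\rho: B(H)\to B(K)$ a unital $*$-homomorphism, $\phi(S) = V^*\rho(S)V$ for all $S\in B(H)$, and $\{\rho(S)Vh : S\in B(H), h\in H\}$ spanning a dense subspace of $K$. $[\rho(\pi(A))VH]$ is the closed linear span of $\{\rho(\pi(a))Vh : a\in A, h\in H\}$. $\rho(B(H))'$ is the commutant in $B(K)$. Paschke dilation. Inner products are linear in the first variable. On the algebraic tensor product $B(H)\otimes \pi(A)''$, a right $\pi(A)''$-module via $(S\otimes T_1)T_2 = S\otimes T_1T_2$, put the $\pi(A)''$-valued sesquilinear form determined by $[S_1\otimes T_1, S_2\otimes T_2] = T_2^*\phi(S_2^*S_1)T_1$, which is positive semidefinite. Let $M = \{x : [x,x]=0\}$, $X_0 = (B(H)\otimes\pi(A)'')/M$ with the induced inner product, and let $X$ be the Hilbert $\pi(A)''$-module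 obtained by completing $X_0$. Let $e = 1_H\otimes 1_H + M$, and let $\sigma: B(H)\to\mathcal{P}(X)$ be the $*$-representation determined by $\sigma(S)(\sum_i S_i\otimes T_i + M) = \sum_i SS_i\otimes T_i + M$, where $\mathcal{P}(X)$ is the C*-algebra of adjointable operators on $X$. Then $\phi(S) = \langle\sigma(S)e,e\rangle$ for all $S\in B(H)$. Let $X'$ be the set of bounded $\pi(A)''$-module maps $\tau: X\to\pi(A)''$ (with the module structure $(\lambda\tau)(x)=\bar\lambda\tau(x)$, $(\tau\cdot b)(x) = b^*\tau(x)$), and for $x\in X$ let $\hat x\in X'$ be $\hat x(y) = \langle y,x\rangle$. Since $\pi(A)''$ is a von Neumann algebra, by a theorem of Paschke the inner product of $X$ (identified with $\{\hat x : x \in X\}\subseteq X'$) extends to $X'$, making $X'$ a self-dual Hilbert $\pi(A)''$-module with $\langle\hat x,\tau\rangle = \tau(x)$ for $x\in X$, $\tau\in X'$; and each $T\in\mathcal{P}(X)$ extends uniquely to $\tilde T\in\mathcal{P}(X')$, the map $T\mapsto\tilde T$ being an injective $*$-homomorphism. Put $\tilde\sigma(S) = \widetilde{\sigma(S)}$; $\tilde\sigma(B(H))'$ is the commutant in $\mathcal{P}(X')$. The sets. $S_\phi$ is the set of $T\in\rho(B(H))'$ with $0\le T\le 1_K$ for which there exist $0<t<1$ and $\theta\in \mathrm{WE}(\pi)$ with $V^*T\rho(\cdot)V = t\theta$. $\mathcal{C}^S_\phi = \{\alpha_1T_1+\alpha_2T_2 : \alpha_1,\alpha_2\in[-1,1],\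 T_1,T_2\in S_\phi\}$. $P_\phi$ is the set of $T\in\tilde\sigma(B(H))'$ with $0\le T\le 1_{X'}$ for which there exist $0<t<1$ and $\theta\in \mathrm{WE}(\pi)$ with $\langle T\tilde\sigma(\cdot)\hat e,\hat e\rangle = t\theta$. $\mathcal{C}^P_\phi = \{\alpha_1T_1+\alpha_2T_2 : \alpha_1,\alpha_2\in[-1,1],\ T_1,T_2\in P_\phi\}$. Faithful subspace. If $H_0$ is a closed subspace of a Hilbert space $L$, $P$ is the orthogonal projection of $L$ onto $H_0$, and $\mathcal{A}\subseteq B(L)$ is a set of operators containing $0$, then $H_0$ is a faithful subspace of $L$ for $\mathcal{A}$ if for every $a\in\mathcal{A}$, $PaP=0$ implies $a=0$. *)

(* Defs.v *)
From HB Require Import structures.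
From mathcomp Require Import all_boot all_order all_algebra.
From mathcomp Require Import sesquilinear complex.
From mathcomp Require Import all_classical all_reals all_analysis.

Set Implicit Arguments.
Unset Strict Implicit.
Unset Printing Implicit Defensive.

Import Order.TTheory GRing.Theory Num.Theory Num.Def.
Import numFieldNormedType.Exports.

Local Open Scope classical_set_scope.
Local Open Scope complex_scope.
Local Open Scope ring_scope.

Reserved Notation "''B' ( H )" (format "''B' ( H )").
Reserved Notation "''B' ( H , K )" (format "''B' ( H ,  K )").
Reserved Notation "S ** T" (at level 40, left associativity).
Reserved Notation "S ^dag" (at level 1, format "S ^dag").

HB.mixin Record isUnitalCstarAlgebra (R : realType) A
    & CompleteNormedModule R[i] A := {
  cstar_mul : A -> A -> A ;
  cstar_one : A ;
  cstar_star : A -> A ;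
  cstar_mulA : associative cstar_mul ;
  cstar_mul1a : left_id cstar_one cstar_mul ;
  cstar_mula1 : right_id cstar_one cstar_mul ;
  cstar_mull : forall a : A, linear (cstar_mul^~ a) ;
  cstar_mulr : forall a : A, linear (cstar_mul a) ;
  cstar_starK : involutive cstar_star ;
  cstar_starP : forall (c : R[i]) (a b : A),
    cstar_star (c *: a + b) = c^* *: cstar_star a + cstar_star b ;
  cstar_starM : forall a b : A,
    cstar_star (cstar_mul a b) = cstar_mul (cstar_star b) (cstar_star a) ;
  cstar_normM : forall a b : A, `|cstar_mul a b| <= `|a| * `|b| ;
  cstar_normE : forall a : A, `|cstar_mul (cstar_star a) a| = `|a| ^+ 2
}.

#[short(type="unitalCstarAlgType")]
HB.structure Definition UnitalCstarAlgebra (R : realType) :=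
  { A of isUnitalCstarAlgebra R A & CompleteNormedModule R[i] A }.

(* A [{dot H for conjC}] is linear in its first argument. *)
HB.mixin Record isHilbert (R : realType) H & CompleteNormedModule R[i] H := {
  inner : {dot H for (@conjC R[i])} ;
  norm_inner : forall x : H, `|x| ^+ 2 = inner x x
}.

#[short(type="hilbertType")]
HB.structure Definition Hilbert (R : realType) :=
  { H of isHilbert R H & CompleteNormedModule R[i] H }.

Section LinearSpaces.
Variables (R : realType) (V : lmodType R[i]).
Implicit Type A : set V.

Definition linear_span A : set V :=
  [set x | exists n (c : 'I_n -> R[i]) (v : 'I_n -> V),
     (forall i, A (v i)) /\ x = \sum_(i < n) c i *: v i].

Definition extreme_point A (x : V) : Prop :=
  A x /\ forall (t : R) y z, 0 < t < 1 -> A y -> A z ->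
    x = t%:C *: y + (1 - t)%:C *: z -> y = x /\ z = x.

Definition two_combinations A : set V :=
  [set x | exists (a1 a2 : R) y1 y2,
     [/\ -1 <= a1 <= 1, -1 <= a2 <= 1, A y1, A y2
       & x = a1%:C *: y1 + a2%:C *: y2]].

End LinearSpaces.

Section BoundedOperators.
Variables (R : realType) (H K : hilbertType R).

Definition bop_pred : {pred H -> K} := fun f =>
  `[< linear f /\ exists M : R[i], forall x, `|f x| <= M * `|x| >].

Record bop := Bop { bop_fun :> H -> K ; bop_funP : bop_fun \in bop_pred }.

HB.instance Definition _ := [isSub for bop_fun].
HB.instance Definition _ := [Choice of bop by <:].

Lemma bop_submod_closed : submod_closed bop_pred.
Proof.
split=> [|a f g /asboolP [fl [M fM]] /asboolP [gl [L gL]]].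
  apply/asboolP; split=> [c x y|]; first by rewrite /= scaler0 addr0.
  by exists 0 => x; rewrite mul0r normr0.
apply/asboolP; split=> [c x y|].
  change (a *: f (c *: x + y) + g (c *: x + y)
          = c *: (a *: f x + g x) + (a *: f y + g y)).
  rewrite fl gl !scalerDr !scalerA (mulrC a c) -!addrA; congr (_ + _).
  by rewrite addrCA.
exists (`|a| * M + L) => x; change (`|a *: f x + g x| <= (`|a| * M + L) * `|x|).
rewrite mulrDl -mulrA (le_trans (ler_normD _ _))// normrZ lerD//.
by rewrite ler_wpM2l.
Qed.

HB.instance Definition _ :=
  GRing.isSubmodClosed.Build _ _ bop_pred bop_submod_closed.
HB.instance Definition _ := [SubChoice_isSubLmodule of bop by <:].

Definition opnorm (T : bop) : R :=
  sup [set complex.Re `|T x| | x in [set x : H | `|x| <= 1]].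

Definition is_adjoint (T : H -> K) (T' : K -> H) : Prop :=
  forall x y, inner (T x) y = inner x (T' y).

End BoundedOperators.

Notation "''B' ( H , K )" := (bop H K) : type_scope.
Notation "''B' ( H )" := (bop H H) : type_scope.

Section Composition.
Variables (R : realType) (H K L : hilbertType R).

Lemma bop_comp_subproof (S : 'B(K, L)) (T : 'B(H, K)) :
  (fun x => S (T x)) \in @bop_pred R H L.
Proof.
case: S => S /= /asboolP [Sl [M SM]]; case: T => T /= /asboolP [Tl [N TN]].
apply/asboolP; split=> [c x y|]; first by rewrite Tl Sl.
exists (`|M| * N) => x; rewrite (le_trans (SM _))// -mulrA.
have M0 : `|T x| = 0 \/ 0 <= M.
  have [->|Tx0] := eqVneq `|T x| 0; first by left.
  right; have := le_trans (normr_ge0 _) (SM (T x)).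
  by rewrite pmulr_lge0// lt_def Tx0 normr_ge0.
case: M0 => [->|M0].
  by rewrite mulr0 mulr_ge0// (le_trans _ (TN x)).
by rewrite ger0_norm// ler_wpM2l.
Qed.

Definition bop_comp (S : 'B(K, L)) (T : 'B(H, K)) : 'B(H, L) :=
  Bop (bop_comp_subproof S T).

Lemma bop_id_subproof : (fun x => x) \in @bop_pred R H H.
Proof.
by apply/asboolP; split=> //; exists 1 => x; rewrite mul1r.
Qed.

Definition bop_id : 'B(H) := Bop bop_id_subproof.

(* The adjoint exists and is unique by the Riesz representation theorem, so
   the default value 0 is never used. *)
Definition adj (T : 'B(H, K)) : 'B(K, H) :=
  xget 0 [set T' : 'B(K, H) | is_adjoint T T'].

End Composition.

Notation "S ** T" := (bop_comp S T) : ring_scope.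
Notation "S ^dag" := (adj S) : ring_scope.
Arguments bop_id {R} H.

Section OperatorNorm.
Variables (R : realType) (H K : hilbertType R).
Implicit Types S T : 'B(H, K).

Lemma opnorm_ub T (x : H) : `|x| <= 1 -> complex.Re `|T x| <= opnorm T.
Proof.
move=> x1; apply: ub_le_sup; last by exists x.
case: T => T /= /asboolP [_ [M TM]]; exists (complex.Re `|M|) => _ [y /= y1 <-].
suff : `|T y| <= `|M| by rewrite lecE => /andP[].
have My0 : 0 <= M * `|y| by exact: le_trans (TM y).
rewrite (le_trans (TM y))// -(ger0_norm My0) normrM normr_id.
by rewrite ler_piMr.
Qed.

Lemma opnorm_le T (M : R) :
  (forall x : H, `|x| <= 1 -> complex.Re `|T x| <= M) -> opnorm T <= M.
Proof.
move=> TM; apply: ge_sup; first by exists (complex.Re `|T 0|), 0; rewrite //= normr0.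
by move=> _ [x /= x1 <-]; exact: TM.
Qed.

Lemma opnormD S T : opnorm (S + T) <= opnorm S + opnorm T.
Proof.
apply: opnorm_le => x x1; have := ler_normD (S x) (T x).
rewrite lecE => /andP[_ /le_trans]; apply.
by rewrite raddfD/= lerD// opnorm_ub.
Qed.

Lemma opnormZ (a : R[i]) T : opnorm (a *: T) <= complex.Re `|a| * opnorm T.
Proof.
apply: opnorm_le => x x1; change (complex.Re `|a *: T x| <= complex.Re `|a| * opnorm T).
have Re_ge0 : 0 <= complex.Re `|a|.
  by have := normr_ge0 a; rewrite lecE => /andP[].
have Im0 : complex.Im `|a| = 0.
  by have := normr_ge0 a; rewrite lecE => /andP[/eqP].
rewrite normrZ; apply: le_trans (ler_wpM2l Re_ge0 (opnorm_ub T x1)).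
by case: (`|a|) Im0 => p q /= ->; case: (`|T x|) => r s /=; rewrite mul0r subr0.
Qed.

End OperatorNorm.

Section Operators.
Variables (R : realType) (H : hilbertType R).
Implicit Types (S T : 'B(H)) (M N : set 'B(H)).

Definition pos_op T : Prop := forall h : H, 0 <= inner (T h) h.

(* Positivity in M_n(B(H)), identified with B(H^n). *)
Definition pos_opmx n (S : 'M['B(H)]_n) : Prop :=
  forall h : 'I_n -> H, 0 <= \sum_i \sum_j inner (S i j (h j)) (h i).

Definition completely_positive (theta : 'B(H) -> 'B(H)) : Prop :=
  linear theta /\
  forall n (S : 'M['B(H)]_n), pos_opmx S -> pos_opmx (map_mx theta S).

Definition CP_into N : set ('B(H) -> 'B(H)) :=
  [set theta | completely_positive theta /\ forall S, N (theta S)].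

Definition commutant M : set 'B(H) :=
  [set T | forall S, M S -> T ** S = S ** T].

End Operators.

Definition star_hom (R : realType) (A : lmodType R[i]) (K : hilbertType R)
    (mul : A -> A -> A) (star : A -> A) (f : A -> 'B(K)) : Prop :=
  [/\ linear f, forall a b, f (mul a b) = f a ** f b
    & forall a, f (star a) = (f a)^dag].

Section Representations.
Variables (R : realType) (A : unitalCstarAlgType R) (H : hilbertType R).

Definition nondegenerate_representation (pi : A -> 'B(H)) : Prop :=
  star_hom (@cstar_mul R A) (@cstar_star R A) pi /\
  closure (linear_span [set x | exists a h, x = pi a h]) = [set: H].

Variable pi : A -> 'B(H).

Definition bicommutant : set 'B(H) := commutant (commutant (range pi)).

Definition WE : set ('B(H) -> 'B(H)) :=
  [set theta | [/\ CP_into bicommutant theta, theta (bop_id H) = bop_id H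
                 & forall a, theta (pi a) = pi a]].

Definition order_interval (phi : 'B(H) -> 'B(H)) : set ('B(H) -> 'B(H)) :=
  [set theta | CP_into bicommutant theta /\ completely_positive (phi - theta)].

End Representations.

Section Stinespring.
Variables (R : realType) (H : hilbertType R).

Record minimal_stinespring (phi : 'B(H) -> 'B(H)) := MinimalStinespring {
  st_space : hilbertType R ;
  st_V : 'B(H, st_space) ;
  st_rho : 'B(H) -> 'B(st_space) ;
  st_star_hom : star_hom (@bop_comp R H H H) (@adj R H H) st_rho ;
  st_unital : st_rho (bop_id H) = bop_id st_space ;
  st_dilation : forall S, phi S = st_V^dag ** st_rho S ** st_V ;
  st_minimal : closure (linear_span
    [set k | exists S h, k = st_rho S (st_V h)]) = [set: st_space]
}.

Definition orthogonal_projection (H0 : set H) (P : 'B(H)) : Prop :=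
  forall x, H0 (P x) /\ forall y, H0 y -> inner (x - P x) y = 0.

Definition faithful_subspace (H0 : set H) (AA : set 'B(H)) : Prop :=
  exists2 P : 'B(H), orthogonal_projection H0 P &
    forall T, AA T -> P ** T ** P = 0 -> T = 0.

End Stinespring.

Section HilbertModules.
Variables (R : realType) (H : hilbertType R) (N : set 'B(H)).

(* N stands for a von Neumann algebra on H. The action of an operator outside N
   is never used. *)
Section Laws.
Variables (X : lmodType R[i]) (act : X -> 'B(H) -> X) (ip : X -> X -> 'B(H)).

Definition module_norm (x : X) : R := Num.sqrt (opnorm (ip x x)).

Record hilbert_module_axioms : Prop := HilbertModuleAxioms {
  hm_actDl : forall b, N b -> linear (act^~ b) ;
  hm_actDr : forall x (c : R[i]) b1 b2, N b1 -> N b2 ->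
    act x (c *: b1 + b2) = c *: act x b1 + act x b2 ;
  hm_actM : forall x b1 b2, N b1 -> N b2 ->
    act x (b1 ** b2) = act (act x b1) b2 ;
  hm_act1 : forall x, act x (bop_id H) = x ;
  hm_ip_mem : forall x y, N (ip x y) ;
  hm_ipDl : forall y, linear (ip^~ y) ;
  hm_ip_act : forall x y b, N b -> ip (act x b) y = ip x y ** b ;
  hm_ip_adj : forall x y, ip y x = (ip x y)^dag ;
  hm_ip_ge0 : forall x, pos_op (ip x x) ;
  hm_ip_eq0 : forall x, ip x x = 0 -> x = 0 ;
  hm_complete : forall u : nat -> X,
    (forall e : R, 0 < e -> exists n, forall i j, (n <= i)%N -> (n <= j)%N ->
       module_norm (u i - u j) < e) ->
    exists l, forall e : R, 0 < e -> exists n, forall i, (n <= i)%N ->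
       module_norm (u i - l) < e
}.

End Laws.

Record hilbert_module := HilbertModule {
  hm_car :> lmodType R[i] ;
  hm_act : hm_car -> 'B(H) -> hm_car ;
  hm_ip : hm_car -> hm_car -> 'B(H) ;
  hm_axioms : hilbert_module_axioms hm_act hm_ip
}.

Definition hm_norm (X : hilbert_module) : X -> R := module_norm (@hm_ip X).

Definition bounded_module_map (X : hilbert_module) : {pred X -> 'B(H)} :=
  fun tau => `[< [/\ forall x, N (tau x), linear tau,
    forall x b, N b -> tau (hm_act x b) = tau x ** b
    & exists M : R, forall x, opnorm (tau x) <= M * hm_norm x] >].

Definition adjoint_pair (X : hilbert_module) (T T' : X -> X) : Prop :=
  forall x y, hm_ip (T x) y = hm_ip x (T' y).

Definition adjointable (X : hilbert_module) : set (X -> X) :=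
  [set T | exists T', adjoint_pair T T'].

(* The positive elements of the C*-algebra P(X), as the products S^* S. *)
Definition pos_adjointable (X : hilbert_module) : set (X -> X) :=
  [set T | exists S S' : X -> X, adjoint_pair S S' /\ T = S' \o S].

End HilbertModules.

Section Dual.
Variables (R : realType) (A : unitalCstarAlgType R) (H : hilbertType R).
Variables (pi : A -> 'B(H)) (X : hilbert_module (bicommutant pi)).

Record dual := Dual {
  dual_fun :> X -> 'B(H) ; dual_funP : dual_fun \in @bounded_module_map _ _ _ X
}.

HB.instance Definition _ := [isSub for dual_fun].
HB.instance Definition _ := [Choice of dual by <:].

Lemma bicommutant_linear (c : R[i]) (S T : 'B(H)) :
  bicommutant pi S -> bicommutant pi T -> bicommutant pi (c *: S + T).
Proof.
move=> NS NT U MU; apply: val_inj; apply/funext => h.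
have SU := congr1 (fun W : 'B(H) => W h) (NS U MU).
have TU := congr1 (fun W : 'B(H) => W h) (NT U MU).
change (c *: S (U h) + T (U h) = U (c *: S h + T h)).
case: U MU SU TU => U /= UP _ SU TU.
by case/asboolP: (UP) => Ul _; rewrite Ul -SU -TU.
Qed.

Lemma dual_submod_closed : submod_closed (@bounded_module_map _ _ _ X).
Proof.
have comp0 (b : 'B(H)) : 0 ** b = 0 by apply: val_inj.
have compP (c : R[i]) (S T b : 'B(H)) :
  (c *: S + T) ** b = c *: (S ** b) + T ** b by apply: val_inj.
split=> [|c f g /asboolP[fN fl fb [B fB]] /asboolP[gN gl gb [D gD]]];
  apply/asboolP; split.
- move=> x U MU; apply: val_inj; apply/funext => h; rewrite /=.
  case: U {MU} => U /= /asboolP[Ul _].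
  change (0 = U 0); have := Ul (-1) 0 0.
  by rewrite scaler0 addr0 scaleN1r addNr => ->.
- by move=> a x y; change (0 = a *: (0 : 'B(H)) + 0); rewrite scaler0 addr0.
- by move=> x b Nb; change (0 = (0 : 'B(H)) ** b); rewrite comp0.
- exists 0 => x; rewrite mul0r; apply: opnorm_le => h _.
  by change (complex.Re `|0 : H| <= 0); rewrite normr0.
- by move=> x; apply: bicommutant_linear; [exact: fN|exact: gN].
- move=> a x y.
  change (c *: f (a *: x + y) + g (a *: x + y)
          = a *: (c *: f x + g x) + (c *: f y + g y)).
  rewrite fl gl !scalerDr !scalerA (mulrC c a) -!addrA; congr (_ + _).
  by rewrite addrCA.
- move=> x b Nb.
  change (c *: f (hm_act x b) + g (hm_act x b) = (c *: f x + g x) ** b).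
  by rewrite fb// gb// compP.
- exists (complex.Re `|c| * B + D) => x; rewrite mulrDl -mulrA.
  apply: le_trans (opnormD _ _) _; apply: lerD; last exact: gD.
  apply: le_trans (opnormZ _ _) _; apply: ler_wpM2l; last exact: fB.
  by have := normr_ge0 c; rewrite lecE => /andP[].
Qed.

HB.instance Definition _ := GRing.isSubmodClosed.Build _ _
  (@bounded_module_map _ _ _ X) dual_submod_closed.
HB.instance Definition _ := [SubChoice_isSubZmodule of dual by <:].

Lemma dual_scale_subproof (c : R[i]) (tau : dual) :
  c^* *: (tau : X -> 'B(H)) \in @bounded_module_map _ _ _ X.
Proof. by apply: rpredZ; case: tau. Qed.

(* (c tau)(x) = c^* tau(x), so that [hat] below is linear. *)
Definition dual_scale (c : R[i]) (tau : dual) : dual :=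
  Dual (dual_scale_subproof c tau).

Lemma dual_scaleA a b tau :
  dual_scale a (dual_scale b tau) = dual_scale (a * b) tau.
Proof. by apply: val_inj; rewrite /= scalerA -rmorphM. Qed.

Lemma dual_scale1 : left_id 1 dual_scale.
Proof. by move=> tau; apply: val_inj; rewrite /= rmorph1 scale1r. Qed.

Lemma dual_scaleDr : right_distributive dual_scale +%R.
Proof. by move=> a t1 t2; apply: val_inj; rewrite /= scalerDr. Qed.

Lemma dual_scaleDl tau : {morph dual_scale^~ tau : a b / a + b}.
Proof. by move=> a b; apply: val_inj; rewrite /= rmorphD/= scalerDl. Qed.

HB.instance Definition _ := GRing.Zmodule_isLmodule.Build R[i] dual
  dual_scaleA dual_scale1 dual_scaleDr dual_scaleDl.

(* The default 0 of [insubd] is not used: b^* tau is a bounded module map for b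
   in pi(A)'', and so is <_, x> by the Cauchy-Schwarz inequality. *)
Definition dual_act (tau : dual) (b : 'B(H)) : dual :=
  insubd (0 : dual) (fun x => b^dag ** tau x).

Definition hat (x : X) : dual := insubd (0 : dual) (fun y => hm_ip y x).

Record selfdual_extension := SelfdualExtension {
  sd_ip : dual -> dual -> 'B(H) ;
  sd_axioms : hilbert_module_axioms (bicommutant pi) dual_act sd_ip ;
  sd_module := HilbertModule sd_axioms ;
  sd_ip_hat : forall (x : X) (tau : dual), sd_ip (hat x) tau = tau x ;
  sd_selfdual : forall f : sd_module -> 'B(H),
    f \in @bounded_module_map _ _ _ sd_module ->
    exists tau : dual, forall psi : dual, f psi = sd_ip psi tau
}.

End Dual.

Section Paschke.
Variables (R : realType) (A : unitalCstarAlgType R) (H : hilbertType R).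
Variables (pi : A -> 'B(H)) (phi : 'B(H) -> 'B(H)).
Local Notation N := (bicommutant pi).

(* [pd_tens S T] is the class of the elementary tensor S (x) T, for T in
   pi(A)''. A vector of X is null iff its inner square is, so by [pd_tens_ip]
   the linear map that pd_tens induces on the algebraic tensor product has
   kernel M: its image is X_0, and X is the completion of X_0. *)
Record paschke_dilation := PaschkeDilation {
  pd_module : hilbert_module N ;
  pd_tens : 'B(H) -> 'B(H) -> pd_module ;
  pd_tensDl : forall T, N T -> linear (pd_tens^~ T) ;
  pd_tensDr : forall S (c : R[i]) T1 T2, N T1 -> N T2 ->
    pd_tens S (c *: T1 + T2) = c *: pd_tens S T1 + pd_tens S T2 ;
  pd_tens_act : forall S T1 T2, N T1 -> N T2 ->
    hm_act (pd_tens S T1) T2 = pd_tens S (T1 ** T2) ;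
  pd_tens_ip : forall S1 T1 S2 T2, N T1 -> N T2 ->
    hm_ip (pd_tens S1 T1) (pd_tens S2 T2)
    = T2^dag ** phi (S2^dag ** S1) ** T1 ;
  pd_dense : forall (x : pd_module) (e : R), 0 < e ->
    exists2 y, linear_span [set z | exists S T, N T /\ z = pd_tens S T] y
             & hm_norm (x - y) < e ;
  pd_sigma : 'B(H) -> pd_module -> pd_module ;
  pd_sigma_linear : linear pd_sigma ;
  pd_sigmaM : forall S1 S2, pd_sigma (S1 ** S2) = pd_sigma S1 \o pd_sigma S2 ;
  pd_sigma_adj : forall S, adjoint_pair (pd_sigma S) (pd_sigma (S^dag)) ;
  pd_sigma_tens : forall S S1 T1, N T1 ->
    pd_sigma S (pd_tens S1 T1) = pd_tens (S ** S1) T1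
}.

Definition pd_e (X : paschke_dilation) : pd_module X :=
  pd_tens X (bop_id H) (bop_id H).

Definition is_sigma_tilde (X : paschke_dilation)
    (X' : selfdual_extension (pd_module X))
    (sigmat : 'B(H) -> sd_module X' -> sd_module X') : Prop :=
  forall S, adjointable (sigmat S) /\
    forall x, sigmat S (hat x) = hat (pd_sigma S x).

End Paschke.

Section Conditions.
Variables (R : realType) (A : unitalCstarAlgType R) (H : hilbertType R).
Variables (pi : A -> 'B(H)) (phi : 'B(H) -> 'B(H)).

Section StinespringSets.
Variable D : minimal_stinespring phi.
Local Notation V := (st_V D).
Local Notation rho := (st_rho D).

Definition S_set : set 'B(st_space D) :=
  [set T | [/\ commutant (range rho) T, pos_op T,
    pos_op (bop_id (st_space D) - T)
    & exists (t : R) theta, [/\ 0 < t < 1, WE pi theta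
      & forall S, V^dag ** T ** rho S ** V = t%:C *: theta S]]].

Definition C_S_set : set 'B(st_space D) := two_combinations S_set.

Definition rho_piA_VH : set (st_space D) :=
  closure (linear_span [set k | exists a h, k = rho (pi a) (V h)]).

End StinespringSets.

Section PaschkeSets.
Variables (X : paschke_dilation pi phi) (X' : selfdual_extension (pd_module X)).
Variable sigmat : 'B(H) -> sd_module X' -> sd_module X'.

Definition e_hat : sd_module X' := hat (pd_e X).

Definition P_set : set (sd_module X' -> sd_module X') :=
  [set T | [/\ adjointable T,
    forall S, T \o sigmat S = sigmat S \o T,
    pos_adjointable T, pos_adjointable (id - T)
    & exists (t : R) theta, [/\ 0 < t < 1, WE pi theta
      & forall S, hm_ip (T (sigmat S e_hat)) e_hat = t%:C *: theta S]]].

Definition C_P_set : set (sd_module X' -> sd_module X') :=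
  two_combinations P_set.

End PaschkeSets.

End Conditions.

Arguments S_set {R A H} pi {phi} D.
Arguments C_S_set {R A H} pi {phi} D.
Arguments rho_piA_VH {R A H} pi {phi} D.
Arguments e_hat {R A H pi phi X} X'.
Arguments P_set {R A H pi phi X X'} sigmat.
Arguments C_P_set {R A H pi phi X X'} sigmat.

(* Main.v *)
(** Let [N = pi(A)''] and [N' = pi(A)'].  If [phi] is extreme and [t theta] lies in
    [[0, phi]], then [phi] is a convex combination of [theta] and of
    [(phi - t theta) / (1 - t)], which gives (2).  An element [T] of [S_phi] or of
    [P_phi] compresses to some [t theta] in [[0, phi]], so under (2) every element
    of [C_phi] compresses to a multiple [c phi]; if the compression vanishes on
    [pi(A)], then [c phi = 0] because [phi (pi 1) = 1], and the element is zero.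
    Conversely, if [phi = t theta + (1 - t) psi], let [T] be the Radon-Nikodym
    derivative of [t theta] on the Stinespring space [K]; then [T - t] belongs to
    [C_phi], its compression vanishes on [pi(A)], and [T = t] gives [theta = phi].

    For the Paschke dilation, [N'] acts on [K] by [S (x) h |-> S (x) b h], and
    self-duality identifies [X'] with the operators [C : H -> K] intertwining the
    two actions of [N'], with inner product [<C, C'> = C'^* C].  Since [theta] has
    values in [N], its derivative [T] and the square roots of [T] and [1 - T]
    commute with [N'] and therefore act on [X'] by composition.

    Positivity of maps and of inner products of families of vectors is reduced to
    square roots of positive operators on [H^n]. *)
Require Import Defs.
From mathcomp Require Import all_boot all_order all_algebra.
From mathcomp Require Import sesquilinear complex ring lra.
From mathcomp Require Import all_classical all_reals all_analysis.

Set Implicit Arguments.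
Unset Strict Implicit.
Unset Printing Implicit Defensive.

Import Order.TTheory GRing.Theory Num.Theory Num.Def.
Import numFieldNormedType.Exports.

Local Open Scope classical_set_scope.
Local Open Scope complex_scope.
Local Open Scope ring_scope.

(** The tests in (3) and (4) see the same data. For an operator commuting with [rho], the
    coefficients between vectors [rho (pi a) (V h)] and [rho (pi b) (V k)] depend only on the value
    of its compression at [pi (b^* a)]; pairing with [e_hat] reads off the compression too. All weak
    expectations agree on [pi(A)], so the scalar [t], which compresses to [t phi], is the natural
    partner of a derivative of [t theta], and the coefficients [1] and [-1] are enough for the
    converse.

    The obstacle is [X'], known only through its axioms. To enter [P_phi], an operator on [X'] must
    be exhibited, together with factorizations [W^* W] of it and of its complement. These are made
    on [K], where positivity is a statement about vectors, and then carried over; this is why every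
    square root comes with a commutation clause.

    Positivity also appears in incompatible shapes: complete positivity tests matrices on arbitrary
    families in [H], while the module axioms test one element of the module against one vector.
    Passing between the two needs roots on [H^n]. *)

Local Notation Re := complex.Re.
Local Notation Im := complex.Im.

(** * Complex scalars *)

Section Complex.
Variable R : realType.
Implicit Types z w : R[i].

(** The norm of [R[i]] is itself [R[i]]-valued; [cabs] is the modulus in [R], where the order is
    total and [lra] and [nra] apply. *)
Definition cabs z : R := Re `|z|.

Lemma cabsE z : `|z| = (cabs z)%:C.
Proof.
have := normr_ge0 z; rewrite /cabs lecE => /andP[/eqP].
by case: (`|z|) => a b /= ->.
Qed.

Lemma cabs_ge0 z : 0 <= cabs z.
Proof. by have := normr_ge0 z; rewrite lecE => /andP[]. Qed.

Lemma cabsD z w : cabs (z + w) <= cabs z + cabs w.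
Proof. by rewrite -lecR rmorphD/= -!cabsE ler_normD. Qed.

Lemma cabs_real (t : R) : cabs t%:C = `|t|.
Proof. by rewrite /cabs normc_def /= expr0n /= addr0 sqrtr_sqr. Qed.

Lemma cabs_eq0 z : cabs z = 0 -> z = 0.
Proof. by move=> z0; apply/eqP; rewrite -normr_eq0 cabsE z0. Qed.

Lemma cabsN z : cabs (- z) = cabs z.
Proof. by rewrite /cabs normrN. Qed.

Lemma conjE z : z^* = Re z -i* Im z.
Proof. by case: z => a b. Qed.

Lemma cabs_conj z : cabs z^* = cabs z.
Proof. by rewrite /cabs -[in RHS]normcJ. Qed.

Lemma cabs_sqr z : cabs z ^+ 2 = Re z ^+ 2 + Im z ^+ 2.
Proof.
by rewrite /cabs normc_def /= sqr_sqrtr // addr_ge0 ?sqr_ge0.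
Qed.

Lemma Re_le_cabs z : Re z <= cabs z.
Proof.
apply: le_trans (ler_norm _) _.
by rewrite -(ler_pXn2r (n := 2)) ?nnegrE ?cabs_ge0// cabs_sqr real_normK ?num_real// lerDl sqr_ge0.
Qed.

Lemma ge0_complexE z : 0 <= z -> z = (Re z)%:C.
Proof. by case: z => a b; rewrite lecE /= => /andP[/eqP ->]. Qed.

Lemma complex_ge0 z : Im z = 0 -> 0 <= Re z -> 0 <= z.
Proof. by case: z => a b /= -> ?; rewrite lecE /= eqxx. Qed.

Lemma complex_ext z w : Re z = Re w -> Im z = Im w -> z = w.
Proof. by case: z => a b; case: w => c d /= -> ->. Qed.

(** With [n] in the role of |b|^2, this is the quadratic of [quad_CS] along [z = - s b^*]. The
    choice [s = 1 / c] is its minimum; for [c = 0] the expression is affine in [s] and can be driven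
    to [-1]. *)
Lemma real_quad_disc (a c n : R) : 0 <= a -> 0 <= c -> 0 <= n ->
  (forall s, 0 <= a - 2 * s * n + s ^+ 2 * n * c) -> n <= a * c.
Proof.
move=> a0 c0 n0 h.
have [c_eq0|cn0] := eqVneq c 0.
  rewrite c_eq0 mulr0 leNgt; apply/negP => np.
  have := h ((a + 1) / (2 * n)); rewrite c_eq0.
  have -> : a - 2 * ((a + 1) / (2 * n)) * n + ((a + 1) / (2 * n)) ^+ 2 * n * 0 = -1.
    by field; lra.
  lra.
have cp : 0 < c by rewrite lt_def cn0.
have := h c^-1.
have -> : a - 2 * c^-1 * n + c^-1 ^+ 2 * n * c = (a * c - n) / c by field.
by rewrite pmulr_lge0 ?invr_gt0 // subr_ge0.
Qed.

(** Common source of Hermitian symmetry and of Cauchy-Schwarz: at [z = 1] and [z = i] the vanishing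
    imaginary parts force [b' = b^*], so symmetry of a positive form is a conclusion. *)
Lemma quad_CS (a b b' c : R[i]) : 0 <= a -> 0 <= c ->
  (forall z, 0 <= a + z * b + z^* * b' + z * z^* * c) ->
  b' = b^* /\ cabs b ^+ 2 <= Re a * Re c.
Proof.
case: a b b' c => [a ai] [b bi] [d di] [c ci].
rewrite !lecE /= => /andP[/eqP -> a0] /andP[/eqP -> c0] h.
have h1 := h 1; have hi := h ('i)%C.
move: h1 hi; rewrite !conjE; simpc.
move=> /andP[/eqP h1 _] /andP[/eqP h2 _].
have e1 : di = - bi by lra.
have e2 : d = b by lra.
split; first by rewrite e1 e2.
rewrite cabs_sqr /=; apply: real_quad_disc => // [|s].
  by rewrite addr_ge0 ?sqr_ge0.
have := h ((- s * b) +i* (s * bi)); rewrite !conjE e1 e2; simpc.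
by move=> /andP[_] /=; congr (0 <= _); ring.
Qed.

End Complex.

(** * Hermitian forms and square roots *)

Section Forms.
Variables (R : realType) (V : lmodType R[i]).
Implicit Types (f : V -> V -> R[i]) (x y : V).

(** A semi-inner product, possibly degenerate, on a bare module, so that the square root below
    applies to ['I_n -> H] as well as to [H]. *)
Definition hform f := [/\ forall c x x' y, f (c *: x + x') y = c * f x y + f x' y,
  forall x y, f y x = (f x y)^* & forall x, 0 <= f x x].

Definition fnorm f x : R := Num.sqrt (Re (f x x)).

Definition fcomplete f := forall u : nat -> V,
  (forall e : R, 0 < e -> exists n, forall i j, (n <= i)%N -> (n <= j)%N ->
     fnorm f (u i - u j) < e) ->
  exists l, forall e : R, 0 < e -> exists n, forall i, (n <= i)%N ->
     fnorm f (u i - l) < e.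

Section HForm.
Variables (f : V -> V -> R[i]) (fH : hform f).

Lemma hformDl x x' y : f (x + x') y = f x y + f x' y.
Proof. by case: fH => h _ _; have := h 1 x x' y; rewrite scale1r mul1r. Qed.

Lemma hform0l y : f 0 y = 0.
Proof. by apply: (addrI (f 0 y)); rewrite -hformDl !addr0. Qed.

Lemma hformZl c x y : f (c *: x) y = c * f x y.
Proof. by case: fH => h _ _; have := h c x 0 y; rewrite !addr0 hform0l addr0. Qed.

Lemma hformC x y : f y x = (f x y)^*.
Proof. by case: fH. Qed.

Lemma hformDr x y y' : f x (y + y') = f x y + f x y'.
Proof. by rewrite hformC hformDl rmorphD/= -!hformC. Qed.

Lemma hformZr c x y : f x (c *: y) = c^* * f x y.
Proof. by rewrite hformC hformZl rmorphM/= -!hformC. Qed.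

Lemma hform0r x : f x 0 = 0.
Proof. by rewrite hformC hform0l rmorph0. Qed.

Lemma hformNl x y : f (- x) y = - f x y.
Proof. by rewrite -scaleN1r hformZl mulN1r. Qed.

Lemma hformNr x y : f x (- y) = - f x y.
Proof. by rewrite hformC hformNl rmorphN/= -hformC. Qed.

Lemma hformBl x x' y : f (x - x') y = f x y - f x' y.
Proof. by rewrite hformDl hformNl. Qed.

Lemma hformBr x y y' : f x (y - y') = f x y - f x y'.
Proof. by rewrite hformDr hformNr. Qed.

Lemma hform_ge0 x : 0 <= f x x. Proof. by case: fH. Qed.

Lemma hform_Re_ge0 x : 0 <= Re (f x x).
Proof. by have := hform_ge0 x; rewrite lecE => /andP[]. Qed.

Lemma fnorm_ge0 x : 0 <= fnorm f x. Proof. exact: sqrtr_ge0. Qed.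

Lemma fnormE x : f x x = (fnorm f x ^+ 2)%:C.
Proof. by rewrite sqr_sqrtr ?hform_Re_ge0// -ge0_complexE ?hform_ge0. Qed.

Lemma hform_CS x y : cabs (f x y) <= fnorm f x * fnorm f y.
Proof.
have [|] := @quad_CS R (f x x) (f y x) (f x y) (f y y) (hform_ge0 _) (hform_ge0 _).
  move=> z; have := hform_ge0 (x + z *: y).
  rewrite hformDl !hformDr !hformZl !hformZr.
  by rewrite -!addrA (addrCA (_^* * f x y)) (mulrA z).
move=> _; rewrite !fnormE /= -exprMn ler_pXn2r ?nnegrE ?cabs_ge0 ?mulr_ge0 ?fnorm_ge0//.
by rewrite hformC cabs_conj.
Qed.

Lemma fnormD x y : fnorm f (x + y) <= fnorm f x + fnorm f y.
Proof.
rewrite -(ler_pXn2r (n := 2)) ?nnegrE ?addr_ge0 ?fnorm_ge0// -lecR -fnormE.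
have Re1 : Re (f x y) <= fnorm f x * fnorm f y.
  exact: le_trans (Re_le_cabs _) (hform_CS x y).
have Re2 : Re (f y x) = Re (f x y) by rewrite hformC; case: (f x y).
rewrite {1}(ge0_complexE (hform_ge0 _)) lecR hformDl !hformDr !raddfD/= Re2 !fnormE /=.
by rewrite sqrrD; lra.
Qed.

Lemma fnormZ c x : fnorm f (c *: x) = cabs c * fnorm f x.
Proof.
apply/eqP; rewrite -(eqrXn2 (n := 2)) ?mulr_ge0 ?fnorm_ge0 ?cabs_ge0//; apply/eqP.
apply: complexI; rewrite -fnormE hformZl hformZr fnormE exprMn mulrA -sqr_normc.
by rewrite cabsE !expr2 !rmorphM.
Qed.

Lemma fnorm0 : fnorm f 0 = 0.
Proof. by rewrite /fnorm hform0l sqrtr0. Qed.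

Lemma fnormN x : fnorm f (- x) = fnorm f x.
Proof. by rewrite -scaleN1r fnormZ cabsN (cabs_real 1) normr1 mul1r. Qed.

Lemma fnormB x y : fnorm f (x - y) = fnorm f (y - x).
Proof. by rewrite -fnormN opprB. Qed.

Lemma fnorm_sym_tri x y z : fnorm f (x - z) <= fnorm f (x - y) + fnorm f (y - z).
Proof. by rewrite (le_trans _ (fnormD _ _))// addrA subrK. Qed.

End HForm.

End Forms.

Section Majorant.
Variable R : realType.

(* Iterates of [y |-> (1 + y^2) / 2]: they increase to its fixed point [1] and
   dominate the operator iteration for the square root below. *)
Fixpoint sqrt_major (n : nat) : R :=
  if n is n'.+1 then (1 + sqrt_major n' ^+ 2) / 2 else 0.

Lemma sqrt_major_ge0 n : 0 <= sqrt_major n.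
Proof. by case: n => //= n; rewrite divr_ge0// addr_ge0// sqr_ge0. Qed.

Lemma sqrt_major_le1 n : sqrt_major n <= 1.
Proof.
elim: n => /= [|n ih]; first exact: ler01.
rewrite ler_pdivrMr// mul1r; have := sqrt_major_ge0 n; nra.
Qed.

Lemma sqrt_majorS n : sqrt_major n <= sqrt_major n.+1.
Proof. by rewrite /= ler_pdivlMr//; have := sqr_ge0 (sqrt_major n - 1); nra. Qed.

Lemma sqrt_major_nd : {homo sqrt_major : m n / (m <= n)%N >-> m <= n}.
Proof. by apply: homo_leq => //; [exact: le_trans|exact: sqrt_majorS]. Qed.

(** Convergence of the majorant drives the Cauchy estimates, and [l <= 1] makes the limit operator a
    contraction. *)
Lemma sqrt_major_sup : exists l : R, [/\ l <= 1, forall n, sqrt_major n <= l &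
  forall e, 0 < e -> exists n, l - sqrt_major n < e].
Proof.
pose E := range sqrt_major.
have E0 : E !=set0 by exists (sqrt_major 0), 0%N.
have ubE : ubound E 1 by move=> _ [n _ <-]; exact: sqrt_major_le1.
have sE : has_sup E by split=> //; exists 1.
exists (sup E); split.
- exact: ge_sup.
- by move=> n; apply: ub_le_sup; [exists 1|exists n].
- move=> e e0; have [_ [n _ <-] h] := sup_adherent e0 sE.
  by exists n; rewrite ltrBlDr addrC -ltrBlDr.
Qed.

End Majorant.

Section FormLimits.
Variables (R : realType) (V : lmodType R[i]) (f : V -> V -> R[i]).
Hypotheses (fH : hform f) (fdef : forall x, f x x = 0 -> x = 0).

Lemma fnorm_eq0 x : fnorm f x <= 0 -> x = 0.
Proof.
move=> x0; apply: fdef; rewrite fnormE//.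
suff -> : fnorm f x = 0 by rewrite expr0n.
by apply/eqP; rewrite eq_le x0 fnorm_ge0.
Qed.

Lemma real_vanish (a C : R) (d : nat -> R) :
  (forall e, 0 < e -> exists n, d n < e) -> 0 <= C ->
  (forall n, a <= C * d n) -> a <= 0.
Proof.
move=> d0 C0 h; rewrite leNgt; apply/negP => a0.
have [n dn] := d0 (a / (C + 1)) (divr_gt0 a0 (ltr_wpDl C0 ltr01)).
have C1 : 0 < C + 1 by lra.
rewrite ltr_pdivlMr// in dn.
have := h n; have [dn0|dn0] := leP 0 (d n); nra.
Qed.

Lemma fnorm_vanish x C (d : nat -> R) :
  (forall e, 0 < e -> exists n, d n < e) -> 0 <= C ->
  (forall n, fnorm f x <= C * d n) -> x = 0.
Proof. by move=> d0 C0 h; apply/fnorm_eq0/(real_vanish d0 C0 h). Qed.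

End FormLimits.

Section SquareRoot.
Variables (R : realType) (V : lmodType R[i]) (f : V -> V -> R[i]).
Hypotheses (fH : hform f) (fdef : forall x, f x x = 0 -> x = 0).
Hypothesis fcomp : fcomplete f.
Variable B : V -> V.
Hypotheses (Blin : linear B) (Bsym : forall x y, f (B x) y = f x (B y)).
Hypotheses (Bge0 : forall x, 0 <= f (B x) x) (Ble1 : forall x, f (B x) x <= f x x).
Local Notation nm := (fnorm f).
Local Notation y_ := (@sqrt_major R).

(** A fixed point [S] of [y |-> (Z + y^2) / 2] satisfies [(1 - S)^2 = 1 - 2 S + S^2 = 1 - Z = B], so
    the root produced is [1 - S]. *)
Let Z x := x - B x.

Let Zlin : linear Z.
Proof. by move=> c x y; rewrite /Z Blin scalerBr opprD addrACA. Qed.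

Let Zsym x y : f (Z x) y = f x (Z y).
Proof. by rewrite /Z hformBl// hformBr// Bsym. Qed.

Let ZH : hform (fun x y => f (Z x) y).
Proof.
split=> [c x x' y|x y|x].
- by rewrite Zlin (hformDl fH) (hformZl fH).
- by rewrite Zsym (hformC fH).
- by rewrite /Z hformBl// subr_ge0.
Qed.

(** Since [0 <= Z <= 1], Cauchy-Schwarz for the form [f (Z x) y] at [x] and [Z x] bounds |Z x|^2 by
    |x| |Z x|. *)
Let Znorm x : nm (Z x) <= nm x.
Proof.
have h := hform_CS ZH x (Z x).
have h1 : nm (Z x) ^+ 2 = cabs (f (Z x) (Z x)).
  by rewrite fnormE// cabs_real ger0_norm// sqr_ge0.
have le z : fnorm (fun x y => f (Z x) y) z <= nm z.
  rewrite /fnorm ler_sqrt ?hform_Re_ge0//.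
  suff : f (Z z) z <= f z z by rewrite lecE => /andP[].
  by rewrite /Z hformBl// gerBl Bge0.
have := le_trans h (ler_pM (fnorm_ge0 _ _) (fnorm_ge0 _ _) (le x) (le (Z x))).
rewrite -h1; have := fnorm_ge0 f (Z x); have := fnorm_ge0 f x; nra.
Qed.

Fixpoint sqrt_iter n : V -> V :=
  if n is n'.+1 then fun x => 2^-1 *: (Z x + sqrt_iter n' (sqrt_iter n' x))
  else fun=> 0.
Local Notation Y := sqrt_iter.

Lemma sqrt_iter_lin n : linear (Y n).
Proof.
elim: n => [|n ih] c x y /=; first by rewrite scaler0 addr0.
rewrite Zlin !ih scalerA mulrC -scalerA -scalerDr; congr (_ *: _).
by rewrite [c *: (Z x + _)]scalerDr addrACA.
Qed.

Let YB n x y : Y n (x - y) = Y n x - Y n y.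
Proof. by have := sqrt_iter_lin n (-1) y x; rewrite !scaleN1r !(addrC (- _)). Qed.

Let half_real : (2^-1 : R[i]) = (2^-1)%:C.
Proof. by rewrite fmorphV /= rmorphMn. Qed.

Let nmhalf x : nm (2^-1 *: x) = 2^-1 * nm x.
Proof. by rewrite fnormZ// half_real cabs_real ger0_norm// invr_ge0. Qed.

Lemma sqrt_iter_norm n x : nm (Y n x) <= y_ n * nm x.
Proof.
elim: n x => [|n ih] x /=; first by rewrite fnorm0// mul0r.
rewrite nmhalf mulrC [X in _ <= X]mulrAC ler_pM2r ?invr_gt0//.
apply: le_trans (fnormD fH _ _) _; rewrite mulrDl mul1r lerD//.
apply: le_trans (ih _) _; rewrite expr2 -mulrA ler_wpM2l ?sqrt_major_ge0//.
Qed.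

Lemma sqrt_iterS n x : nm (Y n.+1 x - Y n x) <= (y_ n.+1 - y_ n) * nm x.
Proof.
elim: n x => [|n ih] x.
  rewrite /= subr0 addr0 nmhalf subr0 expr0n addr0 mul1r.
  by rewrite ler_wpM2l ?invr_ge0.
(* The difference of squares is split as [Y' (Y' - Y) + (Y' - Y) Y], which is valid without
   commuting the iterates; the majorant obeys the same identity. *)
have -> : Y n.+2 x - Y n.+1 x = 2^-1 *: (Y n.+1 (Y n.+1 x - Y n x)
    + (Y n.+1 (Y n x) - Y n (Y n x))).
  rewrite YB addrA subrK [Y n.+2 x]/= [in X in _ - X]/= -scalerBr; congr (_ *: _).
  by rewrite opprD addrACA subrr add0r.
have -> : (y_ n.+2 - y_ n.+1) * nm x =
  2^-1 * (y_ n.+1 * ((y_ n.+1 - y_ n) * nm x) + (y_ n.+1 - y_ n) * (y_ n * nm x)).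
  have yS k : y_ k.+1 = (1 + y_ k ^+ 2) / 2 by [].
  have -> : y_ n.+2 - y_ n.+1 = 2^-1 * (y_ n.+1 ^+ 2 - y_ n ^+ 2).
    by rewrite (yS n.+1) [X in _ - X](yS n); field.
  by field.
rewrite nmhalf ler_wpM2l ?invr_ge0//.
apply: le_trans (fnormD fH _ _) _; apply: lerD.
  by apply: le_trans (sqrt_iter_norm _ _) _; rewrite ler_wpM2l ?sqrt_major_ge0.
apply: le_trans (ih _) _; rewrite ler_wpM2l ?sqrt_iter_norm// subr_ge0.
exact: sqrt_majorS.
Qed.

Lemma sqrt_iter_cauchy n m x : (n <= m)%N -> nm (Y m x - Y n x) <= (y_ m - y_ n) * nm x.
Proof.
elim: m => [|m ih]; first by rewrite leqn0 => /eqP ->; rewrite subrr fnorm0// subrr mul0r.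
rewrite leq_eqVlt ltnS => /predU1P[<-|nm].
  by rewrite !subrr fnorm0// mul0r.
apply: le_trans (fnorm_sym_tri fH _ (Y m x) _) _.
have -> : (y_ m.+1 - y_ n) * fnorm f x =
   (y_ m.+1 - y_ m) * fnorm f x + (y_ m - y_ n) * fnorm f x by ring.
by rewrite lerD// ?ih// sqrt_iterS.
Qed.

Lemma sqrt_iter_lim : exists (S : V -> V) (l : R), [/\ l <= 1, forall n, y_ n <= l,
  forall e, 0 < e -> exists n, l - y_ n < e &
  forall n x, nm (Y n x - S x) <= nm x * (l - y_ n)].
Proof.
have [l [l1 yl ly]] := sqrt_major_sup R.
suff h x : exists v, forall n, nm (Y n x - v) <= nm x * (l - y_ n).
  by have [S hS] := choice h; exists S, l.
have C1 : 0 < nm x + 1 by rewrite ltr_wpDl ?fnorm_ge0.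
have bound i j k e : l - y_ k < e / (nm x + 1) -> 0 < e ->
    (k <= i)%N -> (i <= j)%N -> nm (Y j x - Y i x) < e.
  move=> lk e0 ki ij; apply: le_lt_trans (sqrt_iter_cauchy _ ij) _.
  rewrite ltr_pdivlMr// in lk.
  have := sqrt_major_nd R ki; have := yl j; have := yl k; have := fnorm_ge0 f x.
  nra.
have [e e0|v hv] := fcomp (u := fun n => Y n x).
  have [k lk] := ly (e / (nm x + 1)) (divr_gt0 e0 C1); exists k => i j ki kj.
  have [ij|/ltnW ij] := leqP j i; first exact: bound lk e0 kj ij.
  by rewrite fnormB//; exact: bound lk e0 ki ij.
exists v => n; rewrite -subr_le0.
apply: (@real_vanish _ _ 1 (fun m => nm (Y (n + m)%N x - v))) => // [e e0|m].
  by have [k hk] := hv e e0; exists k; apply: hk; rewrite leq_addl.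
rewrite mul1r lerBlDr; apply: le_trans (fnorm_sym_tri fH _ (Y (n + m)%N x) _) _.
rewrite addrC lerD2l fnormB//.
apply: le_trans (sqrt_iter_cauchy _ (leq_addr _ _)) _.
by rewrite mulrC ler_wpM2l ?fnorm_ge0// lerB.
Qed.

(** Each property holds for the iterates, which are polynomials in [Z], and passes to the limit at
    the rate [l - y_ n]. The commutation clause stands in for functional calculus: it later places
    roots in commutants. *)
Lemma hform_sqrt : exists S : V -> V, [/\ linear S,
  forall x y, f (S x) y = f x (S y), forall x, S (S x) = B x,
  forall x, 0 <= f (S x) x &
  forall G : V -> V, linear G -> (exists M, 0 <= M /\ forall x, nm (G x) <= M * nm x) ->
    (forall x, G (B x) = B (G x)) -> forall x, G (S x) = S (G x)].
Proof.
have [S [l [l1 yl ly hS]]] := sqrt_iter_lim.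
have yl0 n : 0 <= l - y_ n by rewrite subr_ge0.
have hS' n x : nm (S x - Y n x) <= nm x * (l - y_ n) by rewrite fnormB.
have vanish x C : 0 <= C -> (forall n, nm x <= C * (l - y_ n)) -> x = 0.
  exact: fnorm_vanish.
have Slin : linear S.
  move=> c x y; apply/eqP; rewrite -subr_eq0; apply/eqP.
  apply: (vanish _ (nm (c *: x + y) + (cabs c * nm x + nm y))) => [|n].
    by rewrite !addr_ge0 ?mulr_ge0 ?cabs_ge0 ?fnorm_ge0.
  apply: le_trans (fnorm_sym_tri fH _ (Y n (c *: x + y)) _) _.
  rewrite mulrDl lerD//= sqrt_iter_lin opprD addrACA -scalerBr.
  apply: le_trans (fnormD fH _ _) _; rewrite mulrDl lerD//.
  by rewrite fnormZ// -mulrA ler_wpM2l// cabs_ge0.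
have Ysym n x y : f (Y n x) y = f x (Y n y).
  elim: n x y => [|n ih] x y /=; first by rewrite hform0l// hform0r.
  rewrite hformZl// hformZr// hformDl// hformDr// Zsym !ih; congr (_ * _).
  by rewrite half_real conjE /= oppr0.
have Ssym x y : f (S x) y = f x (S y).
  apply/eqP; rewrite -subr_eq0; apply/eqP; apply: cabs_eq0; apply/eqP.
  rewrite eq_le cabs_ge0 andbT.
  apply: (@real_vanish _ _ (2 * nm x * nm y) (fun n => l - y_ n)) => // [|n].
    by rewrite !mulr_ge0 ?fnorm_ge0.
  have -> : f (S x) y - f x (S y) = f (S x - Y n x) y + f x (Y n y - S y).
    by rewrite hformBl// hformBr// Ysym addrA subrK.
  apply: le_trans (cabsD _ _) _.
  have -> : 2 * nm x * nm y * (l - y_ n) =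
    nm x * (l - y_ n) * nm y + nm x * (nm y * (l - y_ n)) by ring.
  apply: lerD; apply: le_trans (hform_CS fH _ _) _.
    by rewrite ler_wpM2r ?fnorm_ge0.
  by rewrite ler_wpM2l ?fnorm_ge0.
have Snorm x : nm (S x) <= nm x.
  have := hS' 0%N x; rewrite /= !subr0 => /le_trans; apply.
  by rewrite ler_piMr ?fnorm_ge0.
have Scomm (G : V -> V) : linear G -> (exists M, 0 <= M /\ forall x, nm (G x) <= M * nm x) ->
    (forall x, G (B x) = B (G x)) -> forall x, G (S x) = S (G x).
  move=> Gl [M [M0 hM]] GB x.
  have GD u v : G (u + v) = G u + G v by have := Gl 1 u v; rewrite !scale1r.
  have GZ c u : G (c *: u) = c *: G u.
    have G0 : G 0 = 0 by apply: (addrI (G 0)); rewrite -GD !addr0.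
    by have := Gl c u 0; rewrite G0 !addr0.
  have GBB u v : G (u - v) = G u - G v by rewrite -scaleN1r GD GZ scaleN1r.
  have GY n u : G (Y n u) = Y n (G u).
    elim: n u => [|n ih] u /=; first by have := GZ 0 0; rewrite !scale0r.
    by rewrite GZ GD /Z GBB GB !ih.
  apply/eqP; rewrite -subr_eq0; apply/eqP.
  apply: (vanish _ (M * nm x + nm (G x))) => [|n].
    by rewrite addr_ge0 ?mulr_ge0 ?fnorm_ge0.
  apply: le_trans (fnorm_sym_tri fH _ (G (Y n x)) _) _.
  rewrite mulrDl lerD//; last by rewrite GY.
  by rewrite -GBB -mulrA (le_trans (hM _))// ler_wpM2l.
have SE x : S x = 2^-1 *: (Z x + S (S x)).
  apply/eqP; rewrite -subr_eq0; apply/eqP.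
  apply: (vanish _ (2 * nm x + nm (S x))) => [|n].
    by rewrite addr_ge0 ?mulr_ge0 ?fnorm_ge0.
  apply: le_trans (fnorm_sym_tri fH _ (Y n.+1 x) _) _.
  rewrite [Y n.+1 x in X in _ + X]/= -scalerBr opprD addrACA subrr add0r nmhalf.
  have h1 : nm (S x - Y n.+1 x) <= nm x * (l - y_ n).
    apply: le_trans (hS' _ _) _; rewrite ler_wpM2l ?fnorm_ge0// lerB//.
    exact: sqrt_majorS.
  have h2 : nm (Y n (Y n x) - S (S x)) <= nm x * (l - y_ n) + nm (S x) * (l - y_ n).
    apply: le_trans (fnorm_sym_tri fH _ (Y n (S x)) _) _.
    rewrite lerD// -YB; apply: le_trans (sqrt_iter_norm _ _) _.
    apply: le_trans (hS n x); rewrite ler_piMl ?fnorm_ge0//.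
    exact: sqrt_major_le1.
  have := fnorm_ge0 f (Y n (Y n x) - S (S x)); lra.
exists (fun x => x - S x); split.
- by move=> c x y; rewrite Slin scalerBr opprD addrACA.
- by move=> x y; rewrite hformBl// hformBr// Ssym.
- move=> x; have SB u v : S (u - v) = S u - S v.
    by have := Slin (-1) v u; rewrite !scaleN1r !(addrC (- _)).
  have two : S x + S x = Z x + S (S x).
    rewrite -mulr2n -scaler_nat {1}SE scalerA divff ?scale1r//.

  rewrite SB.
  have -> : x - S x - (S x - S (S x)) = x - (S x + S x) + S (S x).
    by rewrite opprB opprD !addrA addrAC.
  by rewrite two opprD addrA subrK /Z opprB addrC subrK.
(* [f (S x) x] is real by symmetry and at most |x|^2 because [S] is a contraction, so [1 - S] is
   positive. *)
- move=> x; rewrite hformBl// subr_ge0.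
  have Sxx : (f (S x) x)^* = f (S x) x by rewrite -(hformC fH) Ssym.
  have ImS : Im (f (S x) x) = 0.
    move: Sxx; case: (f (S x) x) => a b /= [] /eqP; rewrite eq_sym -addr_eq0 -mulr2n.
    by rewrite mulrn_eq0 /= => /eqP.
  rewrite lecE ImS fnormE//= eqxx /=.
  apply: le_trans (Re_le_cabs _) _; apply: le_trans (hform_CS fH _ _) _.
  by rewrite expr2 ler_wpM2r ?fnorm_ge0.
- move=> G Gl GM GB x; rewrite -(Scomm G)//.
  by have := Gl (-1) (S x) x; rewrite !scaleN1r !(addrC (- _)).
Qed.

End SquareRoot.

(** * Hilbert spaces *)

Section HilbertForm.
Variables (R : realType) (H : hilbertType R).
Implicit Types x y : H.
Local Notation nm := (fnorm (@inner R H)).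

Lemma inner_hform : hform (@inner R H).
Proof.
split=> [c x x' y|x y|x].
- by rewrite linearPl.
- by rewrite (hermC (@inner R H)) expr0 mul1r.
- exact: dnorm_ge0.
Qed.
Local Notation iH := inner_hform.

Lemma inner_eq0 x : inner x x = 0 -> x = 0.
Proof. by move=> /eqP; rewrite (dnorm_eq0 (@inner R H)) => /eqP. Qed.

Lemma normE x : `|x| = (nm x)%:C.
Proof.
apply/eqP; rewrite -(eqrXn2 (n := 2))// ?lecR ?fnorm_ge0//.
by rewrite norm_inner (fnormE iH) rmorphXn.
Qed.

Lemma inner_complete : fcomplete (@inner R H).
Proof.
move=> u cu.
have : cauchy (u @ \oo).
  apply/cauchy_exP => e e0; rewrite (ge0_complexE (ltW e0)).
  have e1 : 0 < Re e by move: e0; rewrite ltcE => /andP[].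
  have [n hn] := cu _ e1.
  exists (u n), n => // i ni /=.
  by rewrite -ball_normE /= normE ltcR; apply: hn.
move/cauchy_cvgP => cvu; exists (lim (u @ \oo)) => e e0.
have /cvgrPdist_lt /(_ e%:C) := cvu; rewrite ltcR => /(_ e0) [n _ hn].
exists n => i ni; have := hn i ni; rewrite /= normE ltcR.
by rewrite (fnormB iH).
Qed.

Lemma closure_nmP (A : set H) x :
  closure A x <-> forall e : R, 0 < e -> exists2 a, A a & nm (a - x) < e.
Proof.
split=> [cA e e0|h].
  have e1 : 0 < e%:C by rewrite ltcR.
  have [a [Aa]] := cA _ (nbhsx_ballx x _ e1).
  rewrite -ball_normE /= normE ltcR => ae; exists a => //.
  by rewrite (fnormB iH).
move=> U /nbhs_ballP [e /= e0 xU].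
have e1 : 0 < Re e by move: e0; rewrite ltcE => /andP[].
rewrite (ge0_complexE (ltW e0)) in xU.
have [a Aa ae] := h _ e1; exists a; split => //; apply: xU.
by rewrite -ball_normE /= normE ltcR (fnormB iH).
Qed.

Lemma inner_orth_closure (A : set H) x y :
  (forall a, A a -> inner a y = 0) -> closure A x -> inner x y = 0.
Proof.
move=> Ay /closure_nmP cA; apply: cabs_eq0; apply/eqP; rewrite eq_le cabs_ge0 andbT.
rewrite leNgt; apply/negP => h0.
have [a Aa ae] := cA (cabs (inner x y) / (nm y + 1)) (divr_gt0 h0 (ltr_wpDl (fnorm_ge0 _ _) ltr01)).
have : cabs (inner x y) = cabs (inner (a - x) y).
  by rewrite (hformBl iH) (Ay a)// sub0r cabsN.
have y1 : 0 < nm y + 1 by have := fnorm_ge0 (@inner R H) y; lra.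
rewrite ltr_pdivlMr// in ae.
have := hform_CS iH (a - x) y; have := fnorm_ge0 (@inner R H) (a - x).
nra.
Qed.

Lemma dense_eq (A : set H) x y : closure A = setT ->
  (forall a, A a -> inner a x = inner a y) -> x = y.
Proof.
move=> dA h; apply/eqP; rewrite -subr_eq0; apply/eqP/inner_eq0.
apply: (@inner_orth_closure A); last by rewrite dA.
by move=> a Aa; rewrite (hformBr iH) h// subrr.
Qed.

Lemma inner_ext x y : (forall z, inner z x = inner z y) -> x = y.
Proof.
move=> h; apply/eqP; rewrite -subr_eq0; apply/eqP/inner_eq0.
by rewrite (hformBr iH) h subrr.
Qed.

Lemma innerDl x x' y : inner (x + x') y = inner x y + inner x' y.
Proof. exact: hformDl iH _ _ _. Qed.

Lemma innerDr x y y' : inner x (y + y') = inner x y + inner x y'.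
Proof. exact: hformDr iH _ _ _. Qed.

Lemma innerZl c x y : inner (c *: x) y = c * inner x y.
Proof. exact: hformZl iH _ _ _. Qed.

Lemma innerZr c x y : inner x (c *: y) = c^* * inner x y.
Proof. exact: hformZr iH _ _ _. Qed.

Lemma inner0l y : inner 0 y = 0.
Proof. exact: hform0l iH _. Qed.

Lemma inner0r x : inner x 0 = 0.
Proof. exact: hform0r iH _. Qed.

Lemma innerNl x y : inner (- x) y = - inner x y.
Proof. exact: hformNl iH _ _. Qed.

Lemma innerNr x y : inner x (- y) = - inner x y.
Proof. exact: hformNr iH _ _. Qed.

Lemma innerBl x x' y : inner (x - x') y = inner x y - inner x' y.
Proof. exact: hformBl iH _ _ _. Qed.

Lemma innerBr x y y' : inner x (y - y') = inner x y - inner x y'.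
Proof. exact: hformBr iH _ _ _. Qed.

Lemma innerC x y : inner y x = (inner x y)^*.
Proof. exact: hformC iH _ _. Qed.

Lemma inner_ge0 x : 0 <= inner x x.
Proof. exact: hform_ge0 iH _. Qed.

Lemma inner_nm x : inner x x = (nm x ^+ 2)%:C.
Proof. exact: fnormE iH _. Qed.

Lemma inner_CS x y : cabs (inner x y) <= nm x * nm y.
Proof. exact: hform_CS iH _ _. Qed.

Lemma nmD x y : nm (x + y) <= nm x + nm y.
Proof. exact: fnormD iH _ _. Qed.

Lemma nmB x y : nm (x - y) = nm (y - x).
Proof. exact: fnormB iH _ _. Qed.

Lemma nmZ c x : nm (c *: x) = cabs c * nm x.
Proof. exact: fnormZ iH _ _. Qed.

Lemma nm0 : nm (0 : H) = 0.
Proof. exact: fnorm0 iH. Qed.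

End HilbertForm.

(** * Bounded operators *)

Section BopBasics.
Variables (R : realType) (H K : hilbertType R).
Local Notation nm := (fnorm (@inner R _)).
Implicit Types S T : 'B(H, K).

Lemma bop_linear T : linear T.
Proof. by case: T => T /= /asboolP []. Qed.

Lemma bopD T x y : T (x + y) = T x + T y.
Proof. by have := bop_linear T 1 x y; rewrite !scale1r. Qed.

Lemma bop0 T : T 0 = 0.
Proof. by apply: (addrI (T 0)); rewrite -bopD !addr0. Qed.

Lemma bopZ T c x : T (c *: x) = c *: T x.
Proof. by have := bop_linear T c x 0; rewrite bop0 !addr0. Qed.

Lemma bopB T x y : T (x - y) = T x - T y.
Proof. by rewrite -scaleN1r bopD bopZ scaleN1r. Qed.

Lemma bop_sum T (I : Type) (r : seq I) (F : I -> H) :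
  T (\sum_(i <- r) F i) = \sum_(i <- r) T (F i).
Proof. by elim/big_rec2: _ => [|i x y _ <-]; [exact: bop0|rewrite bopD]. Qed.

Lemma bop_bounded T : exists M : R, 0 <= M /\ forall x, nm (T x) <= M * nm x.
Proof.
case: T => T /= /asboolP [_ [M hM]]; exists (cabs M); split; first exact: cabs_ge0.
move=> x; rewrite -lecR rmorphM/= -!normE -cabsE.
have Mx0 : 0 <= M * `|x| by exact: le_trans (hM x).
by rewrite (le_trans (hM x))// -(ger0_norm Mx0) normrM normr_id.
Qed.

Lemma bop_predP (f : H -> K) : linear f ->
  (exists M : R, forall x, nm (f x) <= M * nm x) -> f \in @bop_pred R H K.
Proof.
move=> fl [M hM]; apply/asboolP; split=> //; exists M%:C => x.
by rewrite !normE -rmorphM lecR.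
Qed.

Lemma bop_ext S T : (forall x, S x = T x) -> S = T.
Proof. by move=> h; apply: val_inj; apply/funext. Qed.

Lemma bop_sumE (I : Type) (r : seq I) (F : I -> 'B(H, K)) x :
  (\sum_(i <- r) F i) x = \sum_(i <- r) F i x.
Proof. by elim/big_rec2: _ => // i y1 y2 _ <-. Qed.

End BopBasics.

(** * Riesz representation, adjoints and projections *)

Section Riesz.
Variables (R : realType) (K : hilbertType R).
Local Notation nm := (fnorm (@inner R _)).

(** The functional is a linear relation because later ones are prescribed on lists of tensors: the
    bound makes the value depend only on the vector that a list represents. The domain may be
    neither closed nor dense; that [eta] lies in its closure is what yields orthogonal
    projections. *)
Lemma riesz_relation (G : set (K * R[i])) (M : R) :
  G (0, 0) ->
  (forall c k k' a a', G (k, a) -> G (k', a') -> G (c *: k + k', c * a + a')) ->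
  0 <= M -> (forall k a, G (k, a) -> cabs a <= M * nm k) ->
  exists eta, closure [set k | exists a, G (k, a)] eta /\
    forall k a, G (k, a) -> a = inner k eta.
Proof.
move=> G0 GD M0 GM.
(* eta is the limit of a minimizing sequence of |k|^2 - 2 Re a over G. *)
pose J (p : K * R[i]) := nm p.1 ^+ 2 - 2 * Re p.2.
pose E := J @` G.
have JmC m q : (J q - m)%:C = (nm q.1 ^+ 2)%:C - (q.2 + q.2^*) - m%:C.
  by apply: complex_ext; case: q => u [b c] /=; rewrite /J /=; ring.
have JM p : G p -> - M ^+ 2 <= J p.
  case: p => k a Gka; rewrite /J /=.
  have := GM _ _ Gka; have := Re_le_cabs a.
  by have := sqr_ge0 (nm k - M); nra.
have iE : has_inf E.
  by split; [exists (J (0, 0)), (0, 0)|exists (- M ^+ 2) => _ [p Gp <-]; exact: JM].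
pose m := inf E.
have mJ p : G p -> m <= J p by move=> Gp; apply: ge_inf; [case: iE|exists p].
have near_inf n : exists p, G p /\ J p < m + n.+1%:R^-1.
  have n0 : 0 < n.+1%:R^-1 :> R by rewrite invr_gt0.
  have [_ [p Gp <-] h] := inf_adherent n0 iE.
  by exists p.
have [p hp] := choice near_inf.
(* First-order condition at an approximate minimizer: [J] stays above [m] along [z (k, a) + q], so
   the discriminant bounds the defect [inner k q.1 - a] by the excess [J q - m]. *)
have quad q k a : G q -> G (k, a) ->
    cabs (inner k q.1 - a) ^+ 2 <= (J q - m) * nm k ^+ 2.
  case: q => k0 a0 Gq Gka /=.
  have := @quad_CS R (J (k0, a0) - m)%:C (inner k k0 - a) (inner k k0 - a)^* (nm k ^+ 2)%:C.
  rewrite /= !lecR sqr_ge0 subr_ge0 mJ// => /(_ isT isT) [|_ //].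
  move=> z; have h := mJ _ (GD z k k0 a a0 Gka Gq).
  have nE : (nm (z *: k + k0) ^+ 2)%:C =
      z * z^* * (nm k ^+ 2)%:C + z * inner k k0 + (z * inner k k0)^* + (nm k0 ^+ 2)%:C.
    rewrite -!inner_nm innerDl !innerDr !innerZl !innerZr.
    rewrite (innerC k k0) rmorphM !addrA; congr (_ + _ + _ + _).
    by rewrite mulrA.
  suff -> : (J (k0, a0) - m)%:C + z * (inner k k0 - a) + z^* * (inner k k0 - a)^*
      + z * z^* * (nm k ^+ 2)%:C = (J (z *: k + k0, z * a + a0) - m)%:C.
    by rewrite lecR subr_ge0.
  rewrite !JmC [(_, _).1 in RHS]/= nE.
  rewrite !(rmorphB, rmorphD, rmorphM) /=.
  ring.
have lim_inv (e : R) : 0 < e -> exists n, forall i, (n <= i)%N -> i.+1%:R^-1 < e.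
  move=> e0; have [n hn] := ltr_add_invr (y := 0) (x := e) e0.
  exists n => i ni; rewrite add0r in hn; apply: le_lt_trans hn.
  by rewrite lef_pV2 ?posrE// ler_nat.
(* Parallelogram law: the midpoint of two approximate minimizers also has [J] at least [m], which
   forces them together. *)
have pc i j : nm ((p i).1 - (p j).1) ^+ 2 <= 2 * (i.+1%:R^-1 + j.+1%:R^-1).
  have [Gi Ji] := hp i; have [Gj Jj] := hp j.
  case: (p i) Gi Ji => k a Gi Ji; case: (p j) Gj Jj => k' a' Gj Jj /=.
  have Ga : G (2^-1 *: k + 2^-1 *: k', 2^-1 * a + 2^-1 * a').
    by have := GD 2^-1 _ _ _ _ Gj G0; rewrite !addr0; exact: GD.
  have := mJ _ Ga; move: Ji Jj; rewrite /J /=.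
  have half : (2^-1 : R[i]) = (2^-1)%:C by rewrite fmorphV /= rmorphMn.
  have half2 : (2^-1 : R[i])^* = 2^-1 by rewrite half conjE /= oppr0.
  have ReE : Re (2^-1 * a + 2^-1 * a') = 2^-1 * (Re a + Re a').
    by rewrite half; case: (a) => ? ?; case: (a') => ? ?; simpc; rewrite /= mulrDr.
  have par : nm (k - k') ^+ 2 + 4 * nm (2^-1 *: k + 2^-1 *: k') ^+ 2
      = 2 * nm k ^+ 2 + 2 * nm k' ^+ 2.
    have : inner (k - k') (k - k') + (4 : R)%:C * inner (2^-1 *: k + 2^-1 *: k')
        (2^-1 *: k + 2^-1 *: k') = (2 : R)%:C * inner k k + (2 : R)%:C * inner k' k'.
      have -> : (4 : R)%:C = 4 by rewrite rmorphMn.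
      have -> : (2 : R)%:C = 2 by rewrite rmorphMn.
      rewrite !innerDl !innerDr !innerNl !innerNr.
      rewrite !innerZl !innerZr half2.
      by field.
    by rewrite !inner_nm => /(congr1 (@complex.Re R)) /=; lra.
  rewrite ReE; move: par (i.+1%:R^-1) (j.+1%:R^-1) => + u v; lra.
have [e e0|eta heta] := @inner_complete R K (fun n => (p n).1).
  have e20 : 0 < e ^+ 2 / 4 by rewrite divr_gt0// exprn_gt0.
  have [n hn] := lim_inv _ e20; exists n => i j ni nj.
  rewrite -(ltr_pXn2r (n := 2)) ?nnegrE ?fnorm_ge0 ?(ltW e0)//.
  apply: le_lt_trans (pc i j) _; have := hn i ni; have := hn j nj.
  by move: (i.+1%:R^-1) (j.+1%:R^-1) => u v; lra.
exists eta; split.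
  apply/closure_nmP => e e0; have [n hn] := heta e e0.
  exists (p n).1; last exact: hn.
  by exists (p n).2; have [] := hp n; case: (p n).
move=> k a Gka; apply/eqP; rewrite eq_sym -subr_eq0; apply/eqP/cabs_eq0/eqP.
rewrite eq_le cabs_ge0 andbT leNgt; apply/negP => c0.
set c := cabs _ in c0.
have nk0 := fnorm_ge0 (@inner R K) k.
(* Two errors of at most |k| times this quantity add up to strictly less than [c]; the [+ 1] covers
   [k = 0]. *)
have e0 : 0 < c / (2 * (nm k + 1)) by apply: divr_gt0 => //; lra.
have [n1 h1] := heta _ e0.
have [n2 h2] := lim_inv ((c / (2 * (nm k + 1))) ^+ 2) (exprn_gt0 2 e0).
pose n := maxn n1 n2.
have {}h1 := h1 n (leq_maxl _ _); have {}h2 := h2 n (leq_maxr _ _).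
have [Gn Jn] := hp n.
have q1 : cabs (inner k (p n).1 - a) <= c / (2 * (nm k + 1)) * nm k.
  have b0 : 0 <= c / (2 * (nm k + 1)) * nm k by rewrite mulr_ge0// ltW.
  rewrite -(ler_pXn2r (n := 2)) ?nnegrE ?cabs_ge0// [in leRHS]exprMn.
  apply: le_trans (quad _ _ _ Gn Gka) _; rewrite ler_wpM2r ?sqr_ge0//.
  by apply: le_trans (ltW h2); rewrite lerBlDl ltW.
have q2 : cabs (inner k (eta - (p n).1)) <= nm k * (c / (2 * (nm k + 1))).
  apply: le_trans (inner_CS _ _) _; rewrite ler_wpM2l//.
  by rewrite nmB ltW.
have : c <= cabs (inner k (eta - (p n).1)) + cabs (inner k (p n).1 - a).
  by apply: le_trans (cabsD _ _); rewrite innerBr addrA subrK.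
apply/negP; rewrite -ltNge.
apply: le_lt_trans (lerD q2 q1) _.
have -> : nm k * (c / (2 * (nm k + 1))) + c / (2 * (nm k + 1)) * nm k = c * (nm k / (nm k + 1)).
  by field; lra.
by rewrite gtr_pMr// ltr_pdivrMr ?mul1r; lra.
Qed.

End Riesz.

Section Extension.
Variables (R : realType).
Local Notation nm := (fnorm (@inner R _)).

Lemma dense_norm_bound (H : hilbertType R) (A : set H) (x : H) (C : R) :
  closure A = setT -> 0 <= C ->
  (forall a, A a -> cabs (inner a x) <= C * nm a) -> nm x <= C.
Proof.
move=> dA C0 h; rewrite leNgt; apply/negP => Cx.
have Ax : closure A x by rewrite dA.
have n0 := fnorm_ge0 (@inner R H) x.
(* If |a - x| < d, the hypothesis gives |x|^2 <= C (|x| + d) + d |x|; this [d] is small enough to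
   contradict [C < |x|]. *)
have d0 : 0 < nm x * (nm x - C) / (C + nm x + 1).
  by apply: divr_gt0; [apply: mulr_gt0; lra|lra].
have /closure_nmP /(_ _ d0) [a Aa] := Ax.
rewrite ltr_pdivlMr; last by lra.
have h1 := h a Aa.
have h2 : nm x ^+ 2 <= cabs (inner a x) + cabs (inner (a - x) x).
  have -> : nm x ^+ 2 = cabs (inner x x) by rewrite inner_nm cabs_real ger0_norm// sqr_ge0.
  have -> : inner x x = inner a x - inner (a - x) x.
    by rewrite innerBl opprB addrCA subrr addr0.
  by rewrite (le_trans (cabsD _ _))// cabsN.
have h3 := inner_CS (a - x) x.
have h4 : nm a <= nm (a - x) + nm x by rewrite -{1}(subrK x a) nmD.
have := fnorm_ge0 (@inner R H) (a - x).
nra.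
Qed.

(** [W y] is the Riesz vector of the functional [k |-> inner l y] on the domain of [G]; density of
    the domain makes it unique, hence [W] linear and bounded. *)
Lemma adjoint_relation (K1 K2 : hilbertType R) (G : set (K1 * K2)) (M : R) :
  G (0, 0) ->
  (forall c k k' l l', G (k, l) -> G (k', l') -> G (c *: k + k', c *: l + l')) ->
  0 <= M -> (forall k l, G (k, l) -> nm l <= M * nm k) ->
  closure [set k | exists l, G (k, l)] = setT ->
  exists W : 'B(K2, K1), forall k l y, G (k, l) -> inner l y = inner k (W y).
Proof.
move=> G0 GD M0 GM dG.
have ex y : exists eta, forall k l, G (k, l) -> inner l y = inner k eta.
  pose Gy := [set p : K1 * R[i] | exists2 l, G (p.1, l) & p.2 = inner l y].
  have [||||eta [_ heta]] := @riesz_relation R K1 Gy (M * nm y).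
  - by exists 0 => //=; rewrite inner0l.
  - move=> c k k' a a' [l /= Gl ->] [l' /= Gl' ->]; exists (c *: l + l') => /=.
      exact: GD.
    by rewrite innerDl innerZl.
  - by rewrite mulr_ge0// fnorm_ge0.
  - move=> k a [l /= Gl ->]; apply: le_trans (inner_CS _ _) _.
    by rewrite mulrAC ler_wpM2r ?fnorm_ge0 ?GM.
  by exists eta => k l Gkl; apply: heta; exists l.
have [W hW] := choice ex.
have Wl : linear W.
  move=> c x y; apply: (dense_eq dG) => k [l Gkl].
  rewrite -(hW _ _ _ Gkl) !innerDr !innerZr.
  by rewrite (hW _ _ _ Gkl) (hW _ _ _ Gkl).
have Wb : exists M : R, forall x, nm (W x) <= M * nm x.
  exists M => x; apply: (dense_norm_bound dG); first by rewrite mulr_ge0// fnorm_ge0.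
  move=> k [l Gkl]; rewrite -(hW _ _ _ Gkl); apply: le_trans (inner_CS _ _) _.
  by rewrite mulrAC ler_wpM2r ?fnorm_ge0 ?(GM _ _ Gkl).
by exists (Bop (bop_predP Wl Wb)) => k l y; exact: hW.
Qed.

Lemma adj_ex (H K : hilbertType R) (T : 'B(H, K)) : exists T' : 'B(K, H), is_adjoint T T'.
Proof.
have [M [M0 hM]] := bop_bounded T.
have [||||W hW] := @adjoint_relation H K [set p | p.2 = T p.1] M _ _ M0.
- by rewrite /= bop0.
- by move=> c k k' l l' /= -> ->; rewrite bopD bopZ.
- by move=> k l /= ->.
- apply/seteqP; split=> // x _; apply: subset_closure; by exists (T x).
by exists W => x y; apply: hW.
Qed.

Lemma adjP (H K : hilbertType R) (T : 'B(H, K)) : is_adjoint T (T^dag).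
Proof. by rewrite /adj; case: xgetP => [T' -> //|h]; have [T' /h] := adj_ex T. Qed.

Lemma adjPr (H K : hilbertType R) (T : 'B(H, K)) x y :
  inner y (T x) = inner (T^dag y) x.
Proof. by rewrite innerC adjP -innerC. Qed.

Lemma adj_uniq (H K : hilbertType R) (T : 'B(H, K)) (T' : 'B(K, H)) :
  is_adjoint T T' -> T^dag = T'.
Proof.
by move=> h; apply: bop_ext => y; apply: inner_ext => x; rewrite -adjP h.
Qed.

Lemma adjK (H K : hilbertType R) (T : 'B(H, K)) : T^dag^dag = T.
Proof. by apply: adj_uniq => x y; rewrite adjPr. Qed.

Lemma adj_inj (H K : hilbertType R) : injective (@adj R H K).
Proof. by move=> S T ST; rewrite -(adjK S) ST adjK. Qed.

Lemma adj_comp (H K L : hilbertType R) (S : 'B(K, L)) (T : 'B(H, K)) :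
  (S ** T)^dag = T^dag ** S^dag.
Proof. by apply: adj_uniq => x y; rewrite /= !adjP. Qed.

Lemma adj_linear (H K : hilbertType R) c (S T : 'B(H, K)) :
  (c *: S + T)^dag = c^* *: S^dag + T^dag.
Proof.
apply: adj_uniq => x y.
change (inner (c *: S x + T x) y = inner x (c^* *: S^dag y + T^dag y)).
rewrite innerDl innerZl innerDr innerZr -!adjP.
by congr (_ * _ + _); rewrite conjCK.
Qed.

Lemma adjD (H K : hilbertType R) (S T : 'B(H, K)) : (S + T)^dag = S^dag + T^dag.
Proof. by have := adj_linear 1 S T; rewrite !scale1r rmorph1 scale1r. Qed.

Lemma adj0 (H K : hilbertType R) : (0 : 'B(H, K))^dag = 0.
Proof. by apply: (addrI (0 : 'B(H, K))^dag); rewrite -adjD !addr0. Qed.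

Lemma adj_scale (H K : hilbertType R) c (T : 'B(H, K)) : (c *: T)^dag = c^* *: T^dag.
Proof. by have := adj_linear c T 0; rewrite adj0 !addr0. Qed.

Lemma adjB (H K : hilbertType R) (S T : 'B(H, K)) : (S - T)^dag = S^dag - T^dag.
Proof. by rewrite -scaleN1r adjD adj_scale rmorphN1 scaleN1r. Qed.

Lemma adj_id (H : hilbertType R) : (bop_id H)^dag = bop_id H.
Proof. by apply: adj_uniq => x y. Qed.

(** Extension by continuity, obtained as the adjoint of the adjoint instead of through limits of
    sequences. The bound also supplies well-definedness, so operators on [K] can be prescribed on
    lists of tensors. *)
Lemma bop_extension (K1 K2 : hilbertType R) (G : set (K1 * K2)) (M : R) :
  G (0, 0) ->
  (forall c k k' l l', G (k, l) -> G (k', l') -> G (c *: k + k', c *: l + l')) ->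
  0 <= M -> (forall k l, G (k, l) -> nm l <= M * nm k) ->
  closure [set k | exists l, G (k, l)] = setT ->
  exists U : 'B(K1, K2), forall k l, G (k, l) -> U k = l.
Proof.
move=> G0 GD M0 GM dG.
have [W hW] := adjoint_relation G0 GD M0 GM dG.
exists W^dag => k l Gkl; apply: inner_ext => y.
by rewrite adjPr adjK innerC -(hW _ _ _ Gkl) -innerC.
Qed.

Lemma dense_bop_eq (H K : hilbertType R) (A : set H) (S T : 'B(H, K)) :
  closure A = setT -> (forall a, A a -> S a = T a) -> S = T.
Proof.
move=> dA ST; apply: adj_inj; apply: bop_ext => y; apply: (dense_eq dA) => a Aa.
by rewrite -!adjP ST.
Qed.

Lemma inner_linear_span (H : hilbertType R) (A : set H) (y : H) :
  (forall a, A a -> inner a y = 0) -> forall x, closure (linear_span A) x -> inner x y = 0.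
Proof.
move=> h x; apply: inner_orth_closure => _ [n [c [v [Av ->]]]].
elim/big_rec: _ => [|i z _ z0]; first by rewrite inner0l.
by rewrite innerDl innerZl h// mulr0 add0r.
Qed.

Lemma linear_span_sub (H : hilbertType R) (A : set H) : A `<=` linear_span A.
Proof.
move=> x Ax; exists 1%N, (fun=> 1), (fun=> x); split => //.
by rewrite big_ord1 scale1r.
Qed.

Lemma span_bop_eq (H K : hilbertType R) (A : set H) (S T : 'B(H, K)) :
  closure (linear_span A) = setT -> (forall a, A a -> S a = T a) -> S = T.
Proof.
move=> dA ST; apply: (dense_bop_eq dA) => _ [n [c [v [Av ->]]]].
by rewrite !bop_sum; apply: eq_bigr => i _; rewrite !bopZ ST.
Qed.

Lemma linear_span_comb (H : hilbertType R) (A : set H) c x y :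
  linear_span A x -> linear_span A y -> linear_span A (c *: x + y).
Proof.
move=> [n [a [v [Av ->]]]] [m [b [w [Aw ->]]]].
exists (n + m)%N, (fun i => match fintype.split i with inl j => c * a j | inr j => b j end),
  (fun i => match fintype.split i with inl j => v j | inr j => w j end).
split=> [i|]; first by case: (fintype.split i).
rewrite big_split_ord /= scaler_sumr; congr (_ + _); apply: eq_bigr => i _.
  by rewrite (unsplitK (inl _)) scalerA.
by rewrite (unsplitK (inr _)).
Qed.

Lemma projection_ex (H : hilbertType R) (A : set H) :
  exists P : 'B(H), orthogonal_projection (closure (linear_span A)) P.
Proof.
pose L := linear_span A.
have L0 : L 0 by exists 0%N, (fun=> 0), (fun=> 0); split=> [[]//|]; rewrite big_ord0.
have ex x : exists p, closure L p /\ forall y, L y -> inner y x = inner y p.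
  pose G := [set q : H * R[i] | L q.1 /\ q.2 = inner q.1 x].
  have [||||p [cp hp]] := @riesz_relation R H G (nm x).
  - by split=> //=; rewrite inner0l.
  - move=> c k k' a a' [/= Lk ->] [/= Lk' ->]; split=> /=; first exact: linear_span_comb.
    by rewrite innerDl innerZl.
  - exact: fnorm_ge0.
  - by move=> k a [/= _ ->]; rewrite mulrC; exact: inner_CS _ _.
  exists p; split; last by move=> y Ly; apply: hp.
  by move: cp; apply: closureS => k [a []].
have [P hP] := choice ex.
have orth x y : closure L y -> inner y (x - P x) = 0.
  apply: inner_orth_closure => z Lz.
  by rewrite innerBr (proj2 (hP x) _ Lz) subrr.
have cL c x y : closure L x -> closure L y -> closure L (c *: x + y).
  move=> /closure_nmP Lx /closure_nmP Ly; apply/closure_nmP => e e0.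
  have d0 : 0 < e / (cabs c + 1) / 2.
    by rewrite !divr_gt0//; have := cabs_ge0 c; lra.
  have [a La ae] := Lx _ d0; have [b Lb be] := Ly (e / 2) ltac:(lra).
  exists (c *: a + b); first exact: linear_span_comb.
  rewrite opprD addrACA -scalerBr; apply: le_lt_trans (nmD _ _) _.
  rewrite nmZ.
  have c0 := cabs_ge0 c.
  have : cabs c * nm (a - x) <= e / 2.
    apply: le_trans (ler_wpM2l c0 (ltW ae)) _.
    have -> : cabs c * (e / (cabs c + 1) / 2) = (cabs c / (cabs c + 1)) * (e / 2).
      by field; lra.
    rewrite ler_piMl//; first by lra.
    by rewrite ler_pdivrMr; lra.
  lra.
have Pl : linear P.
  move=> c x y; apply/eqP; rewrite -subr_eq0; apply/eqP/inner_eq0.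
  (* The defect of linearity of [P] lies in the closed span by [Ld] and is orthogonal to it by
     [dE]. *)
  set d := (X in inner X X).
  have Ld : closure L d.
    have -> : d = (-1) *: (c *: P x + P y) + P (c *: x + y) by rewrite scaleN1r addrC.
    apply: (cL); last by have [] := hP (c *: x + y).
    by apply: (cL); [have [] := hP x|have [] := hP y].
  have dE : d = c *: (x - P x) + (y - P y) - (c *: x + y - P (c *: x + y)).
    by rewrite /d scalerBr addrACA -opprD opprB [RHS]addrC addrA subrK.
  rewrite {2}dE innerBr innerDr innerZr !orth//.
  by rewrite mulr0 addr0 subrr.
have Pb : exists M : R, forall x, nm (P x) <= M * nm x.
  exists 1 => x; rewrite mul1r.
  have [->|p0] := eqVneq (nm (P x)) 0; first exact: fnorm_ge0.
  have pp : 0 < nm (P x) by rewrite lt_def p0 fnorm_ge0.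
  have : nm (P x) ^+ 2 <= nm (P x) * nm x.
    apply: le_trans (inner_CS (P x) x).
    have -> : inner (P x) x = inner (P x) (P x).
      apply/eqP; rewrite -subr_eq0 -innerBr orth//.
      by have [] := hP x.
    by rewrite inner_nm cabs_real ger0_norm// sqr_ge0.
  by rewrite expr2 ler_pM2l.
exists (Bop (bop_predP Pl Pb)) => x; split; first by have [] := hP x.
by move=> y Ly; rewrite innerC orth// rmorph0.
Qed.

End Extension.

(** * Positive operators and operator matrices *)

Section Positive.
Variable R : realType.
Local Notation nm := (fnorm (@inner R _)).
Local Notation iH := (inner_hform _).

Lemma pos_sesq_hform (V : lmodType R[i]) (f : V -> V -> R[i]) :
  (forall c x x' y, f (c *: x + x') y = c * f x y + f x' y) ->
  (forall c x y y', f x (c *: y + y') = c^* * f x y + f x y') ->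
  (forall x, 0 <= f x x) -> hform f.
Proof.
move=> fl fr f0; split=> // x y.
have [] := @quad_CS R (f x x) (f x y) (f y x) (f y y) (f0 _) (f0 _) => // z.
have := f0 (z^* *: y + x); rewrite fl !fr.
have -> : (z^*)^* = z by exact: conjCK.
by rewrite (_ : forall a b c d e g : R[i], a * (b * c + d) + (b * e + g)
  = g + b * e + a * d + b * a * c) // => *; ring.
Qed.

Lemma pos_op_hform (H : hilbertType R) (T : 'B(H)) : pos_op T ->
  hform (fun x y => inner (T x) y).
Proof.
move=> T0; apply: pos_sesq_hform => // c x y z.
  by rewrite bopD bopZ innerDl innerZl.
by rewrite innerDr innerZr.
Qed.

Lemma pos_op_adj (H : hilbertType R) (T : 'B(H)) : pos_op T -> T^dag = T.
Proof.
by move=> /pos_op_hform TH; apply: adj_uniq => x y; rewrite [RHS]innerC -(hformC TH).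
Qed.

Lemma bop_sqrt (H : hilbertType R) (T : 'B(H)) :
  pos_op T -> pos_op (bop_id H - T) ->
  exists S : 'B(H), [/\ S^dag = S, S ** S = T &
    forall G : 'B(H), G ** T = T ** G -> G ** S = S ** G].
Proof.
move=> T0 T1.
have Tadj x y : inner (T x) y = inner x (T y) by rewrite adjP pos_op_adj.
have T1' x : inner (T x) x <= inner x x.
  have : 0 <= inner (x - T x) x by exact: (T1 x).
  by rewrite innerBl subr_ge0.
have [S [Sl Ss SS _ SG]] := hform_sqrt iH (@inner_eq0 R H) (@inner_complete R H)
  (bop_linear T) Tadj T0 T1'.
have Sb : exists M : R, forall x, nm (S x) <= M * nm x.
  exists 1 => x; rewrite mul1r ler_sqrt ?(hform_Re_ge0 iH)//.
  by rewrite -Ss SS; move: (T1' x); rewrite lecE => /andP[].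
exists (Bop (bop_predP Sl Sb)); split.
- by apply: adj_uniq => x y; rewrite /= Ss.
- exact: bop_ext.
- move=> G GT; apply: bop_ext => x /=; apply: SG; first exact: bop_linear.
    exact: bop_bounded.
  by move=> y; have := congr1 (fun W : 'B(H) => W y) GT.
Qed.

Lemma opnorm_ge0 (H K : hilbertType R) (T : 'B(H, K)) : 0 <= opnorm T.
Proof.
apply: le_trans (@opnorm_ub R H K T 0 _); last by rewrite normr0.
by rewrite bop0 normr0.
Qed.

Lemma opnorm_bound (H K : hilbertType R) (T : 'B(H, K)) x :
  nm (T x) <= opnorm T * nm x.
Proof.
have [x0|x0] := eqVneq (nm x) 0.
  have -> : x = 0 by apply: (fnorm_eq0 iH (@inner_eq0 R H)); rewrite x0.
  by rewrite bop0 !nm0 mulr0.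
have xp : 0 < nm x by rewrite lt_def x0 fnorm_ge0.
have := @opnorm_ub R H K T ((nm x)^-1%:C *: x).
rewrite !normE /= bopZ !nmZ cabs_real ger0_norm ?invr_ge0 ?(ltW xp)//.
by rewrite mulVf// lexx => /(_ isT); rewrite mulrC ler_pdivrMr.
Qed.

Lemma opnorm_leP (H K : hilbertType R) (T : 'B(H, K)) (M : R) : 0 <= M ->
  (forall x, nm (T x) <= M * nm x) -> opnorm T <= M.
Proof.
move=> M0 h; apply: opnorm_le => x; rewrite !normE lecR /= => x1.
by apply: le_trans (h x) _; rewrite ler_piMr.
Qed.

Lemma opnorm_eq0 (H K : hilbertType R) (T : 'B(H, K)) : opnorm T <= 0 -> T = 0.
Proof.
move=> T0; apply: bop_ext => x; apply: (fnorm_eq0 iH (@inner_eq0 R K)).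
apply: le_trans (opnorm_bound T x) _.
by rewrite mulr_le0_ge0// fnorm_ge0.
Qed.

End Positive.

Section PowerSpace.
Variables (R : realType) (H : hilbertType R) (n : nat).
Local Notation nm := (fnorm (@inner R _)).
Local Notation V := ('I_n -> H).

Definition pinner (x y : V) : R[i] := \sum_i inner (x i) (y i).
Local Notation pn := (fnorm pinner).

Lemma pinner_hform : hform pinner.
Proof.
split=> [c x x' y|x y|x].
- rewrite /pinner mulr_sumr -big_split; apply: eq_bigr => i _ /=.
  change (inner (c *: x i + x' i) (y i) = c * inner (x i) (y i) + inner (x' i) (y i)).
  by rewrite innerDl innerZl.
- by rewrite /pinner rmorph_sum; apply: eq_bigr => i _; exact: innerC.
- by apply: sumr_ge0 => i _; rewrite inner_ge0.
Qed.
Local Notation pH := pinner_hform.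

Lemma pinner_eq0 x : pinner x x = 0 -> x = 0.
Proof.
move=> /eqP; rewrite psumr_eq0 => [/allP h|i _]; last exact: inner_ge0.
apply/funext => i; apply: inner_eq0; apply/eqP; apply: h.
by rewrite mem_index_enum.
Qed.

Lemma pnorm_sqr x : pn x ^+ 2 = \sum_i nm (x i) ^+ 2.
Proof.
apply: complexI; rewrite -(fnormE pH) rmorph_sum; apply: eq_bigr => i _ /=.
by rewrite inner_nm.
Qed.

Lemma pnorm_ge x i : nm (x i) <= pn x.
Proof.
rewrite -(ler_pXn2r (n := 2)) ?nnegrE ?fnorm_ge0// pnorm_sqr (bigD1 i)//= lerDl.
by apply: sumr_ge0 => j _; rewrite sqr_ge0.
Qed.

Lemma pnorm_le x : pn x <= \sum_i nm (x i).
Proof.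
have s0 (r : seq 'I_n) : 0 <= \sum_(i <- r) nm (x i).
  by apply: sumr_ge0 => i _; exact: fnorm_ge0.
rewrite -(ler_pXn2r (n := 2)) ?nnegrE ?fnorm_ge0// pnorm_sqr.
elim: (index_enum _) => [|i r ih]; first by rewrite !big_nil expr0n.
rewrite !big_cons; have := s0 r; have := fnorm_ge0 (@inner R H) (x i).
nra.
Qed.

Lemma pinner_complete : fcomplete pinner.
Proof.
move=> u cu.
have ex i : exists l, forall e : R, 0 < e -> exists m, forall k, (m <= k)%N ->
    nm (u k i - l) < e.
  apply: inner_complete => e /cu [m hm]; exists m => k k' mk mk'.
  by apply: le_lt_trans (hm _ _ mk mk'); exact: (pnorm_ge (u k - u k') i).
have [l hl] := choice ex; exists l => e e0.
(* Dividing by [n + 1] covers [n = 0] and keeps the sum of [n] such terms strictly below [e]. *)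
have d0 : 0 < e / n.+1%:R by rewrite divr_gt0.
have [m hm] := choice (fun i => hl i _ d0).
exists (\max_i m i)%N => k mk.
apply: le_lt_trans (pnorm_le _) _.
apply: (@le_lt_trans _ _ (\sum_(i < n) e / n.+1%:R)).
  apply: ler_sum => i _; apply: ltW; apply: (hm i).
  by apply: leq_trans mk; exact: leq_bigmax.
rewrite sumr_const card_ord -[X in X < _]mulr_natr mulrAC -mulrA gtr_pMr//.
by rewrite ltr_pdivrMr// mul1r ltr_nat.
Qed.

Definition pdelta (k : 'I_n) (h : H) : V := fun i => if i == k then h else 0.

Lemma pinner_deltar x k h : pinner x (pdelta k h) = inner (x k) h.
Proof.
rewrite /pinner (bigD1 k)//= /pdelta eqxx big1 ?addr0// => i /negbTE ->.
by rewrite inner0r.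
Qed.

Lemma pdelta_linear k : linear (pdelta k).
Proof.
move=> c x y; apply/funext => i; rewrite /pdelta.
change ((if i == k then c *: x + y else 0)
  = c *: (if i == k then x else 0) + (if i == k then y else 0)).
by case: ifP => // _; rewrite scaler0 addr0.
Qed.

Lemma pdelta_sum x : x = \sum_k pdelta k (x k).
Proof.
apply/funext => i; rewrite fct_sumE (bigD1 i)//= /pdelta eqxx big1 ?addr0// => k.
by rewrite eq_sym => /negbTE ->.
Qed.

Lemma pnorm_delta k h : pn (pdelta k h) = nm h.
Proof. by rewrite /fnorm pinner_deltar /pdelta eqxx. Qed.

Section Entries.
Variables (T : V -> V) (Tl : linear T) (M : R) (M0 : 0 <= M).
Hypothesis Tb : forall x, pn (T x) <= M * pn x.

Lemma pentry_lin i k : linear (fun h => T (pdelta k h) i).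
Proof. by move=> c x y; rewrite pdelta_linear Tl. Qed.

Lemma pentry_bounded i k : exists L : R, forall h, nm (T (pdelta k h) i) <= L * nm h.
Proof.
exists M => h; rewrite -(pnorm_delta k h).
exact: le_trans (pnorm_ge _ i) (Tb _).
Qed.

Definition pentry i k : 'B(H) := Bop (bop_predP (pentry_lin i k) (pentry_bounded i k)).

Lemma pentry_sum x i : T x i = \sum_k pentry i k (x k).
Proof.
have T0 : T 0 = 0 by have := Tl (-1) 0 0; rewrite scaler0 addr0 scaleN1r addNr.
have TD u v : T (u + v) = T u + T v by have := Tl 1 u v; rewrite !scale1r.
rewrite {1}(pdelta_sum x) (big_morph T TD T0) fct_sumE.
by apply: eq_bigr.
Qed.

End Entries.

Definition mxop (S : 'M['B(H)]_n) (x : V) : V := fun i => \sum_j S i j (x j).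

Lemma mxop_linear S : linear (mxop S).
Proof.
move=> c x y; apply/funext => i.
change (\sum_j S i j (c *: x j + y j) = c *: (\sum_j S i j (x j)) + \sum_j S i j (y j)).
by rewrite scaler_sumr -big_split; apply: eq_bigr => j _ /=; rewrite bopD bopZ.
Qed.

Lemma fnorm_sum (K : hilbertType R) (I : Type) (r : seq I) (F : I -> K) :
  nm (\sum_(i <- r) F i) <= \sum_(i <- r) nm (F i).
Proof.
elim/big_rec2: _ => [|i y x _ xy]; first by rewrite nm0.
by apply: le_trans (nmD _ _) _; rewrite lerD2l.
Qed.

Lemma mxop_bounded S : exists M : R, 0 <= M /\ forall x, pn (mxop S x) <= M * pn x.
Proof.
have ex i : exists f : 'I_n -> R, forall j, 0 <= f j /\ forall x, nm (S i j x) <= f j * nm x.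
  by have [f hf] := choice (fun j => bop_bounded (S i j)); exists f.
have [M hM] := choice ex.
have M0 i j : 0 <= M i j by have [] := hM i j.
exists (\sum_i \sum_j M i j); split.
  by apply: sumr_ge0 => i _; apply: sumr_ge0.
move=> x; apply: le_trans (pnorm_le _) _.
rewrite mulr_suml; apply: ler_sum => i _.
apply: le_trans (fnorm_sum _ _) _; rewrite mulr_suml; apply: ler_sum => j _.
have [_ h] := hM i j; apply: le_trans (h _) _.
by rewrite ler_wpM2l// pnorm_ge.
Qed.

Lemma pos_opmxE S : pos_opmx S <-> forall x, 0 <= pinner (mxop S x) x.
Proof.
suff E x : pinner (mxop S x) x = \sum_i \sum_j inner (S i j (x j)) (x i).
  by split=> h x; [rewrite E|rewrite -E]; exact: h.
apply: eq_bigr => i _; rewrite /mxop.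
by elim/big_rec2: _ => [|j y z _ <-]; rewrite ?inner0l// innerDl.
Qed.

Lemma pscale_inv (M : R) : 0 <= M -> (0 < (M + 1)^-1) && ((M + 1)^-1 * M <= 1).
Proof.
move=> M0; have M1 : 0 < M + 1 by lra.
by rewrite invr_gt0 M1 mulrC ler_pdivrMr// mul1r; lra.
Qed.

(** [Q] is the root of [S] scaled below the identity by [d = (M + 1)^-1], and [c = d^-1] undoes the
    scaling. The entries of [Q^* Q] are written out because complete positivity will be tested on
    one [k] at a time. *)
Lemma pos_opmx_sqrt (S : 'M['B(H)]_n) : pos_opmx S ->
  exists (c : R) (Q : 'M['B(H)]_n), 0 <= c /\
    forall i j, S i j = c%:C *: \sum_k (Q k i)^dag ** Q k j.
Proof.
move=> /pos_opmxE S0.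
have Sl := mxop_linear S.
have [M [M0 Sb]] := mxop_bounded S.
have /andP[d0 dM] := pscale_inv M0; set d := (M + 1)^-1 in d0 dM.
have SH : hform (fun x y => pinner (mxop S x) y).
  apply: pos_sesq_hform => // c x y z.
    by rewrite Sl (hformDl pH) (hformZl pH).
  by rewrite (hformDr pH) (hformZr pH).
have d0C : 0 <= d%:C by rewrite lecR ltW.
have dreal : (d%:C)^* = d%:C by rewrite conjE /= oppr0.
pose B x := d%:C *: mxop S x.
have Bl : linear B.
  by move=> c x y; rewrite /B Sl scalerDr !scalerA mulrC.
have Bs x y : pinner (B x) y = pinner x (B y).
  rewrite /B (hformZl pH) (hformZr pH) dreal; congr (_ * _).
  by rewrite [RHS](hformC pH) -(hformC SH).
have B0 x : 0 <= pinner (B x) x.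
  by rewrite /B (hformZl pH) mulr_ge0.
have B1 x : pinner (B x) x <= pinner x x.
  rewrite (ge0_complexE (B0 x)) (fnormE pH) lecR.
  apply: le_trans (Re_le_cabs _) _; apply: le_trans (hform_CS pH _ _) _.
  rewrite expr2 ler_wpM2r ?fnorm_ge0// /B (fnormZ pH) cabs_real ger0_norm ?(ltW d0)//.
  apply: le_trans (ler_wpM2l (ltW d0) (Sb x)) _.
  by rewrite mulrA ler_piMl// fnorm_ge0.
have [Q [Ql Qs QQ Q0 _]] := hform_sqrt pH pinner_eq0 pinner_complete Bl Bs B0 B1.
have Qb x : pn (Q x) <= 1 * pn x.
  rewrite mul1r ler_sqrt ?(hform_Re_ge0 pH)//.
  by rewrite -Qs QQ; move: (B1 x); rewrite lecE => /andP[].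
exists d^-1, (\matrix_(i, j) pentry Ql Qb i j); split.
  by rewrite invr_ge0 ltW.
move=> i j.
have adjQ a b : (pentry Ql Qb a b)^dag = pentry Ql Qb b a.
  apply: adj_uniq => x y /=.
  rewrite -pinner_deltar Qs (hformC pH) pinner_deltar -innerC.
  by [].
have dV : (d^-1)%:C * d%:C = 1 by rewrite -rmorphM mulVf ?gt_eqF.
apply: bop_ext => h.
have -> : S i j h = mxop S (pdelta j h) i.
  rewrite /mxop (bigD1 j)//= /pdelta eqxx big1 ?addr0// => k /negbTE ->.
  by rewrite bop0.
have -> : mxop S (pdelta j h) = (d^-1)%:C *: Q (Q (pdelta j h)).
  by rewrite QQ /B scalerA dV scale1r.
change ((d^-1)%:C *: Q (Q (pdelta j h)) i =
  (d^-1)%:C *: (\sum_k ((\matrix_(i, j) pentry Ql Qb i j) k i)^dag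
     ** (\matrix_(i, j) pentry Ql Qb i j) k j : 'B(H)) h).
congr (_ *: _); rewrite bop_sumE (pentry_sum Ql Qb).
by apply: eq_bigr => k _; rewrite !mxE adjQ.
Qed.

(* With |A| the square root of A^2, the columns of C = |A| - A lie in the
   commutant and A C = - |A| C, so testing A on them gives |A| C = 0. *)
Lemma pos_of_commutant_columns (M0 : set 'B(H)) (A : V -> V) (M : R) :
  linear A -> (forall x y, pinner (A x) y = pinner x (A y)) ->
  0 <= M -> (forall x, pn (A x) <= M * pn x) ->
  (forall b, M0 b -> forall x, A (fun i => b (x i)) = fun i => b (A x i)) ->
  (forall b : 'I_n -> 'B(H), (forall i, commutant M0 (b i)) ->
     forall h, 0 <= pinner (A (fun i => b i h)) (fun i => b i h)) ->
  forall x, 0 <= pinner (A x) x.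
Proof.
move=> Al As Mge0 Ab AM Apos.
have /andP[d0 dM] := pscale_inv Mge0; set d := (M + 1)^-1 in d0 dM.
have d0C : 0 <= d%:C by rewrite lecR ltW.
have dreal : (d%:C)^* = d%:C by rewrite conjE /= oppr0.
pose A1 x := d%:C *: A x.
have A1l : linear A1.
  by move=> c x y; rewrite /A1 Al scalerDr !scalerA mulrC.
have A1s x y : pinner (A1 x) y = pinner x (A1 y).
  by rewrite /A1 (hformZl pH) (hformZr pH) dreal As.
have A1b x : pn (A1 x) <= pn x.
  rewrite /A1 (fnormZ pH) cabs_real ger0_norm ?(ltW d0)//.
  apply: le_trans (ler_wpM2l (ltW d0) (Ab x)) _.
  by rewrite mulrA ler_piMl// fnorm_ge0.
have Bl : linear (A1 \o A1) by move=> c x y /=; rewrite !A1l.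
have Bs x y : pinner ((A1 \o A1) x) y = pinner x ((A1 \o A1) y) by rewrite /= !A1s.
have B0 x : 0 <= pinner ((A1 \o A1) x) x by rewrite /= A1s (hform_ge0 pH).
have B1 x : pinner ((A1 \o A1) x) x <= pinner x x.
  by rewrite /= A1s !(fnormE pH) lecR ler_sqr ?nnegrE ?fnorm_ge0.
have [S [Sl Ss SS S0 SG]] := hform_sqrt pH pinner_eq0 pinner_complete Bl Bs B0 B1.
have Sb x : pn (S x) <= pn x.
  rewrite ler_sqrt ?(hform_Re_ge0 pH)//.
  by rewrite -Ss SS; move: (B1 x); rewrite lecE => /andP[].
have SA x : A1 (S x) = S (A1 x).
  by apply: SG => //; exists 1; split=> // y; rewrite mul1r.
pose C x := S x - A1 x.
have Cl : linear C by move=> c x y; rewrite /C Sl A1l scalerBr opprD addrACA.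
have Cs x y : pinner (C x) y = pinner x (C y).
  by rewrite /C (hformBl pH) (hformBr pH) Ss A1s.
have Cb x : pn (C x) <= 2 * pn x.
  apply: le_trans (fnormD pH _ _) _; rewrite (fnormN pH).
  by have := Sb x; have := A1b x; lra.
have A1B u v : A1 (u - v) = A1 u - A1 v.
  by have := A1l (-1) v u; rewrite !scaleN1r !(addrC (- _)).
have SB u v : S (u - v) = S u - S v.
  by have := Sl (-1) v u; rewrite !scaleN1r !(addrC (- _)).
have AC x : A1 (C x) = - S (C x).
  by rewrite /C A1B SB SA SS /= opprB.
have SM b : M0 b -> forall x, C (fun i => b (x i)) = fun i => b (C x i).
  move=> M0b x.
  have Ab' y : A1 (fun i => b (y i)) = fun i => b (A1 y i).
    rewrite /A1 AM//; apply/funext => i; change (d%:C *: b (A y i) = b (d%:C *: A y i)).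
    by rewrite bopZ.
  have Sb' : S (fun i => b (x i)) = fun i => b (S x i).
    symmetry; apply: (SG (fun y i => b (y i))).
    - move=> c y z; apply/funext => i; exact: bop_linear.
    - have [L [L0 hL]] := bop_bounded b; exists L; split => // y.
      rewrite -(ler_pXn2r (n := 2)) ?nnegrE ?fnorm_ge0 ?mulr_ge0 ?fnorm_ge0//.
      rewrite exprMn !pnorm_sqr mulr_sumr; apply: ler_sum => i _.
      by rewrite -exprMn ler_sqr ?nnegrE ?fnorm_ge0 ?mulr_ge0 ?fnorm_ge0.
    - by move=> y /=; rewrite -!Ab'.
  rewrite /C Sb' Ab'; apply/funext => i.
  change (b (S x i) - b (A1 x i) = b (S x i - A1 x i)).
  by rewrite bopB.
have SC k h : S (C (pdelta k h)) = 0.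
  have bk i : commutant M0 (pentry Cl Cb i k).
    move=> b M0b; apply: bop_ext => g /=.
    have -> : pdelta k (b g) = (fun i => b (pdelta k g i)).
      by apply/funext => j; rewrite /pdelta; case: ifP; rewrite ?bop0.
    by rewrite SM.
  have := Apos _ bk h.
  have -> : (fun i => pentry Cl Cb i k h) = C (pdelta k h) by [].
  move=> AC0; set w := C _ in AC0 *.
  have SH : hform (fun x y => pinner (S x) y).
    apply: pos_sesq_hform => // c x y z.
      by rewrite Sl (hformDl pH) (hformZl pH).
    by rewrite (hformDr pH) (hformZr pH).
  have Sw : pinner (S w) w = 0.
    apply/eqP; rewrite eq_le S0 andbT -oppr_ge0 -(hformNl pH) /w -AC /A1 (hformZl pH).
    by rewrite mulr_ge0.
  apply: (fnorm_eq0 pH pinner_eq0).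
  have := hform_CS SH w (S w); rewrite [X in X * _]/fnorm Sw /= sqrtr0 mul0r.
  rewrite (fnormE pH) cabs_real ger0_norm ?sqr_ge0// => h2.
  have : pn (S w) ^+ 2 = 0 by apply/eqP; rewrite eq_le h2 sqr_ge0.
  by move/eqP; rewrite sqrf_eq0 => /eqP ->.
have lin0 (T : V -> V) (Tl : linear T) : (forall k h, T (pdelta k h) = 0) -> forall x, T x = 0.
  move=> T0 x.
  have T00 : T 0 = 0 by have := Tl (-1) 0 0; rewrite scaler0 addr0 scaleN1r addNr.
  have TD u v : T (u + v) = T u + T v by have := Tl 1 u v; rewrite !scale1r.
  by rewrite (pdelta_sum x) (big_morph T TD T00) big1.
have SC0 : forall x, S (C x) = 0.
  by apply: (lin0 (fun x => S (C x))) => // c x y; rewrite Cl Sl.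
(* |C x|^2 = <C (C x), x> and [C C = S C - A1 C = 2 S C = 0]; hence [A1] equals the positive
   operator [S]. *)
have C0 x : C x = 0.
  apply: pinner_eq0; rewrite -Cs {1}/C AC SC0 oppr0 subrr.
  by rewrite (hform0l pH).
move=> x.
have : 0 <= d%:C * pinner (A x) x.
  have -> : d%:C * pinner (A x) x = pinner (S x) x.
    by rewrite -(hformZl pH); congr pinner; apply/eqP; rewrite eq_sym -subr_eq0 -/(A1 x) -/(C x) C0.
  exact: S0.
by rewrite pmulr_rge0// ltcR.
Qed.

End PowerSpace.

(** * Positive definite kernels and Hilbert modules *)

Section BopAlgebra.
Variable R : realType.
Implicit Types H K L : hilbertType R.

Lemma bop_compA H K L (W : hilbertType R) (S : 'B(L, W)) (T : 'B(K, L)) (U : 'B(H, K)) :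
  S ** (T ** U) = S ** T ** U.
Proof. exact: bop_ext. Qed.

Lemma bop_comp1l H K (T : 'B(H, K)) : bop_id K ** T = T.
Proof. exact: bop_ext. Qed.

Lemma bop_comp1r H K (T : 'B(H, K)) : T ** bop_id H = T.
Proof. exact: bop_ext. Qed.

Lemma bop_compPl H K L c (S S' : 'B(K, L)) (T : 'B(H, K)) :
  (c *: S + S') ** T = c *: (S ** T) + S' ** T.
Proof. exact: bop_ext. Qed.

Lemma bop_compPr H K L c (S : 'B(K, L)) (T T' : 'B(H, K)) :
  S ** (c *: T + T') = c *: (S ** T) + S ** T'.
Proof. by apply: bop_ext => x; exact: bop_linear. Qed.

Lemma bop_compZl H K L c (S : 'B(K, L)) (T : 'B(H, K)) : (c *: S) ** T = c *: (S ** T).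
Proof. exact: bop_ext. Qed.

Lemma bop_compZr H K L c (S : 'B(K, L)) (T : 'B(H, K)) : S ** (c *: T) = c *: (S ** T).
Proof. by apply: bop_ext => x; exact: bopZ. Qed.

Lemma bop_compBl H K L (S S' : 'B(K, L)) (T : 'B(H, K)) : (S - S') ** T = S ** T - S' ** T.
Proof. exact: bop_ext. Qed.

Lemma bop_comp0l H K L (T : 'B(H, K)) : (0 : 'B(K, L)) ** T = 0.
Proof. exact: bop_ext. Qed.

Lemma bop_comp0r H K L (T : 'B(K, L)) : T ** (0 : 'B(H, K)) = 0.
Proof. by apply: bop_ext => x; exact: bop0. Qed.

Lemma adj_sum H K (I : Type) (r : seq I) (F : I -> 'B(H, K)) :
  (\sum_(i <- r) F i)^dag = \sum_(i <- r) (F i)^dag.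
Proof. by elim/big_rec2: _ => [|i y x _ <-]; rewrite ?adj0 ?adjD. Qed.

Lemma inner_suml H (I : Type) (r : seq I) (F : I -> H) y :
  inner (\sum_(i <- r) F i) y = \sum_(i <- r) inner (F i) y.
Proof.
by elim/big_rec2: _ => [|i x z _ <-]; rewrite ?inner0l ?innerDl.
Qed.

Lemma inner_sumr H (I : Type) (r : seq I) (F : I -> H) y :
  inner y (\sum_(i <- r) F i) = \sum_(i <- r) inner y (F i).
Proof.
by elim/big_rec2: _ => [|i x z _ <-]; rewrite ?inner0r ?innerDr.
Qed.

Lemma linear_span_min H (A B : set H) : A `<=` B -> B 0 ->
  (forall c x y, B x -> B y -> B (c *: x + y)) -> linear_span A `<=` B.
Proof.
move=> AB B0 Bl _ [n [c [v [Av ->]]]].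
by elim/big_rec: _ => // i x _ Bx; apply: Bl => //; exact: AB.
Qed.

Lemma span_op_eq H (A : set H) (S T : 'B(H)) : closure (linear_span A) = setT ->
  (forall a b, A a -> A b -> inner (S a) b = inner (T a) b) -> S = T.
Proof.
move=> dA h; apply: (span_bop_eq dA) => a Aa.
apply/eqP; rewrite -subr_eq0; apply/eqP/inner_eq0; rewrite (hformC (inner_hform _)).
rewrite (@inner_linear_span R H A) ?dA ?rmorph0// => b Ab.
by rewrite (hformC (inner_hform _)) (hformBl (inner_hform _)) h// subrr rmorph0.
Qed.

(** In [R[i]], being at least [0] includes being real, so both the imaginary part and the sign must
    survive the approximation. *)
Lemma dense_pos_op H (A : set H) (T : 'B(H)) : closure A = setT ->
  (forall a, A a -> 0 <= inner (T a) a) -> pos_op T.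
Proof.
move=> dA T0 x.
have [M [M0 hM]] := bop_bounded T.
have n0 := fnorm_ge0 (@inner R H) x; set N := fnorm _ x in n0.
have key e : 0 < e -> exists2 w : R, 0 <= w & cabs (inner (T x) x - w%:C) < e.
  (* When |a - x| <= 1, the two cross terms are at most M (1 + N) |a - x| and M N |a - x|; the last
     [+ 1] keeps [C] positive. *)
  move=> e0; pose C := M * (2 * N + 1) + 1.
  have C0 : 0 < C by rewrite /C; nra.
  have d0 : 0 < Num.min 1 (e / C) by rewrite lt_min ltr01 divr_gt0.
  have /closure_nmP /(_ _ d0) [a Aa] : closure A x by rewrite dA.
  rewrite lt_min => /andP[a1 aC]; exists (Re (inner (T a) a)).
    by have := T0 a Aa; rewrite lecE => /andP[].
  rewrite -(ge0_complexE (T0 a Aa)).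
  have -> : inner (T x) x - inner (T a) a = - (inner (T (a - x)) a + inner (T x) (a - x)).
    rewrite bopB innerBl innerBr.
    ring.
  rewrite cabsN; apply: le_lt_trans (cabsD _ _) _.
  have h1 := inner_CS (T (a - x)) a; have h2 := inner_CS (T x) (a - x).
  have h3 := hM (a - x); have h4 := hM x.
  have h5 : fnorm inner a <= fnorm inner (a - x) + N.
    by rewrite -{1}(subrK x a) nmD.
  have d := fnorm_ge0 (@inner R H) (a - x).
  have d1 := fnorm_ge0 (@inner R H) a.
  rewrite ltr_pdivlMr// in aC.
  have k1 : fnorm inner (T (a - x)) * fnorm inner a
      <= M * fnorm inner (a - x) * (1 + N).
    by apply: ler_pM; rewrite ?fnorm_ge0//; lra.
  have k2 : fnorm inner (T x) * fnorm inner (a - x) <= M * N * fnorm inner (a - x).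
    by rewrite ler_wpM2r.
  apply: le_lt_trans (lerD (le_trans h1 k1) (le_trans h2 k2)) _.
  by move: aC; rewrite /C; nra.
have im0 : Im (inner (T x) x) = 0.
  apply/eqP; rewrite -normr_le0 leNgt; apply/negP => i0.
  have [w _ h] := key _ i0; suff : `|Im (inner (T x) x)| <= cabs (inner (T x) x - w%:C).
    by rewrite leNgt h.
  rewrite -(ler_pXn2r (n := 2)) ?nnegrE ?cabs_ge0// cabs_sqr real_normK ?num_real//.
  by case: (inner _ _) => a b /=; rewrite subr0 lerDr sqr_ge0.
apply: complex_ge0 => //; rewrite leNgt; apply/negP => r0.
have [|w w0 h] := key (- Re (inner (T x) x)); first by rewrite oppr_gt0.
have := Re_le_cabs (- (inner (T x) x - w%:C)); rewrite cabsN.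
have -> : Re (- (inner (T x) x - w%:C)) = w - Re (inner (T x) x).
  by case: (inner _ _) => a b /=; rewrite opprB.
lra.
Qed.

End BopAlgebra.

Section Kernel.
Variables (R : realType) (H : hilbertType R) (Z : Type) (kappa : Z -> Z -> 'B(H)).
Implicit Types x y : seq (Z * H).

(** A list of pairs [(z, h)] stands for the formal sum of the tensors of [z] and [h], concatenation
    being addition. Lists with this form replace the tensor product and its quotient by null
    vectors. *)
Definition kform x y : R[i] :=
  \sum_(p <- x) \sum_(q <- y) inner (kappa p.1 q.1 p.2) q.2.

Definition kscale (c : R[i]) x := [seq (p.1, c *: p.2) | p <- x].

Lemma kform_catl x x' y : kform (x ++ x') y = kform x y + kform x' y.
Proof. by rewrite /kform big_cat. Qed.

Lemma kform_catr x y y' : kform x (y ++ y') = kform x y + kform x y'.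
Proof. by rewrite /kform -big_split; apply: eq_bigr => p _ /=; rewrite big_cat. Qed.

Lemma kform_scalel c x y : kform (kscale c x) y = c * kform x y.
Proof.
rewrite /kform big_map mulr_sumr; apply: eq_bigr => p _ /=.
by rewrite mulr_sumr; apply: eq_bigr => q _; rewrite bopZ innerZl.
Qed.

Lemma kform_scaler c x y : kform x (kscale c y) = c^* * kform x y.
Proof.
rewrite /kform mulr_sumr; apply: eq_bigr => p _ /=.
by rewrite big_map mulr_sumr; apply: eq_bigr => q _; rewrite innerZr.
Qed.

Definition pos_kernel := forall n (z : 'I_n -> Z) (h : 'I_n -> H),
  0 <= \sum_i \sum_j inner (kappa (z j) (z i) (h j)) (h i).

Hypothesis kpos : pos_kernel.

Lemma kform_ge0 x : 0 <= kform x x.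
Proof.
have := kpos (fun i => (tnth (in_tuple x) i).1) (fun i => (tnth (in_tuple x) i).2).
rewrite exchange_big /= /kform (big_tnth _ _ x); congr (_ <= _).
by apply: eq_bigr => i _; rewrite (big_tnth _ _ x).
Qed.

Lemma kform_CS x y :
  kform y x = (kform x y)^* /\ cabs (kform x y) ^+ 2 <= Re (kform x x) * Re (kform y y).
Proof.
have [|h1 h2] := @quad_CS R (kform y y) (kform x y) (kform y x) (kform x x)
  (kform_ge0 _) (kform_ge0 _).
  move=> z; have := kform_ge0 (y ++ kscale z x).
  rewrite kform_catl !kform_catr !kform_scalel !kform_scaler; congr (0 <= _); ring.
by split=> //; rewrite mulrC.
Qed.

End Kernel.

(** The matrix with entries [z_i^* z_j] is positive, so complete positivity applies to it. For
    linear maps, [pos_kernel_cp] is the converse. *)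
Lemma cp_pos_kernel (R : realType) (H : hilbertType R) (theta : 'B(H) -> 'B(H)) :
  completely_positive theta -> pos_kernel (fun S S' : 'B(H) => theta (S'^dag ** S)).
Proof.
move=> [_ cp] n z h; pose S : 'M['B(H)]_n := \matrix_(i, j) ((z i)^dag ** z j).
have S0 : pos_opmx S.
  move=> g; have -> : \sum_i \sum_j inner (S i j (g j)) (g i)
      = inner (\sum_i z i (g i)) (\sum_i z i (g i)).
    rewrite inner_sumr.
    apply: eq_bigr => i _.
    rewrite inner_suml.
    by apply: eq_bigr => j _; rewrite !mxE /= -adjPr.
  exact: (hform_ge0 (inner_hform H)).
have := cp n S S0 h; congr (0 <= _).
by apply: eq_bigr => i _; apply: eq_bigr => j _; rewrite !mxE.
Qed.

Section HilbertModulePositivity.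
Variables (R : realType) (H : hilbertType R) (M0 : set 'B(H)).
Local Notation N := (commutant M0).
Variable X : hilbert_module N.
Implicit Types x y : X.
Local Notation ip := (@hm_ip R H N X).

Lemma hm_ip_linear y c x x' : ip (c *: x + x') y = c *: ip x y + ip x' y.
Proof. exact: (hm_ipDl (hm_axioms X)). Qed.

Lemma hm_ip_addl y x x' : ip (x + x') y = ip x y + ip x' y.
Proof. by have := hm_ip_linear y 1 x x'; rewrite !scale1r. Qed.

Lemma hm_ip0l y : ip 0 y = 0.
Proof. by apply: (addrI (ip 0 y)); rewrite -hm_ip_addl !addr0. Qed.

Lemma hm_ip_scalel c x y : ip (c *: x) y = c *: ip x y.
Proof. by rewrite -[c *: x]addr0 hm_ip_linear hm_ip0l addr0. Qed.

Lemma hm_ipC x y : ip y x = (ip x y)^dag.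
Proof. exact: (hm_ip_adj (hm_axioms X)). Qed.

Lemma hm_ip_suml (I : Type) (r : seq I) (F : I -> X) y :
  ip (\sum_(i <- r) F i) y = \sum_(i <- r) ip (F i) y.
Proof. by rewrite (big_morph (fun w => ip w y) (fun x x' => hm_ip_addl y x x') (hm_ip0l y)). Qed.

Lemma hm_ip_sumr (I : Type) (r : seq I) (F : I -> X) y :
  ip y (\sum_(i <- r) F i) = \sum_(i <- r) ip y (F i).
Proof.
by rewrite hm_ipC hm_ip_suml adj_sum; apply: eq_bigr => i _; rewrite -hm_ipC.
Qed.

(** The axiom [hm_ip_ge0] at a sum of [x_i b_i], with [b_i] in [N], tests the Gram matrix only on
    families [b_i g] with a common vector [g]. As the Gram entries commute with [M0],
    [pos_of_commutant_columns] extends this to arbitrary families. *)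
Lemma hm_pos_kernel : pos_kernel ip.
Proof.
move=> n x h; pose S : 'M['B(H)]_n := \matrix_(i, j) ip (x j) (x i).
suff : forall g : 'I_n -> H, 0 <= pinner (mxop S g) g.
  move=> /pos_opmxE /(_ h); congr (0 <= _).
  by apply: eq_bigr => i _; apply: eq_bigr => j _; rewrite mxE.
have [M [Mge0 Sb]] := mxop_bounded S.
apply: (pos_of_commutant_columns (M0 := M0) (mxop_linear S) _ Mge0 Sb).
- move=> g g'; rewrite /pinner /mxop.
  under eq_bigr => i _.
    rewrite inner_suml.
    over.
  under [RHS]eq_bigr => i _.
    rewrite inner_sumr.
    over.
  rewrite exchange_big; apply: eq_bigr => i _; apply: eq_bigr => j _ /=.
  by rewrite !mxE adjP -hm_ipC.
- move=> b M0b g; apply/funext => i; rewrite /mxop bop_sum; apply: eq_bigr => j _.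
  rewrite mxE; have := hm_ip_mem (hm_axioms X) (x j) (x i) b M0b.
  by move/(congr1 (fun W : 'B(H) => W (g j))).
- move=> b Nb g.
  have := hm_ip_ge0 (hm_axioms X) (\sum_i hm_act (x i) (b i)) g.
  rewrite hm_ip_sumr bop_sumE.
  rewrite inner_suml.
  congr (0 <= _); apply: eq_bigr => i _.
  rewrite hm_ip_suml bop_sumE /mxop.
  rewrite !inner_suml.
  apply: eq_bigr => j _; rewrite mxE.
  rewrite (hm_ip_act (hm_axioms X))// hm_ipC (hm_ip_act (hm_axioms X))// adj_comp -hm_ipC /=.
  by rewrite -adjPr.
Qed.

Lemma hm_norm_sqr x : hm_norm x ^+ 2 = opnorm (ip x x).
Proof. by rewrite sqr_sqrtr// opnorm_ge0. Qed.

Lemma hm_norm_ge0 x : 0 <= hm_norm x.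
Proof. exact: sqrtr_ge0. Qed.

Lemma hm_ip_diag x h : Re (inner (ip x x h) h) <= (hm_norm x * fnorm inner h) ^+ 2.
Proof.
apply: le_trans (Re_le_cabs _) _; apply: le_trans (inner_CS _ _) _.
rewrite exprMn hm_norm_sqr expr2 mulrA ler_wpM2r ?fnorm_ge0//.
exact: opnorm_bound.
Qed.

Lemma hm_ip_bound x y : opnorm (ip x y) <= hm_norm x * hm_norm y.
Proof.
apply: opnorm_leP => [|h]; first by rewrite mulr_ge0 ?hm_norm_ge0.
(* Pairing [(x, h)] with [(y, ip x y h)] makes the mixed term |ip x y h|^2, and one factor |ip x y
   h| cancels. *)
have [_] := kform_CS hm_pos_kernel [:: (x, h)] [:: (y, ip x y h)].
rewrite /kform !big_seq1 /= inner_nm cabs_real ger0_norm ?sqr_ge0//.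
move=> /le_trans /(_ (ler_pM _ _ (hm_ip_diag x h) (hm_ip_diag y _))).
have Rge0 z g : 0 <= Re (inner (ip z z g) g).
  by have := hm_ip_ge0 (hm_axioms X) z g; rewrite lecE => /andP[].
move=> /(_ (Rge0 _ _) (Rge0 _ _)).
rewrite -!exprMn ler_pXn2r ?nnegrE ?sqr_ge0 ?mulr_ge0 ?hm_norm_ge0 ?fnorm_ge0// => h2.
have [->|n0] := eqVneq (fnorm inner (ip x y h)) 0.
  by rewrite !mulr_ge0 ?hm_norm_ge0 ?fnorm_ge0.
have np : 0 < fnorm inner (ip x y h) by rewrite lt_def n0 fnorm_ge0.
rewrite -(ler_pM2r np) -expr2; apply: le_trans h2 _.
by rewrite le_eqVlt; apply/orP; left; apply/eqP; ring.
Qed.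

End HilbertModulePositivity.

(** * Stinespring dilations *)

(** [pos_opmx_sqrt] splits a positive matrix into the matrices with entries [Q_ki^* Q_kj], one for
    each [k], and each is an instance of the kernel. *)
Lemma pos_kernel_cp (R : realType) (H : hilbertType R) (psi : 'B(H) -> 'B(H)) :
  linear psi -> pos_kernel (fun S S' : 'B(H) => psi (S'^dag ** S)) ->
  completely_positive psi.
Proof.
move=> psil kpos; split=> // n S /pos_opmx_sqrt [c [Q [c0 SQ]]] h.
have psi0 : psi 0 = 0 by have := psil (-1) 0 0; rewrite scaler0 addr0 scaleN1r addNr.
have psiD u v : psi (u + v) = psi u + psi v by have := psil 1 u v; rewrite !scale1r.
have psiZ a u : psi (a *: u) = a *: psi u by have := psil a u 0; rewrite psi0 !addr0.
have -> : \sum_i \sum_j inner (map_mx psi S i j (h j)) (h i) =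
  c%:C * \sum_k \sum_i \sum_j inner (psi ((Q k i)^dag ** Q k j) (h j)) (h i).
  rewrite [X in _ = _ * X]exchange_big mulr_sumr; apply: eq_bigr => i _ /=.
  rewrite [X in _ = _ * X]exchange_big mulr_sumr; apply: eq_bigr => j _ /=.
  rewrite mxE SQ psiZ (big_morph psi psiD psi0).
  change (inner (c%:C *: (\sum_k psi ((Q k i)^dag ** Q k j) : 'B(H)) (h j)) (h i)
    = c%:C * \sum_k inner (psi ((Q k i)^dag ** Q k j) (h j)) (h i)).
  by rewrite (hformZl (inner_hform H)) bop_sumE inner_suml.
rewrite mulr_ge0 ?lecR//; apply: sumr_ge0 => k _; exact: kpos.
Qed.

Section StinespringTheory.
Variables (R : realType) (H : hilbertType R) (phi : 'B(H) -> 'B(H)).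
Variable D : minimal_stinespring phi.
Local Notation V := (st_V D).
Local Notation rho := (st_rho D).
Local Notation K := (st_space D).
Local Notation nm := (fnorm (@inner R _)).

Lemma st_rho_linear : linear rho.
Proof. by case: (st_star_hom D). Qed.

Lemma st_rhoM S T : rho (S ** T) = rho S ** rho T.
Proof. by case: (st_star_hom D). Qed.

Lemma st_rho_adj S : rho (S^dag) = (rho S)^dag.
Proof. by case: (st_star_hom D). Qed.

Lemma st_inner S S' h k :
  inner (rho S (V h)) (rho S' (V k)) = inner (phi (S'^dag ** S) h) k.
Proof.
by rewrite (st_dilation D) st_rhoM st_rho_adj /= -!adjPr.
Qed.

Lemma st_op_eq (S T : 'B(K)) :
  (forall S1 h S2 k, inner (S (rho S1 (V h))) (rho S2 (V k))
     = inner (T (rho S1 (V h))) (rho S2 (V k))) -> S = T.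
Proof.
move=> ST; apply: (span_op_eq (st_minimal D)) => _ _ [S1 [h ->]] [S2 [k ->]].
exact: ST.
Qed.

Lemma st_bop_eq (L : hilbertType R) (S T : 'B(K, L)) :
  (forall S1 h, S (rho S1 (V h)) = T (rho S1 (V h))) -> S = T.
Proof.
by move=> ST; apply: (span_bop_eq (st_minimal D)) => _ [S1 [h ->]]; exact: ST.
Qed.

(** Because [T] commutes with [rho], the kernel sum of the compression is [inner (T x) x] at the
    vector [x] that sums the [rho (Q i) (V (h i))]. *)
Lemma st_compression_cp (T : 'B(K)) : commutant (range rho) T -> pos_op T ->
  completely_positive (fun S => V^dag ** T ** rho S ** V).
Proof.
move=> cT T0; apply: pos_kernel_cp.
  by move=> c S S'; rewrite st_rho_linear bop_compPr bop_compPl.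
move=> n Q h; have := T0 (\sum_i rho (Q i) (V (h i))); congr (0 <= _).
rewrite inner_sumr; apply: eq_bigr => i _.
rewrite bop_sum inner_suml; apply: eq_bigr => j _ /=.
have cTE S x : T (rho S x) = rho S (T x).
  by have := cT _ (imageT rho S) => /(congr1 (fun W : 'B(K) => W x)).
by rewrite st_rhoM /= -adjPr (cTE (Q i)^dag) st_rho_adj -adjPr.
Qed.

Definition st_comb (x : seq ('B(H) * H)) : K := \sum_(p <- x) rho p.1 (V p.2).

Lemma st_comb_cat x y : st_comb (x ++ y) = st_comb x + st_comb y.
Proof. exact: big_cat. Qed.

Lemma st_comb_scale c x : st_comb (kscale c x) = c *: st_comb x.
Proof.
rewrite /st_comb big_map scaler_sumr; apply: eq_bigr => p _ /=.
by rewrite !bopZ.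
Qed.

Lemma st_comb_dense : closure (range st_comb) = [set: K].
Proof.
apply/seteqP; split=> // x _.
have : closure (linear_span [set k | exists S h, k = rho S (V h)]) x.
  by rewrite (st_minimal D).
apply: closureS; apply: linear_span_min.
- by move=> _ [S [h ->]]; exists [:: (S, h)] => //; rewrite /st_comb big_seq1.
- by exists [::] => //; rewrite /st_comb big_nil.
- move=> c _ _ [x1 _ <-] [y _ <-]; exists (kscale c x1 ++ y) => //.
  by rewrite st_comb_cat st_comb_scale.
Qed.

Lemma st_comb_inner x y :
  inner (st_comb x) (st_comb y) = kform (fun S S' : 'B(H) => phi (S'^dag ** S)) x y.
Proof.
rewrite inner_suml; apply: eq_bigr => p _; rewrite inner_sumr.
by apply: eq_bigr => q _; rewrite st_inner.
Qed.

(** Arveson's derivative: the kernel form [B] of [theta] lies between zero and the inner product of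
    [K], so an operator represents it. It commutes with [rho] because [B] sees a pair [S], [S'] only
    through [S'^* S]. *)
Lemma st_radon_nikodym (theta : 'B(H) -> 'B(H)) :
  completely_positive theta -> completely_positive (phi - theta) ->
  exists T : 'B(K), [/\ commutant (range rho) T, pos_op T, pos_op (bop_id K - T)
    & forall S h S' k, inner (T (rho S (V h))) (rho S' (V k))
        = inner (theta (S'^dag ** S) h) k].
Proof.
move=> /cp_pos_kernel t0 /cp_pos_kernel pt0.
set kt := (fun S S' : 'B(H) => theta (S'^dag ** S)) in t0.
pose B := kform kt.
have BC x y : B y x = (B x y)^* by have [] := kform_CS t0 x y.
have Bge0 x : 0 <= B x x by exact: kform_ge0.
have Ble x : B x x <= inner (st_comb x) (st_comb x).
  rewrite st_comb_inner -subr_ge0; have := kform_ge0 pt0 x; congr (0 <= _).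
  rewrite /B /kform -sumrB; apply: eq_bigr => p _; rewrite -sumrB; apply: eq_bigr => q _.
  by rewrite -innerBl.
have Bbound x y : cabs (B x y) <= nm (st_comb x) * nm (st_comb y).
  rewrite -(ler_pXn2r (n := 2)) ?nnegrE ?mulr_ge0 ?cabs_ge0 ?fnorm_ge0// exprMn.
  have [_ /le_trans] := kform_CS t0 x y; apply.
  have ge0 z : 0 <= Re (B z z) by have := Bge0 z; rewrite lecE => /andP[].
  have le z : Re (B z z) <= nm (st_comb z) ^+ 2.
    by have := Ble z; rewrite inner_nm lecE => /andP[].
  exact: ler_pM (ge0 _) (ge0 _) (le _) (le _).
have eta_ex y : exists eta, forall x, inner (st_comb x) eta = B x y.
  pose G := [set p : K * R[i] | exists2 x, p.1 = st_comb x & p.2 = B x y].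
  have [||||eta [_ heta]] := @riesz_relation R K G (nm (st_comb y)).
  - by exists [::]; rewrite /= ?/st_comb ?/B ?/kform big_nil.
  - move=> c k k' a a' [x /= -> ->] [x' /= -> ->]; exists (kscale c x ++ x') => /=.
      by rewrite st_comb_cat st_comb_scale.
    by rewrite /B kform_catl kform_scalel.
  - exact: fnorm_ge0.
  - by move=> k a [x /= -> ->]; rewrite mulrC; exact: Bbound.
  by exists eta => x; rewrite -(heta (st_comb x) (B x y))//; exists x.
pose G := [set p : K * K | exists2 y, p.1 = st_comb y &
  forall x, inner (st_comb x) p.2 = B x y].
have [||||T hT] := @bop_extension R K K G 1 _ _ ler01.
- exists [::]; rewrite /= ?/st_comb ?big_nil// => x.
  rewrite inner0r /B /kform big1// => p _; exact: big_nil.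
- move=> c k k' l l' [y /= -> hy] [y' /= -> hy']; exists (kscale c y ++ y') => /=.
    by rewrite st_comb_cat st_comb_scale.
  by move=> x; rewrite innerDr innerZr hy hy' /B kform_catr kform_scaler.
- move=> k l [y /= -> hy]; rewrite mul1r.
  apply: (dense_norm_bound st_comb_dense); first exact: fnorm_ge0.
  by move=> _ [x _ <-]; rewrite hy mulrC; exact: Bbound.
- apply/seteqP; split=> // k _; have : closure (range st_comb) k by rewrite st_comb_dense.
  apply: closureS => _ [y _ <-]; have [eta heta] := eta_ex y; exists eta.
  by exists y.
have TB x y : inner (T (st_comb x)) (st_comb y) = B x y.
  have [eta heta] := eta_ex x.
  rewrite (hT (st_comb x) eta); last by exists x.
  by rewrite innerC heta -BC.
have T1 S h S' k : inner (T (rho S (V h))) (rho S' (V k))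
        = inner (theta (S'^dag ** S) h) k.
  have := TB [:: (S, h)] [:: (S', k)].
  by rewrite /st_comb /B /kform !big_seq1.
exists T; split=> //.
- move=> _ [S _ <-]; apply: st_op_eq => S1 h S2 k /=.
  rewrite [RHS](_ : _ = inner (T (rho S1 (V h))) (rho (S^dag ** S2) (V k))).
    have -> : rho S (rho S1 (V h)) = rho (S ** S1) (V h) by rewrite st_rhoM.
    by rewrite !T1 adj_comp adjK bop_compA.
  by rewrite st_rhoM st_rho_adj /= -adjP.
- apply: (dense_pos_op st_comb_dense) => _ [x _ <-]; rewrite TB; exact: Bge0.
- apply: (dense_pos_op st_comb_dense) => _ [x _ <-].
  change (0 <= inner (st_comb x - T (st_comb x)) (st_comb x)).
  by rewrite innerBl TB subr_ge0.
Qed.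

End StinespringTheory.

(** * The implementation of the commutant *)

Section Commutants.
Variables (R : realType) (H : hilbertType R).
Implicit Types (M : set 'B(H)) (S T : 'B(H)).

Lemma commutant_adj M : (forall T, M T -> M T^dag) ->
  forall T, commutant M T -> commutant M T^dag.
Proof.
by move=> Madj T cT S MS; apply: adj_inj; rewrite !adj_comp adjK -cT//; exact: Madj.
Qed.

Lemma commutant_id M : commutant M (bop_id H).
Proof. by move=> T _; exact: bop_ext. Qed.

End Commutants.

Section PaschkeTheory.
Variables (R : realType) (A : unitalCstarAlgType R) (H : hilbertType R).
Variables (pi : A -> 'B(H)) (hpi : nondegenerate_representation pi).
Variables (phi : 'B(H) -> 'B(H)) (hphi : WE pi phi).
Local Notation N := (bicommutant pi).
Local Notation N' := (commutant (range pi)).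
Local Notation nm := (fnorm (@inner R _)).

Lemma pi_star_hom : star_hom (@cstar_mul R A) (@cstar_star R A) pi.
Proof. by case: hpi. Qed.

Lemma pi1 : pi (@cstar_one R A) = bop_id H.
Proof.
have [_ piM _] := pi_star_hom; have [_ dpi] := hpi.
apply: (span_bop_eq dpi) => _ [a [h ->]].
have -> : pi cstar_one (pi a h) = (pi cstar_one ** pi a) h by [].
by rewrite -piM cstar_mul1a.
Qed.

Lemma commutant_pi_adj b : N' b -> N' b^dag.
Proof.
apply: commutant_adj => _ [a _ <-]; have [_ _ piS] := pi_star_hom.
by rewrite -piS; exact: imageT.
Qed.

Lemma bicommutantE T b h : N T -> N' b -> T (b h) = b (T h).
Proof. by move=> NT Nb; have := congr1 (fun W : 'B(H) => W h) (NT b Nb). Qed.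

Lemma WE_mem theta S : WE pi theta -> N (theta S).
Proof. by case=> -[]. Qed.

Lemma WE_cp theta : WE pi theta -> completely_positive theta.
Proof. by case=> -[]. Qed.

Lemma WE_linear theta : WE pi theta -> linear theta.
Proof. by move=> /WE_cp []. Qed.

Section Implementation.
Variable D : minimal_stinespring phi.
Local Notation V := (st_V D).
Local Notation rho := (st_rho D).
Local Notation K := (st_space D).

(* The representation of pi(A)' on K given by [S (x) h |-> S (x) b h]. *)
Definition implements (b : 'B(H)) (L : 'B(K)) :=
  forall S h, L (rho S (V h)) = rho S (V (b h)).

(** The Gram form of [K] with [T] inserted. It is additive in [T], and at [T = b^* b] it is the
    squared norm after applying [b], since values of [phi] commute with [b]; norm estimates on [K]
    thus become operator identities on [H]. *)
Let F (T : 'B(H)) (x : seq ('B(H) * H)) : R[i] :=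
  \sum_(p <- x) \sum_(q <- x) inner (phi (q.1^dag ** p.1) (T p.2)) q.2.

Let F_comp b (x : seq ('B(H) * H)) : N' b ->
  inner (st_comb D [seq (p.1, b p.2) | p <- x]) (st_comb D [seq (p.1, b p.2) | p <- x])
  = F (b^dag ** b) x.
Proof.
move=> Nb; rewrite st_comb_inner /kform big_map; apply: eq_bigr => p _ /=.
rewrite big_map; apply: eq_bigr => q _ /=.
by rewrite adjPr -bicommutantE//; [exact: WE_mem|exact: commutant_pi_adj].
Qed.

Lemma implements_ex b : N' b -> exists L, implements b L.
Proof.
move=> Nb; have [M [M0 hM]] := bop_bounded b.
have M1 : 0 < M + 1 by lra.
pose c := ((M + 1) ^+ 2)^-1.
have c0 : 0 < c by rewrite invr_gt0 exprn_gt0.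
pose E := bop_id H - c%:C *: (b^dag ** b).
have E1 : pos_op (bop_id H - E).
  move=> h; rewrite /E opprB addrC subrK.
  change (0 <= inner (c%:C *: (b^dag (b h))) h).
  by rewrite innerZl -adjPr mulr_ge0 ?lecR ?(ltW c0)// inner_ge0.
have E0 : pos_op E.
  move=> h; change (0 <= inner (h - c%:C *: (b^dag (b h))) h).
  rewrite innerBl innerZl -adjPr !inner_nm -rmorphM -rmorphB lecR /=.
  rewrite subr_ge0 /c mulrC ler_pdivrMr ?exprn_gt0// -exprMn.
  rewrite ler_pXn2r ?nnegrE ?mulr_ge0 ?fnorm_ge0 ?(ltW M1)//.
  rewrite mulrC (le_trans (hM h))// ler_wpM2r ?fnorm_ge0//; lra.
(* W lies in pi(A)', so |x|^2 - c |b x|^2 = |W x|^2 on K. *)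
have [W [Wadj WW Wcomm]] := bop_sqrt E0 E1.
have NW : N' W.
  move=> T rT; symmetry; apply: Wcomm.
  have bT : b ** T = T ** b := Nb T rT.
  have bT' : b^dag ** T = T ** b^dag := commutant_pi_adj Nb rT.
  rewrite /E; apply: bop_ext => h.
  change (T (h - c%:C *: (b^dag (b h))) = T h - c%:C *: (b^dag (b (T h)))).
  rewrite bopB bopZ; congr (_ - _ *: _).
  have /= -> := congr1 (fun U : 'B(H) => U h) bT.
  by have /= -> := congr1 (fun U : 'B(H) => U (b h)) bT'.
pose G := [set p : K * K | exists2 x, p.1 = st_comb D x &
  p.2 = st_comb D [seq (p.1, b p.2) | p <- x]].
have [|||||L hL] := @bop_extension R K K G (M + 1).
- by exists [::]; rewrite /= /st_comb big_nil.
- move=> a k k' l l' [x /= -> ->] [x' /= -> ->]; exists (kscale a x ++ x') => /=.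
    by rewrite st_comb_cat st_comb_scale.
  rewrite map_cat st_comb_cat -st_comb_scale /kscale -!map_comp; congr (st_comb _ _ + _).
  by apply: eq_map => p /=; rewrite bopZ.
- exact: ltW.
- move=> k l [x /= -> ->].
  rewrite -(ler_pXn2r (n := 2)) ?nnegrE ?mulr_ge0 ?fnorm_ge0 ?(ltW M1)// exprMn.
  rewrite -ler_pdivrMl ?exprn_gt0// -/c -subr_ge0 -lecR.
  have nmC (u v : K) : (nm u ^+ 2 - c * nm v ^+ 2)%:C = inner u u - c%:C * inner v v.
    by rewrite !inner_nm -rmorphM -rmorphB.
  rewrite nmC F_comp//.
  have -> : inner (st_comb D x) (st_comb D x) - c%:C * F (b^dag ** b) x = F (W^dag ** W) x.
    rewrite st_comb_inner /F /kform mulr_sumr -sumrB; apply: eq_bigr => p _.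
    rewrite mulr_sumr -sumrB; apply: eq_bigr => q _.
    rewrite Wadj WW.
    change (inner (phi (q.1^dag ** p.1) p.2) q.2 -
      c%:C * inner (phi (q.1^dag ** p.1) ((b^dag ** b) p.2)) q.2 =
      inner (phi (q.1^dag ** p.1) (p.2 - c%:C *: (b^dag ** b) p.2)) q.2).
    by rewrite bopB bopZ innerBl innerZl.
  by rewrite -F_comp// inner_ge0.
- apply/seteqP; split=> // k _; have : closure (range (st_comb D)) k by rewrite st_comb_dense.
  by apply: closureS => _ [x _ <-]; exists (st_comb D [seq (p.1, b p.2) | p <- x]); exists x.
exists L => S h; apply: hL; exists [:: (S, h)]; by rewrite /= /st_comb big_seq1.
Qed.

Lemma implements_adj b L : N' b -> implements b L -> implements b^dag L^dag.
Proof.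
move=> Nb bL.
have [L' bL'] := implements_ex (commutant_pi_adj Nb).
suff -> : L^dag = L' by [].
apply: st_op_eq => S h S' k; rewrite -adjPr bL bL' !st_inner.
by rewrite (bicommutantE _ (WE_mem _ hphi) (commutant_pi_adj Nb)) -adjPr.
Qed.

(** Quantifying over all [L] avoids choosing an implementation of [b]; density of the generating
    vectors makes it unique anyway. *)
Definition intertwiner (C : 'B(H, K)) :=
  forall b L, N' b -> implements b L -> L ** C = C ** b.

(** An element [b] of [pi(A)'] passes through [C] as its implementation [L], and out through
    [C'^dag] because [L^dag] implements [b^dag]. So [C'^dag ** C] lies in the bicommutant. *)
Lemma intertwiner_mem C C' : intertwiner C -> intertwiner C' -> N (C'^dag ** C).
Proof.
move=> iC iC' b Nb; have [L bL] := implements_ex Nb.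
rewrite -bop_compA -(iC b L)// bop_compA [RHS]bop_compA; congr (_ ** C).
apply: adj_inj; rewrite !adj_comp !adjK.
by rewrite (iC' b^dag)//; [exact: commutant_pi_adj|exact: implements_adj].
Qed.

Lemma intertwiner_comp (G : 'B(K)) C :
  (forall b L, N' b -> implements b L -> G ** L = L ** G) ->
  intertwiner C -> intertwiner (G ** C).
Proof.
by move=> hG iC b L Nb bL; rewrite bop_compA -(hG b)// -bop_compA (iC b)// bop_compA.
Qed.

Lemma radon_nikodym_implements (theta : 'B(H) -> 'B(H)) (T : 'B(K)) :
  (forall S, N (theta S)) ->
  (forall S h S' k, inner (T (rho S (V h))) (rho S' (V k))
     = inner (theta (S'^dag ** S) h) k) ->
  forall b L, N' b -> implements b L -> T ** L = L ** T.
Proof.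
move=> Ntheta Tth b L Nb bL; apply: st_op_eq => S h S' k /=.
rewrite bL Tth bicommutantE// -[L]adjK -adjPr (implements_adj Nb bL) Tth.
by rewrite -[b in LHS]adjK -adjPr.
Qed.

End Implementation.

End PaschkeTheory.

(** * The self-dual module as a space of operators *)

Section DualRepresentation.
Variables (R : realType) (A : unitalCstarAlgType R) (H : hilbertType R).
Variables (pi : A -> 'B(H)) (hpi : nondegenerate_representation pi).
Variables (phi : 'B(H) -> 'B(H)) (hphi : WE pi phi).
Variables (D : minimal_stinespring phi) (X : paschke_dilation pi phi).
Variable X' : selfdual_extension (pd_module X).
Local Notation N := (bicommutant pi).
Local Notation V := (st_V D).
Local Notation rho := (st_rho D).
Local Notation K := (st_space D).
Local Notation Y := (sd_module X').
Local Notation nm := (fnorm (@inner R _)).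
Implicit Types (tau psi : dual (pd_module X)).

Definition ptens S : pd_module X := pd_tens X S (bop_id H).

Lemma dualN tau x : N (tau x).
Proof. by case: tau => t /= /asboolP []. Qed.

Lemma dual_linear tau : linear tau.
Proof. by case: tau => t /= /asboolP []. Qed.

Lemma dual_actE tau x b : N b -> tau (hm_act x b) = tau x ** b.
Proof. by case: tau => t /= /asboolP [_ _ h _]; exact: h. Qed.

Lemma dual_bounded tau : exists M : R, forall x, opnorm (tau x) <= M * hm_norm x.
Proof. by case: tau => t /= /asboolP []. Qed.

Lemma ptens_act S T : N T -> pd_tens X S T = hm_act (ptens S) T.
Proof.
by move=> NT; rewrite pd_tens_act// ?bop_comp1l//; exact: commutant_id.
Qed.

(** An elementary tensor is [ptens S] acted on by [T], so module linearity, density and boundedness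
    leave only these values. This is the basic test for equality in [X']. *)
Lemma dual_eq tau psi : (forall S, tau (ptens S) = psi (ptens S)) -> tau = psi.
Proof.
move=> h; apply/eqP; rewrite -subr_eq0; apply/eqP.
set d := tau - psi.
have dE x : d x = tau x - psi x by [].
have d0 S T : N T -> d (pd_tens X S T) = 0.
  by move=> NT; rewrite ptens_act// dual_actE// dE h subrr bop_comp0l.
have dl := dual_linear d.
have dD x y : d (x + y) = d x + d y by have := dl 1 x y; rewrite !scale1r.
have d00 : d 0 = 0 by apply: (addrI (d 0)); rewrite -dD !addr0.
have dspan y : linear_span [set z | exists S T, N T /\ z = pd_tens X S T] y -> d y = 0.
  move=> [n [c [v [hv ->]]]]; rewrite (big_morph d dD d00) big1// => i _.
  have [S [T [NT ->]]] := hv i.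
  by have := dl (c i) (pd_tens X S T) 0; rewrite d00 !addr0 d0// scaler0.
have [M hM] := dual_bounded d.
apply: val_inj; apply/funext => x; apply: opnorm_eq0.
rewrite leNgt; apply/negP => p0.
have M1 : 0 < `|M| + 1 by rewrite ltr_wpDl.
have [y /dspan dy xy] := pd_dense x (divr_gt0 p0 M1).
have : opnorm (d x) <= M * hm_norm (x - y).
  have -> : d x = d (x - y) by have := dD (x - y) y; rewrite subrK dy addr0.
  exact: hM.
rewrite ltr_pdivlMr// in xy.
have := hm_norm_ge0 (x - y); have := ler_norm M.
by move: p0 xy; rewrite -/(d x); nra.
Qed.

Lemma hatE (x y : pd_module X) : hat x y = hm_ip y x.
Proof.
rewrite /hat insubdK//; apply/asboolP; split.
- by move=> z; exact: (hm_ip_mem (hm_axioms _)).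
- by move=> c u v; exact: hm_ip_linear.
- by move=> z b Nb; rewrite (hm_ip_act (hm_axioms _)).
- by exists (hm_norm x) => z; rewrite mulrC; exact: hm_ip_bound.
Qed.

Lemma sd_hatE x tau : hm_ip (hat x : Y) (tau : Y) = tau x.
Proof. exact: sd_ip_hat. Qed.

Lemma sd_hat_ptens S S' :
  hm_ip (hat (ptens S) : Y) (hat (ptens S') : Y) = phi (S'^dag ** S).
Proof.
rewrite sd_hatE hatE pd_tens_ip; [|exact: commutant_id|exact: commutant_id].
by rewrite adj_id bop_comp1l bop_comp1r.
Qed.

(* The adjoint of the operator representing tau is [S (x) h |-> tau (S (x) 1) h]. *)
Lemma sd_operator_ex tau : exists C : 'B(H, K),
  (forall S h, C^dag (rho S (V h)) = tau (ptens S) h) /\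
  forall h, nm (C h) <= hm_norm (tau : Y) * nm h.
Proof.
pose lift (x : seq ('B(H) * H)) := [seq ((hat (ptens p.1) : Y), p.2) | p <- x].
pose ev (x : seq ('B(H) * H)) := \sum_(p <- x) tau (ptens p.1) p.2.
have evZ c x : ev (kscale c x) = c *: ev x.
  by rewrite /ev big_map scaler_sumr; apply: eq_bigr => p _; rewrite bopZ.
have t0 := hm_norm_ge0 (tau : Y).
have ev_le x : nm (ev x) <= hm_norm (tau : Y) * nm (st_comb D x).
  (* Cauchy-Schwarz in [X'] against [(tau, ev x)]: the mixed term is |ev x|^2, and one factor |ev x|
     cancels. *)
  have [_] := kform_CS (@hm_pos_kernel _ _ _ Y) (lift x) [:: (tau : Y, ev x)].
  have -> : kform (@hm_ip _ _ _ Y) (lift x) [:: (tau : Y, ev x)] = inner (ev x) (ev x).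
    rewrite /kform big_map {2}/ev inner_suml; apply: eq_bigr => p _.
    by rewrite big_seq1 /= sd_ip_hat.
  have -> : kform (@hm_ip _ _ _ Y) (lift x) (lift x) = inner (st_comb D x) (st_comb D x).
    rewrite st_comb_inner /kform big_map; apply: eq_bigr => p _.
    by rewrite big_map; apply: eq_bigr => q _; rewrite sd_hat_ptens.
  have -> : kform (@hm_ip _ _ _ Y) [:: (tau : Y, ev x)] [:: (tau : Y, ev x)] =
      inner (hm_ip (tau : Y) (tau : Y) (ev x)) (ev x) by rewrite /kform !big_seq1.
  rewrite !inner_nm cabs_real ger0_norm ?sqr_ge0//= => h1.
  have h2 := le_trans h1 (ler_wpM2l (sqr_ge0 _) (hm_ip_diag (tau : Y) (ev x))).
  have [e0|e0] := eqVneq (nm (ev x)) 0.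
    by rewrite e0 mulr_ge0// fnorm_ge0.
  have ep : 0 < nm (ev x) by rewrite lt_def e0 fnorm_ge0.
  have h3 : nm (ev x) ^+ 2 <= nm (st_comb D x) * (hm_norm (tau : Y) * nm (ev x)).
    rewrite -(ler_pXn2r (n := 2)) ?nnegrE ?sqr_ge0 ?mulr_ge0 ?fnorm_ge0//.
    by rewrite [leRHS]exprMn.
  by rewrite -(ler_pM2r ep) -expr2 (le_trans h3)// mulrA (mulrC (nm _)).
pose G := [set p : K * H | exists2 x, p.1 = st_comb D x & p.2 = ev x].
have [||||U hU] := @bop_extension R K H G (hm_norm (tau : Y)) _ _ t0.
- by exists [::]; rewrite /= /st_comb /ev big_nil.
- move=> c k k' l l' [x /= -> ->] [x' /= -> ->]; exists (kscale c x ++ x') => /=.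
    by rewrite st_comb_cat st_comb_scale.
  by rewrite -evZ /ev big_cat.
- by move=> k l [x /= -> ->].
- apply/seteqP; split=> // k _; have : closure (range (st_comb D)) k by rewrite st_comb_dense.
  by apply: closureS => _ [x _ <-]; exists (ev x); exists x.
have Ux x : U (st_comb D x) = ev x by apply: hU; exists x.
exists U^dag; split=> [S h|].
  rewrite adjK; have := Ux [:: (S, h)].
  by rewrite /st_comb /ev !big_seq1.
move=> h; apply: (dense_norm_bound (st_comb_dense D)); first by rewrite mulr_ge0// fnorm_ge0.
move=> _ [x _ <-]; rewrite -adjP Ux; apply: le_trans (inner_CS _ _) _.
by rewrite mulrAC ler_wpM2r ?fnorm_ge0.
Qed.

(** Self-duality gives surjectivity: for an intertwiner [C], the bounded module map
    [psi |-> C^dag ** L psi] is represented by some [tau], and evaluating at [hat (ptens S)], which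
    [L] sends to [rho S ** V], shows [L tau = C]. *)
Lemma sd_representation : exists L : dual (pd_module X) -> 'B(H, K), [/\
  forall tau S h, (L tau)^dag (rho S (V h)) = tau (ptens S) h,
  injective L,
  forall tau psi, hm_ip (tau : Y) (psi : Y) = (L psi)^dag ** L tau,
  forall tau, intertwiner pi (L tau) &
  forall C, intertwiner pi C -> exists tau, L tau = C].
Proof.
have [L hL] := choice sd_operator_ex.
have LE tau S h : (L tau)^dag (rho S (V h)) = tau (ptens S) h by have [] := hL tau.
have Lb tau h : nm (L tau h) <= hm_norm (tau : Y) * nm h by have [] := hL tau.
have adj_eq (C C' : 'B(H, K)) :
    (forall S h, C^dag (rho S (V h)) = C'^dag (rho S (V h))) -> C = C'.
  by move=> h; apply: adj_inj; exact: st_bop_eq.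
have Linj : injective L.
  by move=> tau psi e; apply: dual_eq => S; apply: bop_ext => h; rewrite -!LE e.
(* Scalars act on the dual through [c^*] and the adjoint conjugates once more, so [L] is linear and
   not conjugate-linear. *)
have Llin : linear L.
  move=> c tau psi; apply: (adj_eq) => S h; rewrite LE adj_linear.
  change (c^* *: tau (ptens S) h + psi (ptens S) h =
    c^* *: (L tau)^dag (rho S (V h)) + (L psi)^dag (rho S (V h))).
  by rewrite !LE.
have Lact (tau : Y) b : N b -> L (hm_act tau b) = L tau ** b.
  move=> Nb; apply: (adj_eq) => S h; rewrite LE adj_comp /= LE.
  rewrite -sd_hatE hm_ipC (hm_ip_act (hm_axioms Y))// adj_comp -hm_ipC.
  by rewrite sd_hatE.
have Lint tau : intertwiner pi (L tau).
  move=> b L' Nb bL'; apply: adj_inj; rewrite !adj_comp; apply: st_bop_eq => S h /=.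
  rewrite (implements_adj hpi hphi Nb bL') !LE.
  by rewrite (bicommutantE _ (dualN _ _) (commutant_pi_adj hpi Nb)).
have Lsurj C : intertwiner pi C ->
    exists tau, L tau = C /\ forall psi, hm_ip (psi : Y) (tau : Y) = C^dag ** L psi.
  move=> iC; have [|tau htau] := @sd_selfdual _ _ _ _ _ X' (fun psi => C^dag ** L psi).
    apply/asboolP; split.
    - by move=> psi; exact: (intertwiner_mem hpi hphi).
    - by move=> c tau psi; rewrite Llin bop_compPr.
    - by move=> tau b Nb; rewrite Lact// bop_compA.
    have [M [M0 hM]] := bop_bounded C^dag; exists M => psi.
    apply: opnorm_leP => [|h]; first by rewrite mulr_ge0// hm_norm_ge0.
    by apply: le_trans (hM _) _; rewrite -mulrA ler_wpM2l.
  exists tau; split=> [|psi]; last by rewrite htau.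
  apply: (adj_eq) => S h; rewrite LE -sd_hatE.
  have -> : hm_ip (hat (ptens S) : Y) (tau : Y) = C^dag ** L (hat (ptens S)) by rewrite htau.
  rewrite /=; congr (_ _).
  have -> // : L (hat (ptens S)) = rho S ** V.
  apply: (adj_eq) => S' h'; rewrite LE hatE adj_comp.
  rewrite pd_tens_ip; [|exact: commutant_id|exact: commutant_id].
  rewrite adj_id bop_comp1l bop_comp1r (st_dilation D).
  by rewrite st_rhoM st_rho_adj.
exists L; split=> //.
(* Surjectivity at [L psi] returns [psi] itself by injectivity, together with the formula for its
   inner products. *)
- move=> tau psi; have [psi' [/Linj -> h]] := Lsurj _ (Lint psi).
  exact: h.
- by move=> C /Lsurj [tau [] ]; exists tau.
Qed.

End DualRepresentation.

(** * Weak expectations *)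

Section ScaledMaps.
Variables (R : realType) (H : hilbertType R).
Implicit Types theta : 'B(H) -> 'B(H).

Lemma cp_scale (t : R) theta : 0 <= t -> completely_positive theta ->
  completely_positive (t%:C *: theta).
Proof.
move=> t0 [thl thp]; split=> [c S T|n S S0 h].
  change (t%:C *: theta (c *: S + T) = c *: (t%:C *: theta S) + t%:C *: theta T).
  by rewrite thl scalerDr !scalerA mulrC.
have -> : \sum_i \sum_j inner (map_mx (t%:C *: theta) S i j (h j)) (h i)
    = t%:C * \sum_i \sum_j inner (map_mx theta S i j (h j)) (h i).
  rewrite mulr_sumr; apply: eq_bigr => i _; rewrite mulr_sumr; apply: eq_bigr => j _.
  rewrite !mxE; change (inner (t%:C *: theta (S i j) (h j)) (h i)
    = t%:C * inner (theta (S i j) (h j)) (h i)).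
  by rewrite innerZl.
by rewrite mulr_ge0 ?lecR//; exact: thp.
Qed.

Lemma pos_op_scale (K : hilbertType R) (t : R) : 0 <= t -> pos_op (t%:C *: bop_id K).
Proof.
move=> t0 k; change (0 <= inner (t%:C *: k) k).
by rewrite innerZl mulr_ge0 ?lecR// inner_ge0.
Qed.

Lemma one_sub_scale (K : hilbertType R) (t : R) :
  bop_id K - t%:C *: bop_id K = (1 - t)%:C *: bop_id K.
Proof. by rewrite rmorphB scalerBl scale1r. Qed.

Lemma orthogonal_projectionK (H0 : set H) (P : 'B(H)) x :
  orthogonal_projection H0 P -> H0 x -> P x = x.
Proof.
move=> hP H0x; apply/eqP; rewrite eq_sym -subr_eq0; apply/eqP/inner_eq0.
have [H0P orth] := hP x.
by rewrite {1}innerBr !orth// subrr.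
Qed.

End ScaledMaps.

Section WeakExpectations.
Variables (R : realType) (A : unitalCstarAlgType R) (H : hilbertType R).
Variables (pi : A -> 'B(H)) (hpi : nondegenerate_representation pi).
Variables (phi : 'B(H) -> 'B(H)) (hphi : WE pi phi).
Local Notation N := (bicommutant pi).

Lemma N_scale c T : N T -> N (c *: T).
Proof.
move=> NT; rewrite -[c *: T]addr0; apply: bicommutant_linear => //.
by move=> b _; rewrite bop_comp0l bop_comp0r.
Qed.

Lemma WE_scale_interval (t : R) theta : 0 < t < 1 -> WE pi theta ->
  completely_positive (phi - t%:C *: theta) -> order_interval pi phi (t%:C *: theta).
Proof.
move=> /andP[t0 _] wth cp; split=> //; split; first exact: cp_scale (ltW t0) (WE_cp wth).
by move=> S; apply: N_scale; exact: (WE_mem _ wth).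
Qed.

Definition interval_cond := forall (t : R) (phi0 : 'B(H) -> 'B(H)), 0 < t < 1 ->
  order_interval pi phi phi0 ->
  (exists2 theta, WE pi theta & phi0 = t%:C *: theta) -> phi0 = t%:C *: phi.

Lemma extreme_interval : extreme_point (WE pi) phi -> interval_cond.
Proof.
move=> [_ ext] t phi0 /[dup] t01 /andP[t0 t1] [_ cp] [theta wth e]; subst phi0.
have s0 : 0 < 1 - t by rewrite subr_gt0.
pose psi : 'B(H) -> 'B(H) := ((1 - t)^-1)%:C *: (phi - t%:C *: theta).
have sV : ((1 - t)^-1)%:C * (1 - t)%:C = 1 :> R[i].
  by rewrite -rmorphM mulVf ?gt_eqF.
have sE : 1 - t%:C = (1 - t)%:C :> R[i] by rewrite rmorphB.
have val S T : phi S = T -> theta S = T -> psi S = T.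
  move=> pS tS; change (((1 - t)^-1)%:C *: (phi S - t%:C *: theta S) = T).
  by rewrite pS tS -{1}[T]scale1r -scalerBl sE scalerA sV scale1r.
have wpsi : WE pi psi.
  split; first split.
  - by apply: cp_scale => //; rewrite invr_ge0 ltW.
  - move=> S; apply: N_scale.
    change (N (phi S - t%:C *: theta S)); rewrite addrC -scaleNr.
    by apply: bicommutant_linear; [exact: (WE_mem _ wth)|exact: (WE_mem _ hphi)].
  - by case: wth => _ t1' _; case: hphi => _ p1 _; exact: val.
  - by case: wth => _ _ ta a; case: hphi => _ _ pa; exact: val.
have [| -> //] := ext t theta psi t01 wth wpsi.
by rewrite /psi scalerA mulrC sV scale1r addrC subrK.
Qed.

(** Testing at [pi 1 = 1] gives [c *: 1 = 0]. The conclusion is about [c *: phi] and not [c], since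
    [H] may be the zero space. *)
Lemma phi_pi_scale c : (forall a, c *: phi (pi a) = 0) -> forall S, c *: phi S = 0.
Proof.
move=> h S; case: hphi => _ p1 _.
have c1 : c *: bop_id H = 0 by rewrite -p1 -(pi1 hpi) h.
rewrite -[phi S]bop_comp1r -bop_compZr c1; exact: bop_comp0r.
Qed.

Lemma interval_cp (t : R) theta : interval_cond -> 0 < t < 1 -> WE pi theta ->
  completely_positive (phi - t%:C *: theta) -> forall S, t%:C *: theta S = t%:C *: phi S.
Proof.
move=> ic t01 wth cp S.
have e := ic t _ t01 (WE_scale_interval t01 wth cp) (ex_intro2 _ _ theta wth erefl).
by have := congr1 (fun f => f S) e.
Qed.

Lemma convex_cp (t : R) theta psi : 0 < t < 1 -> WE pi theta -> WE pi psi ->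
  phi = t%:C *: theta + (1 - t)%:C *: psi ->
  completely_positive (t%:C *: theta) /\ completely_positive (phi - t%:C *: theta).
Proof.
move=> /andP[t0 t1] wth wpsi ->; split; first exact: cp_scale (ltW t0) (WE_cp wth).
rewrite addrC addKr; apply: cp_scale (WE_cp wpsi).
by rewrite subr_ge0 ltW.
Qed.

(** Both weights are nonzero, so [theta = phi] follows by cancelling [t], and the decomposition then
    gives [psi = phi]. *)
Lemma extreme_of_scaled :
  (forall (t : R) theta psi, 0 < t < 1 -> WE pi theta -> WE pi psi ->
    phi = t%:C *: theta + (1 - t)%:C *: psi -> t%:C *: theta = t%:C *: phi) ->
  extreme_point (WE pi) phi.
Proof.
move=> h; split=> // t theta psi t01 wth wpsi e.
have /andP[t0 t1] := t01.
have eth := h t theta psi t01 wth wpsi e.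
have cancel (s : R) (f g : 'B(H) -> 'B(H)) : 0 < s -> s%:C *: f = s%:C *: g -> f = g.
  move=> s0 efg; rewrite -[f]scale1r -[g]scale1r.
  have <- : (s^-1)%:C * s%:C = 1 :> R[i] by rewrite -rmorphM mulVf ?gt_eqF.
  by rewrite -!scalerA efg.
split; first exact: cancel t0 eth.
apply: (cancel (1 - t)); first by rewrite subr_gt0.
apply: (addrI (t%:C *: theta)); rewrite -e eth -scalerDl -rmorphD.
by rewrite addrC subrK scale1r.
Qed.

Section Stinespring.
Variable D : minimal_stinespring phi.
Local Notation V := (st_V D).
Local Notation rho := (st_rho D).
Local Notation K := (st_space D).

Lemma S_set_inner T t theta : commutant (range rho) T ->
  (forall S, V^dag ** T ** rho S ** V = t%:C *: theta S) ->
  forall S h S' k, inner (T (rho S (V h))) (rho S' (V k))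
    = inner ((t%:C *: theta (S'^dag ** S)) h) k.
Proof.
move=> cT e S h S' k; rewrite -e /= -adjPr.
have cTE S1 x : T (rho S1 x) = rho S1 (T x).
  by have := cT _ (imageT rho S1) => /(congr1 (fun W : 'B(K) => W x)).
by rewrite st_rhoM /= !cTE st_rho_adj -adjPr.
Qed.

Lemma S_set_cp T t theta : commutant (range rho) T -> pos_op (bop_id K - T) ->
  (forall S, V^dag ** T ** rho S ** V = t%:C *: theta S) ->
  completely_positive (phi - t%:C *: theta).
Proof.
move=> cT T1 e.
have -> : phi - t%:C *: theta = fun S => V^dag ** (bop_id K - T) ** rho S ** V.
  apply/funext => S; change (phi S - t%:C *: theta S = V^dag ** (bop_id K - T) ** rho S ** V).
  rewrite -e (st_dilation D) -!bop_compA; apply: bop_ext => h /=.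
  change (V^dag (rho S (V h)) - V^dag (T (rho S (V h)))
    = V^dag (rho S (V h) - T (rho S (V h)))).
  by rewrite bopB.
apply: st_compression_cp => // S rS.
apply: bop_ext => x; change (S x - T (S x) = S (x - T x)).
by rewrite bopB; have /= -> := congr1 (fun W : 'B(K) => W x) (cT S rS).
Qed.

Lemma interval_faithful : interval_cond -> faithful_subspace (rho_piA_VH pi D) (C_S_set pi D).
Proof.
move=> ic; have [P hP] := projection_ex [set k | exists a h, k = rho (pi a) (V h)].
exists P => // U [a1 [a2 [T1 [T2 [_ _ S1 S2 UE]]]]] PUP.
have [cT1 _ oT1 [t1 [th1 [t01 w1 e1]]]] := S1.
have [cT2 _ oT2 [t2 [th2 [t02 w2 e2]]]] := S2.
have i1 := interval_cp ic t01 w1 (S_set_cp cT1 oT1 e1).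
have i2 := interval_cp ic t02 w2 (S_set_cp cT2 oT2 e2).
pose T := a1%:C *: T1 + a2%:C *: T2.
have PTP : P ** T ** P = 0 by rewrite /T -UE.
rewrite UE -/T {UE PUP}.
pose c := a1%:C * t1%:C + a2%:C * t2%:C.
have TE S h S' k : inner (T (rho S (V h))) (rho S' (V k))
    = inner ((c *: phi (S'^dag ** S)) h) k.
  change (inner (a1%:C *: T1 (rho S (V h)) + a2%:C *: T2 (rho S (V h))) (rho S' (V k))
    = inner (c *: phi (S'^dag ** S) h) k).
  rewrite innerDl !innerZl (S_set_inner cT1 e1) (S_set_inner cT2 e2) i1 i2.
  change (a1%:C * inner (t1%:C *: phi (S'^dag ** S) h) k
    + a2%:C * inner (t2%:C *: phi (S'^dag ** S) h) k = c * inner (phi (S'^dag ** S) h) k).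
  by rewrite !innerZl mulrDl !mulrA.
have memP a h : rho_piA_VH pi D (rho (pi a) (V h)).
  by apply: subset_closure; apply: linear_span_sub; exists a, h.
have c0 : forall S, c *: phi S = 0.
  apply: phi_pi_scale => a; apply: bop_ext => h; apply: inner_ext => k.
  (* Reading [pi a] as [1^* pi a] makes the second vector [V k = rho (pi 1) (V k)], which the
     projection fixes. *)
  rewrite inner0r innerC -[pi a](_ : (bop_id H)^dag ** pi a = _); last first.
    by rewrite adj_id bop_comp1l.
  rewrite -TE -(pi1 hpi).
  have Px := orthogonal_projectionK hP (memP a h).
  have Py := orthogonal_projectionK hP (memP (@cstar_one R A) k).
  have [_ /(_ _ (memP (@cstar_one R A) k))] := hP (T (rho (pi a) (V h))).
  rewrite innerBl -{2}Px.
  have -> : P (T (P (rho (pi a) (V h)))) = (P ** T ** P) (rho (pi a) (V h)) by [].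
  by rewrite PTP inner0l subr0 => ->; rewrite rmorph0.
apply: st_op_eq => S h S' k.
by rewrite TE c0 !inner0l.
Qed.

Lemma faithful_extreme : faithful_subspace (rho_piA_VH pi D) (C_S_set pi D) ->
  extreme_point (WE pi) phi.
Proof.
move=> [P hP fP]; apply: extreme_of_scaled => t theta psi t01 wth wpsi e.
have [cp1 cp2] := convex_cp t01 wth wpsi e.
have /andP[t0 t1] := t01.
have [T [cT T0 T1 TE]] := st_radon_nikodym D cp1 cp2.
have VE (S : 'B(H)) h k : inner ((V^dag ** T ** rho S ** V) h) k
    = inner ((t%:C *: theta S) h) k.
  have := TE S h (bop_id H) k; rewrite st_unital adj_id bop_comp1l /= => <-.
  by rewrite -adjPr.
have VTV S : V^dag ** T ** rho S ** V = t%:C *: theta S.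
  apply: bop_ext => h; apply: inner_ext => k.
  by rewrite innerC VE -innerC.
pose I := t%:C *: bop_id K.
have VIV S : V^dag ** I ** rho S ** V = t%:C *: phi S.
  by rewrite (st_dilation D) /I bop_compZr !bop_compZl bop_comp1r.
have cI : commutant (range rho) I.
  by move=> S _; rewrite /I bop_compZl bop_compZr bop_comp1l bop_comp1r.
have TI : T - I = 0.
  apply: fP.
    exists 1, (-1), T, I; split.
    - by apply/andP; split; lra.
    - by apply/andP; split; lra.
    - by split; [exact: cT|exact: T0|exact: T1|exists t, theta].
    - split; [exact: cI|exact: pos_op_scale (ltW t0)| |by exists t, phi].
      by rewrite one_sub_scale; apply: pos_op_scale; rewrite subr_ge0 ltW.
    - by rewrite rmorphN1 scale1r scaleN1r.
  (* The two vectors are reduced to generators one after the other; there [b^* a] lies in [A], where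
     [theta] and [phi] both equal [pi]. *)
  have orth u v : rho_piA_VH pi D u -> rho_piA_VH pi D v -> inner ((T - I) u) v = 0.
    move=> Hu Hv; rewrite adjP; move: u Hu; apply: inner_linear_span => _ [a [h ->]].
    rewrite -adjP innerC; suff -> : inner v ((T - I) (rho (pi a) (V h))) = 0 by rewrite rmorph0.
    move: v Hv; apply: inner_linear_span => _ [b [k ->]].
    rewrite innerC.
    suff -> : inner ((T - I) (rho (pi a) (V h))) (rho (pi b) (V k)) = 0 by rewrite rmorph0.
    change (inner (T (rho (pi a) (V h)) - I (rho (pi a) (V h))) (rho (pi b) (V k)) = 0).
    rewrite innerBl TE (S_set_inner cI VIV).
    have [_ piM piS] := pi_star_hom hpi.
    rewrite -piS -piM.
    change (inner (t%:C *: theta (pi (cstar_mul (cstar_star b) a)) h) k -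
      inner (t%:C *: phi (pi (cstar_mul (cstar_star b) a)) h) k = 0).
    case: wth => _ _ ->; case: hphi => _ _ ->.
    by rewrite subrr.
  apply: bop_ext => x; apply: inner_eq0.
  have [_ o] := hP ((T - I) (P x)).
  have [m _] := hP x; have [m' _] := hP ((T - I) (P x)).
  have := o _ m'; rewrite innerBl (orth _ _ m m') sub0r => /eqP.
  by rewrite oppr_eq0 => /eqP.
have TE' : T = I by apply/eqP; rewrite -subr_eq0 TI.
apply/funext => S; change (t%:C *: theta S = t%:C *: phi S).
by rewrite -VTV TE' VIV.
Qed.

End Stinespring.

End WeakExpectations.

(** * Condition (4) on the self-dual module *)

Section PaschkeConditions.
Variables (R : realType) (A : unitalCstarAlgType R) (H : hilbertType R).
Variables (pi : A -> 'B(H)) (hpi : nondegenerate_representation pi).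
Variables (phi : 'B(H) -> 'B(H)) (hphi : WE pi phi).
Variables (D : minimal_stinespring phi) (X : paschke_dilation pi phi).
Variable X' : selfdual_extension (pd_module X).
Variable sigmat : 'B(H) -> sd_module X' -> sd_module X'.
Hypothesis hsigmat : is_sigma_tilde sigmat.
Local Notation N := (bicommutant pi).
Local Notation N' := (commutant (range pi)).
Local Notation V := (st_V D).
Local Notation rho := (st_rho D).
Local Notation K := (st_space D).
Local Notation Y := (sd_module X').
Local Notation ip := (@hm_ip R H N Y).
Local Notation ee := (e_hat X').
Implicit Types (tau psi : Y).

(** [is_sigma_tilde] asks only that each [sigmat S] be adjointable and extend [pd_sigma S]. An
    element of [X'] is determined by its pairings with vectors of [X], so moving [sigmat S] onto [X]
    recovers that [sigmat] is multiplicative and preserves adjoints. *)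
Lemma sigmat_adjoint S tau (x : pd_module X) :
  ip (hat x : Y) (sigmat S tau) = ip (hat (pd_sigma (S^dag) x) : Y) tau.
Proof.
have [[T' hT'] sh] := hsigmat S.
rewrite hm_ipC hT' -hm_ipC; congr (ip _ tau).
apply: val_inj; apply/funext => y /=.
change ((T' (hat x) : dual (pd_module X)) y = (hat (pd_sigma (S^dag) x) : dual (pd_module X)) y).
rewrite -[LHS](@sd_hatE _ _ _ _ _ _ X') -hT' sh sd_hatE !hatE.
exact: pd_sigma_adj.
Qed.

Lemma sigmat_hat_ptens S S' : sigmat S (hat (ptens X S') : Y) = hat (ptens X (S ** S')).
Proof.
have [_ ->] := hsigmat S; congr hat; apply: pd_sigma_tens; exact: commutant_id.
Qed.

Lemma e_hatE S : sigmat S ee = hat (ptens X S).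
Proof. by rewrite /e_hat (sigmat_hat_ptens S) bop_comp1r. Qed.

Lemma sigmat_ip S tau psi : ip (sigmat S tau) psi = ip tau (sigmat (S^dag) psi).
Proof.
have [[T' hT'] _] := hsigmat S.
rewrite hT'; congr (ip tau _); apply: dual_eq => S1.
rewrite -!(@sd_hatE _ _ _ _ _ _ X') -hT' sigmat_adjoint adjK.
have [_ ->] := hsigmat S; by [].
Qed.

Lemma sigmatM S S' tau : sigmat (S ** S') tau = sigmat S (sigmat S' tau).
Proof.
apply: dual_eq => S1; rewrite -!(@sd_hatE _ _ _ _ _ _ X') !sigmat_adjoint.
by rewrite adj_comp pd_sigmaM.
Qed.

Lemma pos_adjointable_sym (T : Y -> Y) : pos_adjointable T -> adjoint_pair T T.
Proof.
move=> [W [W' [WW' ->]]] x y; change (ip (W' (W x)) y = ip x (W' (W y))).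
by rewrite -WW' [LHS]hm_ipC -WW' -hm_ipC.
Qed.

Section PSet.
Variables (T : Y -> Y) (t : R) (theta : 'B(H) -> 'B(H)).
Hypotheses (cT : forall S, T \o sigmat S = sigmat S \o T).
Hypothesis Tform : forall S, ip (T (sigmat S ee)) ee = t%:C *: theta S.

Lemma P_set_ip S S' : ip (T (sigmat S ee)) (sigmat S' ee) = t%:C *: theta (S'^dag ** S).
Proof.
rewrite -Tform sigmatM -[S' in LHS]adjK -sigmat_ip; congr (ip _ ee).
by have := congr1 (fun f => f (sigmat S ee)) (cT (S'^dag)).
Qed.

(** With [1 - T = W^* W], the kernel of [phi - t theta] is the Gram kernel of the vectors
    [W (sigmat S ee)]. *)
Lemma P_set_cp : linear theta -> pos_adjointable (id - T) ->
  completely_positive (phi - t%:C *: theta).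
Proof.
move=> thl [W [W' [WW' TE]]].
have phiE S S' : phi (S'^dag ** S) = ip (sigmat S ee) (sigmat S' ee).
  by rewrite !e_hatE sd_hat_ptens.
apply: pos_kernel_cp.
  move=> c S S'; have pl := WE_linear hphi.
  change (phi (c *: S + S') - t%:C *: theta (c *: S + S')
    = c *: (phi S - t%:C *: theta S) + (phi S' - t%:C *: theta S')).
  by rewrite pl thl scalerBr scalerDr !scalerA (mulrC c) opprD addrACA.
move=> n S h.
have := @hm_pos_kernel _ _ _ Y n (fun i => W (sigmat (S i) ee)) h; congr (0 <= _).
apply: eq_bigr => i _; apply: eq_bigr => j _; congr (inner (bop_fun _ _) _).
have TS : adjoint_pair (id - T) (id - T) by apply: pos_adjointable_sym; exists W, W'.
have -> : ip (W (sigmat (S j) ee)) (W (sigmat (S i) ee))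
    = ip ((id - T) (sigmat (S j) ee)) (sigmat (S i) ee).
  by rewrite WW' TS TE.
change (ip (sigmat (S j) ee - T (sigmat (S j) ee)) (sigmat (S i) ee)
  = phi ((S i)^dag ** S j) - t%:C *: theta ((S i)^dag ** S j)).
by rewrite -scaleN1r addrC hm_ip_linear scaleN1r addrC -phiE P_set_ip.
Qed.

End PSet.

(** The image of [X] need not be norm dense in [X'], so vanishing on the vectors [sigmat S ee] does
    not finish by continuity. Real coefficients make [T] self-adjoint, and the pairing of [T y] with
    these vectors vanishes for every [y]. *)
Lemma interval_paschke : interval_cond pi phi ->
  forall T, C_P_set sigmat T ->
    (forall a, ip (T (sigmat (pi a) ee)) ee = 0) -> T = 0.
Proof.
move=> ic U [a1 [a2 [T1 [T2 [_ _ P1 P2 ->]]]]] U0.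
have [_ c1 p1 q1 [t1 [th1 [t01 w1 e1]]]] := P1.
have [_ c2 p2 q2 [t2 [th2 [t02 w2 e2]]]] := P2.
have i1 := interval_cp ic t01 w1 (P_set_cp c1 e1 (WE_linear w1) q1).
have i2 := interval_cp ic t02 w2 (P_set_cp c2 e2 (WE_linear w2) q2).
pose c := a1%:C * t1%:C + a2%:C * t2%:C.
pose T (y : Y) : Y := a1%:C *: T1 y + a2%:C *: T2 y.
have ipl (y z w : Y) : ip (a1%:C *: y + a2%:C *: z) w = a1%:C *: ip y w + a2%:C *: ip z w.
  by rewrite hm_ip_linear hm_ip_scalel.
have TE S S' : ip (T (sigmat S ee)) (sigmat S' ee) = c *: phi (S'^dag ** S).
  by rewrite ipl (P_set_ip c1 e1) (P_set_ip c2 e2) i1 i2 scalerDl !scalerA.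
have Tsym y z : ip (T y) z = ip y (T z).
  rewrite ipl [RHS]hm_ipC ipl adjD !adj_scale -!hm_ipC.
  rewrite (pos_adjointable_sym p1) (pos_adjointable_sym p2).
  by rewrite !conjE /= !oppr0.
have c0 : forall S, c *: phi S = 0.
  apply: (phi_pi_scale hpi hphi) => a; rewrite -[pi a](_ : (bop_id H)^dag ** pi a = _).
    by rewrite -TE (e_hatE (bop_id H)); exact: U0.
  by rewrite adj_id bop_comp1l.
have Te S : T (sigmat S ee) = 0.
  apply: dual_eq => S'; rewrite -(@sd_hatE _ _ _ _ _ _ X') -(e_hatE S') hm_ipC TE c0 adj0.
  by [].
apply/funext => y; change (T y = 0); apply: dual_eq => S.
rewrite -(@sd_hatE _ _ _ _ _ _ X') -(e_hatE S) -Tsym Te.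
exact: hm_ip0l.
Qed.

(** The scalar [t] is the derivative of [t phi], the element against which [F] is compared below;
    real square roots provide the factorizations. *)
Lemma id_P_set (t : R) : 0 < t < 1 -> P_set (pi := pi) sigmat (fun y => t%:C *: y).
Proof.
move=> /andP[t0 t1].
have real_conj (s : R) : (s%:C)^* = s%:C by rewrite conjE /= oppr0.
have sym (s : R) : adjoint_pair (fun y : Y => s%:C *: y) (fun y => s%:C *: y).
  by move=> x y; rewrite hm_ip_scalel [RHS]hm_ipC hm_ip_scalel adj_scale -hm_ipC real_conj.
have root (s : R) : 0 <= s -> pos_adjointable (fun y : Y => s%:C *: y).
  move=> s0; exists (fun y => (Num.sqrt s)%:C *: y), (fun y => (Num.sqrt s)%:C *: y).
  split; first exact: sym.
  by apply/funext => y /=; rewrite scalerA -rmorphM -expr2 sqr_sqrtr.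
split.
- by exists (fun y => t%:C *: y); exact: sym.
- move=> S; apply/funext => tau /=; apply: dual_eq => S'.
  rewrite -!(@sd_hatE _ _ _ _ _ _ X') sigmat_adjoint.
  rewrite (hm_ipC (t%:C *: _)) (hm_ipC (t%:C *: tau)) !hm_ip_scalel !adj_scale -!hm_ipC.
  by rewrite sigmat_adjoint.
- exact: root (ltW t0).
- have -> : id - (fun y : Y => t%:C *: y) = (fun y => (1 - t)%:C *: y).
    apply/funext => y; change (y - t%:C *: y = (1 - t)%:C *: y).
    by rewrite rmorphB scalerBl scale1r.
  by apply: root; rewrite subr_ge0 ltW.
- exists t, phi; split; [by rewrite t0 t1|exact: hphi|move=> S].
  rewrite hm_ip_scalel e_hatE; congr (_ *: _); rewrite sd_hat_ptens.
  by rewrite adj_id bop_comp1l.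
Qed.

Lemma paschke_extreme :
  (forall T, C_P_set sigmat T ->
    (forall a, ip (T (sigmat (pi a) ee)) ee = 0) -> T = 0) ->
  extreme_point (WE pi) phi.
Proof.
move=> cond; apply: extreme_of_scaled => // t theta psi t01 wth wpsi e.
have [cp1 cp2] := convex_cp t01 wth wpsi e.
have /andP[t0 t1] := t01.
have [T [cT T0 T1 TE]] := st_radon_nikodym D cp1 cp2.
have [L [LE Linj Lip Lint Lsurj]] := sd_representation hpi hphi D X'.
have Timp : forall b G, N' b -> implements b G -> T ** G = G ** T.
  apply: (radon_nikodym_implements hpi hphi _ TE) => S.
  by apply: N_scale; exact: (WE_mem _ wth).
(* Composition with [G] preserves intertwiners, and [L] maps onto these, so [G] induces a map of
   [X']. *)
have lift (G : 'B(K)) : (forall b G', N' b -> implements b G' -> G ** G' = G' ** G) ->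
    exists F : Y -> Y, forall tau, L (F tau) = G ** L tau.
  move=> hG; have ex (tau : Y) : exists tau', L tau' = G ** L tau.
    by apply: Lsurj; apply: intertwiner_comp.
  by have [F hF] := choice ex; exists F.
have lift_adj (G : 'B(K)) (F : Y -> Y) : G^dag = G ->
    (forall tau, L (F tau) = G ** L tau) -> adjoint_pair F F.
  move=> GG hF x y; rewrite !Lip !hF adj_comp GG; exact: bop_compA.
have T1c : pos_op (bop_id K - (bop_id K - T)) by rewrite opprB addrC subrK.
(* The square roots of T and 1 - T exhibit F and id - F as products W^* W. *)
have [R1 [R1a R1R1 R1c]] := bop_sqrt T0 T1.
have [R2 [R2a R2R2 R2c]] := bop_sqrt T1 T1c.
have [F1 hF1] : exists F : Y -> Y, forall tau, L (F tau) = R1 ** L tau.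
  by apply: lift => b G Nb bG; symmetry; apply: R1c; rewrite (Timp b).
have [F2 hF2] : exists F : Y -> Y, forall tau, L (F tau) = R2 ** L tau.
  apply: lift => b G Nb bG; symmetry; apply: R2c.
  rewrite bop_compBl (bop_comp1l G) (Timp b)//.
  apply: bop_ext => k; change (G (k - T k) = G k - G (T k)); exact: bopB.
pose F := F1 \o F1.
have hF tau : L (F tau) = T ** L tau by rewrite /F /= !hF1 bop_compA R1R1.
have Lsig S tau : L (sigmat S tau) = rho S ** L tau.
  apply: adj_inj; apply: st_bop_eq => S1 h; rewrite LE adj_comp -st_rho_adj.
  rewrite -(@sd_hatE _ _ _ _ _ _ X') sigmat_adjoint.
  have -> : pd_sigma (S^dag) (ptens X S1) = ptens X (S^dag ** S1).
    by apply: pd_sigma_tens; exact: commutant_id.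
  rewrite sd_hatE -LE /=; congr (bop_fun _ _).
  by rewrite st_rhoM.
(* Under [L], [e_hat] becomes [V] and [sigmat] becomes composition with [rho], so pairing with
   [e_hat] is compression by [V]. *)
have Le : L ee = V.
  apply: adj_inj; apply: st_bop_eq => S h; rewrite LE hatE.
  rewrite pd_tens_ip; [|exact: commutant_id|exact: commutant_id].
  by rewrite adj_id bop_comp1l bop_comp1l bop_comp1r (st_dilation D).
have Fform S : ip (F (sigmat S ee)) ee = t%:C *: theta S.
  rewrite Lip hF Lsig Le; apply: bop_ext => h; apply: inner_ext => k.
  rewrite innerC [RHS]innerC; congr (_ ^*).
  have := TE S h (bop_id H) k; rewrite st_unital adj_id bop_comp1l /= => <-.
  by rewrite -adjPr.
have PF : P_set (pi := pi) sigmat F.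
  split.
  - by exists F; apply: (lift_adj T) => //; exact: pos_op_adj.
  - move=> S; apply/funext => tau /=; apply: Linj; rewrite hF !Lsig hF.
    by rewrite !bop_compA cT//; exact: imageT.
  - by exists F1, F1; split=> //; exact: (lift_adj R1).
  - exists F2, F2; split; first exact: (lift_adj R2).
    apply/funext => tau; apply: Linj; rewrite /= !hF2 bop_compA R2R2.
    apply: adj_inj; apply: st_bop_eq => S h.
    rewrite LE; change ((tau (ptens X S) - (F tau : dual (pd_module X)) (ptens X S)) h
      = (((bop_id K - T) ** L tau)^dag) (rho S (V h))).
    rewrite bop_compBl adjB bop_comp1l -hF.
    change (tau (ptens X S) h - (F tau : dual (pd_module X)) (ptens X S) h
      = (L tau)^dag (rho S (V h)) - (L (F tau))^dag (rho S (V h))).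
    by rewrite !LE.
  - by exists t, theta.
pose I (y : Y) := t%:C *: y.
have FI : (1 : R)%:C *: F + (-1 : R)%:C *: I = 0.
  apply: cond.
    exists 1, (-1), F, I; split; [by apply/andP; split; lra|by apply/andP; split; lra
      |exact: PF|exact: id_P_set|by []].
  move=> a; have -> : ((1 : R)%:C *: F + (-1 : R)%:C *: I) (sigmat (pi a) ee)
      = (-1) *: (t%:C *: sigmat (pi a) ee) + F (sigmat (pi a) ee).
    change ((1 : R)%:C *: F (sigmat (pi a) ee) + (-1 : R)%:C *: (t%:C *: sigmat (pi a) ee)
      = (-1) *: (t%:C *: sigmat (pi a) ee) + F (sigmat (pi a) ee)).
    by rewrite rmorphN1 scale1r addrC.
  rewrite hm_ip_linear Fform e_hatE.
  rewrite hm_ip_scalel sd_hat_ptens adj_id bop_comp1l.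
  case: wth => _ _ ->; case: hphi => _ _ ->.
  by rewrite scaleN1r addNr.
have FI' tau : F tau = t%:C *: tau.
  have := congr1 (fun f : Y -> Y => f tau) FI.
  change ((1 : R)%:C *: F tau + (-1 : R)%:C *: (t%:C *: tau) = 0 -> F tau = t%:C *: tau).
  by rewrite rmorphN1 scale1r scaleN1r => /eqP; rewrite subr_eq0 => /eqP.
apply/funext => S; change (t%:C *: theta S = t%:C *: phi S).
rewrite -Fform FI'.
by rewrite hm_ip_scalel e_hatE sd_hat_ptens adj_id bop_comp1l.
Qed.

End PaschkeConditions.

(** * Equivalence of the four conditions *)

Theorem theorem3p4 (R : realType) (A : unitalCstarAlgType R)
    (H : hilbertType R) (pi : A -> 'B(H))
    (hpi : nondegenerate_representation pi)
    (hWE : WE pi !=set0)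
    (phi : 'B(H) -> 'B(H)) (hphi : WE pi phi)
    (D : minimal_stinespring phi)
    (X : paschke_dilation pi phi)
    (X' : selfdual_extension (pd_module X))
    (sigmat : 'B(H) -> sd_module X' -> sd_module X')
    (hsigmat : is_sigma_tilde sigmat) :
  [<-> extreme_point (WE pi) phi;
       forall (t : R) (phi0 : 'B(H) -> 'B(H)), 0 < t < 1 ->
         order_interval pi phi phi0 ->
         (exists2 theta, WE pi theta & phi0 = t%:C *: theta) ->
         phi0 = t%:C *: phi;
       faithful_subspace (rho_piA_VH pi D) (C_S_set pi D);
       forall T, C_P_set sigmat T ->
         (forall a, hm_ip (T (sigmat (pi a) (e_hat X'))) (e_hat X') = 0) ->
         T = 0].
Proof.
have ext_int := extreme_interval hphi.
tfae.
- exact: ext_int.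
- exact: interval_faithful.
(* From (3) to (4) through (1) and (2): operators on [K] and on [X'] are related by the maps in
   [[0, phi]] that they compress to. *)
- move=> /(faithful_extreme hpi hphi)/ext_int.
  exact: interval_paschke.
- exact: (paschke_extreme hpi hphi D hsigmat).
Qed.
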